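(* Let $\mathbb{F}\in\{\mathbb{R},\mathbb{C},\mathbb{H}\}$ with $n\ge2$, or $\mathbb{F}=\mathbb{O}$ with $n=2$, let $d=\dim_{\mathbb{R}}\mathbb{F}$ and $1\le m\le n-1$. There exists a constant $c>0$ depending only on $m,n,d$ such that for all $\lambda,\nu\in i\mathbb{R}$, $$\ell^{\mathrm{mod}}_{\lambda,\nu}(\phi_\lambda,\psi_\nu)=c\cdot\frac{\Gamma(\frac{\lambda+\rho+1}{2})\Gamma(\frac{\lambda+\rho-\nu-\rho_H}{2})\Gamma(\frac{\lambda+\rho+\nu-\rho_H}{2})}{\Gamma(\frac{\lambda+\rho-d+2}{2})\Gamma(\lambda+\rho)}.$$
   Context: Put $\rho=\frac12(nd+d-2)$, $\rho_H=\frac12(md+d-2)$. Identify $\overline N=\mathbb{F}^{n-1}\oplus\operatorname{Im}\mathbb{F}$ with group law $(x,z)\cdot(x',z')=(x+x',\,z+z'+\tfrac12(x^*x'-x'^*x))$, where $x^*x'=\sum_i\overline{x_i}x'_i$, and $\overline N_H=\mathbb{F}^{m-1}\oplus\operatorname{Im}\mathbb{F}$ embedded in $\overline N$ via $\mathbb{F}^{m-1}\subseteq\mathbb{F}^{n-1}$ as the first $m-1$ coordinates; both carry Lebesgue measure. Write $x=(x_1,x_2)\in\mathbb{F}^{m-1}\oplus\mathbb{F}^{n-m}$, $|x|$ the Euclidean norm, and $\mathcal N(x,z)=(|x|^4+4|z|^2)^{1/4}$. Define $\phi_\lambda(x,z)=((1+|x|^2)^2+4|z|^2)^{-\frac{\lambda+\rho}{2}}$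 on $\overline N$, $\psi_\nu(y,w)=((1+|y|^2)^2+4|w|^2)^{-\frac{\nu+\rho_H}{2}}$ on $\overline N_H$, the kernel $K_{\lambda,\nu}((x,z),(y,w))=\mathcal N((-x,-z)\cdot(y,w))^{-2(\nu+\rho_H)}|x_2|^{(\lambda-\rho)+(\nu+\rho_H)}$, and the bilinear form $\ell^{\mathrm{mod}}_{\lambda,\nu}(u,v)=\int_{\overline N}\int_{\overline N_H}K_{\lambda,-\nu}((x,z),(y,w))\,u(x,z)\,v(y,w)\,d(y,w)\,d(x,z)$. *)

(* Defs.v *)
From HB Require Import structures.
From mathcomp Require Import all_boot all_order all_algebra.
From mathcomp Require Import complex.
From mathcomp Require Import all_classical all_reals all_analysis.

Set Implicit Arguments.
Unset Strict Implicit.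
Unset Printing Implicit Defensive.
Import Order.TTheory GRing.Theory Num.Theory.
Import numFieldNormedType.Exports.

Local Open Scope classical_set_scope.
Local Open Scope ring_scope.
Local Open Scope complex_scope.

(* The library's sigma-finite instance on m1 \x m2 for sigma-finite m1 and m2 is
   shadowed by its instance for subprobabilities; sigma_finite_prod m1 m2 is m1 \x m2
   packed with the former. *)
Section sigma_finite_prod.
Context d1 d2 (T1 : measurableType d1) (T2 : measurableType d2) (R : realType).
Variables (m1 : {sigma_finite_measure set T1 -> \bar R}).
Variables (m2 : {sigma_finite_measure set T2 -> \bar R}).

Lemma product_sigma_finite : sigma_finite setT (m1 \x m2)%E.
Proof.
have /sigma_finiteP[F [TF ndF Foo]] := sigma_finiteT m1.
have /sigma_finiteP[G [TG ndG Goo]] := sigma_finiteT m2.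
exists (fun n => F n `*` G n).
  rewrite -setXTT TF TG predeqE => -[x y]; split.
    move=> [/= [n _ Fnx] [k _ Gky]]; exists (maxn n k) => //; split.
    - by move: x Fnx; exact/subsetPset/ndF/leq_maxl.
    - by move: y Gky; exact/subsetPset/ndG/leq_maxr.
  by move=> [n _ []/= ? ?]; split; exists n.
move=> k; have [? ?] := Foo k; have [? ?] := Goo k.
split; first exact: measurableX.
by rewrite product_measure1E// lte_mul_pinfty// ge0_fin_numE.
Qed.

Definition sigma_finite_prod : {sigma_finite_measure set (T1 * T2)%type -> \bar R} :=
  HB.pack (m1 \x m2)%E (Measure_isSigmaFinite.Build _ _ _ (m1 \x m2)%E
    product_sigma_finite).

End sigma_finite_prod.

(* Power of a sigma-finite measure, on n.-tuple T.  For n = 0 this is the unit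
   mass on the one-point space, so Lebesgue measure on R^0 has mass 1. *)
Section tuple_measure.
Context d (T : measurableType d) (R : realType).
Variable mu : {sigma_finite_measure set T -> \bar R}.

Definition tuple_cons n (p : T * n.-tuple T) : n.+1.-tuple T :=
  [tuple of p.1 :: p.2].

Lemma measurable_tuple_cons n : measurable_fun [set: T * n.-tuple T] (@tuple_cons n).
Proof. exact: (@measurable_cons _ _ _ _ fst n snd). Qed.

Section cons_measure.
Variables (n : nat) (nu : {sigma_finite_measure set (n.-tuple T) -> \bar R}).

Definition cons_measure : set (n.+1.-tuple T) -> \bar R :=
  pushforward (mu \x nu)%E (@tuple_cons n).

Let cons_measure0 : cons_measure set0 = 0%E.
Proof. by rewrite /cons_measure /pushforward preimage_set0 measure0. Qed.

Let cons_measure_ge0 A : (0 <= cons_measure A)%E.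
Proof. by rewrite /cons_measure /pushforward; exact: measure_ge0. Qed.

Let measurable_preimage_cons A : measurable A -> measurable (@tuple_cons n @^-1` A).
Proof. by move=> mA; rewrite -[X in measurable X]setTI; exact: measurable_tuple_cons. Qed.

Let cons_measure_sigma_additive : semi_sigma_additive cons_measure.
Proof.
move=> F mF tF mUF; rewrite /cons_measure /pushforward preimage_bigcup.
apply: measure_semi_sigma_additive.
- by move=> i; exact: measurable_preimage_cons.
- apply/trivIsetP => /= i j _ _ ij; rewrite -preimage_setI.
  by move/trivIsetP : tF => /(_ _ _ _ _ ij) ->//; rewrite preimage_set0.
- by rewrite -preimage_bigcup; exact: measurable_preimage_cons.
Qed.

HB.instance Definition _ := isMeasure.Build _ _ _ cons_measure
  cons_measure0 cons_measure_ge0 cons_measure_sigma_additive.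

Let cons_measure_sigma_finite : sigma_finite setT cons_measure.
Proof.
have [F TF mF] := product_sigma_finite mu nu.
pose unc (t : n.+1.-tuple T) : T * n.-tuple T := (thead t, [tuple of behead t]).
have munc : measurable_fun [set: n.+1.-tuple T] unc.
  by apply/measurable_fun_pair; [exact: measurable_tnth|exact: measurable_behead].
have consK : cancel (@tuple_cons n) unc.
  move=> [x t]; rewrite /unc /tuple_cons; congr pair; exact/val_inj.
exists (fun i => unc @^-1` F i); first by rewrite -preimage_bigcup -TF preimage_setT.
move=> i; have [mFi Fioo] := mF i; split.
  by rewrite -[X in measurable X]setTI; exact: munc.
rewrite /cons_measure /pushforward.
by rewrite [X in (mu \x nu)%E X](_ : _ = F i)//; apply/funext => x/=; rewrite consK.
Qed.

HB.instance Definition _ := Measure_isSigmaFinite.Build _ _ _ cons_measure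
  cons_measure_sigma_finite.

End cons_measure.

Fixpoint tuple_measure n : {sigma_finite_measure set (n.-tuple T) -> \bar R} :=
  if n is n'.+1 then cons_measure (tuple_measure n') else \d_([tuple] : 0.-tuple T).

End tuple_measure.

Section complex_analysis.
Context {R : realType}.

(* a ^ s for a > 0; the value at a = 0 is a junk value. *)
Definition cpow (a : R) (s : R[i]) : R[i] :=
  let r := expR (complex.Re s * ln a) in
  let t := complex.Im s * ln a in
  (r * cos t) +i* (r * sin t).

Section cintegral.
Context d (T : measurableType d) (mu : {measure set T -> \bar R}) (D : set T).

Definition cintegral (f : T -> R[i]) : R[i] :=
  (\int[mu]_(x in D) complex.Re (f x)) +i* (\int[mu]_(x in D) complex.Im (f x)).

Definition cintegrable (f : T -> R[i]) : Prop :=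
  mu.-integrable D (fun x => (complex.Re (f x))%:E) /\
  mu.-integrable D (fun x => (complex.Im (f x))%:E).

End cintegral.

(* Euler's integral, hence the Gamma function on the half-plane Re s > 0 only. *)
Definition cGamma (s : R[i]) : R[i] :=
  cintegral (@lebesgue_measure R) `]0, +oo[
    (fun t : R => cpow t (s - 1) * (expR (- t))%:C).

End complex_analysis.

(* The k-th Cayley-Dickson algebra over R, of dimension d = 2 ^ k: it is R, C, H, O
   for k = 0, 1, 2, 3.  In the functions below an element is given by its
   coordinates (only those of index < 2 ^ k matter): index 0 is the real part and
   the pair (a, a') of the doubling process is a followed by a'.  The doubling is
   (a, a') (b, b') = (a b - conj b' a', b' a + a' conj b). *)
Section cayley_dickson.
Context {R : realType}.

Definition cd_conj (a : nat -> R) : nat -> R :=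
  fun i => if i == 0%N then a 0%N else - a i.

Fixpoint cd_mul (k : nat) (a b : nat -> R) : nat -> R :=
  if k is l.+1 then
    let a' i := a (2 ^ l + i)%N in
    let b' i := b (2 ^ l + i)%N in
    fun i =>
      if (i < 2 ^ l)%N then cd_mul l a b i - cd_mul l (cd_conj b') a' i
      else cd_mul l b' a (i - 2 ^ l)%N + cd_mul l a' (cd_conj b) (i - 2 ^ l)%N
  else fun=> a 0%N * b 0%N.

End cayley_dickson.

(* F as a measurable space of coordinates, and the group F^(n-1) (+) Im F, where
   Im F has the coordinates of index 1, ..., d - 1 of F. *)
Notation cdalg R k := ((2 ^ k).-tuple (measurableTypeR R)).
Notation heis R k n :=
  ((n.-1).-tuple (cdalg R k) * ((2 ^ k).-1).-tuple (measurableTypeR R))%type.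

Section heisenberg.
Context {R : realType} (k : nat).

(* Lebesgue measure on F^(n-1) (+) Im F. *)
Definition heis_measure n : {sigma_finite_measure set (heis R k n) -> \bar R} :=
  sigma_finite_prod
    (tuple_measure (tuple_measure (@lebesgue_measure R) (2 ^ k)) n.-1)
    (tuple_measure (@lebesgue_measure R) (2 ^ k).-1).

(* x^* x' = \sum_i conj x_i x'_i, in coordinates. *)
Definition hprod p (x x' : p.-tuple (cdalg R k)) : nat -> R := fun j =>
  \sum_(i < p) cd_mul k (cd_conj (nth 0 (tnth x i))) (nth 0 (tnth x' i)) j.

Definition heis_mul n (g h : heis R k n) : heis R k n :=
  ([tuple [tuple tnth (tnth g.1 i) j + tnth (tnth h.1 i) j | j < 2 ^ k] | i < n.-1],
   [tuple tnth g.2 j + tnth h.2 j +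
          (hprod g.1 h.1 j.+1 - hprod h.1 g.1 j.+1) / 2 | j < (2 ^ k).-1]).

Definition heis_opp n (g : heis R k n) : heis R k n :=
  ([tuple [tuple - tnth (tnth g.1 i) j | j < 2 ^ k] | i < n.-1],
   [tuple - tnth g.2 j | j < (2 ^ k).-1]).

(* The embedding F^(m-1) (+) Im F -> F^(n-1) (+) Im F, for m <= n. *)
Definition heis_embed m n (h : heis R k m) : heis R k n :=
  ([tuple nth [tuple of nseq (2 ^ k) 0] h.1 i | i < n.-1], h.2).

Definition vnorm (x : seq (cdalg R k)) : R :=
  Num.sqrt (\sum_(a <- x) \sum_(t <- (a : seq R)) t ^+ 2).

Definition inorm (z : seq R) : R := Num.sqrt (\sum_(t <- z) t ^+ 2).

Definition heis_norm n (g : heis R k n) : R :=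
  (vnorm g.1 ^+ 4 + 4 * inorm g.2 ^+ 2) `^ (4^-1).

(* rho for n, rho_H for m. *)
Definition rho (n : nat) : R := (n%:R * (2 ^ k)%:R + (2 ^ k)%:R - 2) / 2.

(* phi_lambda for n, psi_nu for m. *)
Definition spherical n (s : R[i]) (g : heis R k n) : R[i] :=
  cpow ((1 + vnorm g.1 ^+ 2) ^+ 2 + 4 * inorm g.2 ^+ 2)
       (- ((s + (rho n)%:C) / 2)).

Definition kern n m (lambda nu : R[i]) (g : heis R k n) (h : heis R k m) : R[i] :=
  cpow (heis_norm (heis_mul (heis_opp g) (heis_embed n h)))
       (- (2 * (nu + (rho m)%:C))) *
  cpow (vnorm (drop m.-1 g.1))
       ((lambda - (rho n)%:C) + (nu + (rho m)%:C)).

Definition ell_integrand n m (lambda nu : R[i])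
    (u : heis R k n -> R[i]) (v : heis R k m -> R[i])
    (g : heis R k n) (h : heis R k m) : R[i] :=
  kern lambda (- nu) g h * u g * v h.

Definition ell_mod n m (lambda nu : R[i])
    (u : heis R k n -> R[i]) (v : heis R k m -> R[i]) : R[i] :=
  cintegral (heis_measure n) setT (fun g =>
    cintegral (heis_measure m) setT (fun h => ell_integrand lambda nu u v g h)).

(* Absolute convergence of the double integral, without which the value of
   ell_mod above would be meaningless. *)
Definition ell_mod_cvg n m (lambda nu : R[i])
    (u : heis R k n -> R[i]) (v : heis R k m -> R[i]) : Prop :=
  cintegrable (heis_measure n \x heis_measure m)%E setT
    (fun gh => ell_integrand lambda nu u v gh.1 gh.2).

End heisenberg.

(* Main.v *)
(* Write x = (x_1, x_2), r = |x_2|, R = (1 + |x|^2)^2 + 4 |z|^2, E = (1 + |y|^2)^2 + 4 |w|^2,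
   and Q for the fourth power of the gauge of (-x, -z) (y, w).  The integrand depends on x_2
   only through r, and in the coordinates (x_1, z, a) with a = |x|^2 the measure
   r^(-2 rho) dx dz becomes, up to a constant, the measure on the Siegel domain a > |x_1|^2
   which is invariant under the translations of the small Heisenberg group, the dilations and
   the inversion.  For fixed (y, w) a composite of these motions carries the pair
   (Q / r^2, R / r^2) to (E / r^2, R / r^2).  Hence the double integral is the product of the
   integral of E^(-rho_H), a constant, and that of r^(lambda - rho - nu + rho_H)
   R^(-(lambda + rho) / 2).  The scalings z = (1 + |x|^2) z' / 2 and x_1 = (1 + r^2)^(1/2) x_1'
   factor the latter into three radial beta integrals.  Their Gamma factors are brought to
   the stated form with the functional equation alone, since multiplying
   Gamma(t/2) Gamma((t+1)/2) / Gamma(t) by 2^t leaves a 1-periodic function of t. *)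
Require Import Defs.
From HB Require Import structures.
From mathcomp Require Import all_boot all_order all_algebra.
From mathcomp Require Import complex ring lra zify.
From mathcomp Require Import all_classical all_reals all_analysis measurable_realfun.
Set Implicit Arguments.
Unset Strict Implicit.
Unset Printing Implicit Defensive.
Import Order.TTheory GRing.Theory Num.Theory.
Import numFieldNormedType.Exports.
Local Open Scope classical_set_scope.
Local Open Scope ring_scope.
Local Open Scope complex_scope.

(** * Lebesgue measure and its powers *)

(** The domain a > |x_1|^2 is a model of the hyperbolic space of the small group. On it R / r^2 is a
    function of the distance to the base point (0, 0, 1), while Q / r^2 and 1 / r^2 are
    horospherical functions centred at the boundary point (y, w) and at infinity. The composite
    motion fixes the base point and matches the two centres, which is why Q is replaced by the
    constant E. Two obstacles shape the proof. No Jacobian is computed: the inversion acts on zeta =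
    a + 2 z by conj zeta / |zeta|^2 and, for fixed zeta, on x_1 as a similarity, so its density
    follows from an average over dilations and from invariance under linear isometries. And
    octonions do not associate: the algebra rests on the alternative laws and the multiplicative
    norm, and associativity serves only inside sums over the coordinates of x_1, which are empty for
    F = O because n = 2 forces m = 1. Changes of variables are proved for functions with values in
    [0, +oo]; complex integrals inherit value and convergence from them. Most constants stay
    implicit, as only the existence of c is claimed. *)

Section lebesgue_affine.
Context {R : realType}.
Local Notation L := (@lebesgue_measure R).
Local Open Scope ereal_scope.

Lemma lebesgue_measure_shift (a : R) (A : set R) : measurable A ->
  pushforward L (+%R a : _ -> measurableTypeR R) A = L A.
Proof.
move=> mA; apply/esym/lebesgue_measure_unique => //=; first exact: measurable_funD.
move=> ? _ [[b c]] _ <-.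
rewrite /pushforward (_ : _ @^-1` _ = `](b - a)%R, (c - a)%R]%classic).
  rewrite !lebesgue_measure_itv/= !lte_fin ltrD2r.
  by case: ifP => // _; rewrite -!EFinB; congr EFin; lra.
by apply/seteqP; split => x/=; rewrite !in_itv/= => /andP[? ?]; apply/andP; split; lra.
Qed.

Lemma ge0_integral_shift (a : R) (f : R -> \bar R) :
  measurable_fun setT f -> (forall x, 0 <= f x) ->
  \int[L]_x f (a + x)%R = \int[L]_x f x.
Proof.
move=> mf f0.
have -> : \int[L]_x f (a + x)%R =
    \int[pushforward L (+%R a : R -> measurableTypeR R)]_x f x.
  by rewrite ge0_integral_pushforward//; exact: measurable_funD.
apply: eq_measure_integral => [|? A mA _]; first exact: measurable_funD.
exact: lebesgue_measure_shift.
Qed.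

Lemma ge0_integral_scale (t : R) (f : R -> \bar R) : (0 < t)%R ->
  measurable_fun setT f -> (forall x, 0 <= f x) ->
  \int[L]_x f (t * x)%R = t^-1%:E * \int[L]_x f x.
Proof.
move=> t0 mf f0.
have mt : measurable_fun setT ( *%R t : R -> measurableTypeR R).
  exact: measurable_funM.
pose mu := mscale (NngNum (ltW t0))
  (measure_function_pushforward__canonical__measure_function_Measure L mt).
have -> : \int[L]_x f x = \int[mu]_x f x.
  apply: eq_measure_integral => A mA _.
  apply: lebesgue_measure_unique => //= _ [[b c]] _ <-.
  rewrite /mscale/= /pushforward (_ : _ @^-1` _ = `](t^-1 * b)%R, (t^-1 * c)%R]%classic).
    rewrite !lebesgue_measure_itv/= !lte_fin ltr_pM2l ?invr_gt0//.
    case: ifP => // _; last by rewrite mule0.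
    by rewrite -!EFinB -EFinM -mulrBr mulrA divff ?gt_eqF// mul1r.
  apply/seteqP; split => x/=; rewrite !in_itv/=.
    by rewrite ltr_pdivrMl// ler_pdivlMl.
  by rewrite ltr_pdivrMl// ler_pdivlMl.
rewrite ge0_integral_mscale//= muleA -EFinM mulVf ?mul1e ?gt_eqF//.
by rewrite ge0_integral_pushforward.
Qed.

Lemma ge0_integral_opp (f : R -> \bar R) :
  measurable_fun setT f -> (forall x, 0 <= f x) ->
  \int[L]_x f (- x)%R = \int[L]_x f x.
Proof.
move=> mf f0.
have -> : \int[L]_x f (- x)%R =
    \int[pushforward L (-%R : R -> measurableTypeR R)]_x f x.
  rewrite ge0_integral_pushforward//.
by apply: eq_measure_integral => A mA _; exact: lebesgue_measureN.
Qed.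

End lebesgue_affine.

Section sigma_finite_prod_integral.
Context d1 d2 (T1 : measurableType d1) (T2 : measurableType d2) {R : realType}.
Variables (m1 : {sigma_finite_measure set T1 -> \bar R}).
Variables (m2 : {sigma_finite_measure set T2 -> \bar R}).
Local Open Scope ereal_scope.

Lemma integral_sigma_finite_prod (f : T1 * T2 -> \bar R) :
  measurable_fun setT f -> (forall x, 0 <= f x) ->
  \int[sigma_finite_prod m1 m2]_p f p = \int[m1]_x \int[m2]_y f (x, y).
Proof. by move=> mf f0; rewrite [LHS]fubini_tonelli1. Qed.

Lemma integral_sigma_finite_prod_swap (f : T1 * T2 -> \bar R) :
  measurable_fun setT f -> (forall x, 0 <= f x) ->
  \int[sigma_finite_prod m1 m2]_p f p = \int[m2]_y \int[m1]_x f (x, y).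
Proof. by move=> mf f0; rewrite [LHS]fubini_tonelli2. Qed.

End sigma_finite_prod_integral.

Section tuple_integral.
Context d (T : measurableType d) {R : realType}.
Variable mu : {sigma_finite_measure set T -> \bar R}.
Local Open Scope ereal_scope.

Lemma integral_tuple0 (f : 0.-tuple T -> \bar R) : measurable_fun setT f ->
  \int[tuple_measure mu 0]_t f t = f [tuple].
Proof. by move=> mf; rewrite [LHS]integral_dirac//= diracT mul1e. Qed.

Lemma integral_tupleS n (f : n.+1.-tuple T -> \bar R) :
  measurable_fun setT f -> (forall x, 0 <= f x) ->
  \int[tuple_measure mu n.+1]_t f t =
  \int[mu]_x \int[tuple_measure mu n]_t f [tuple of x :: t].
Proof.
move=> mf f0.
rewrite [LHS](_ : _ = \int[pushforward (mu \x tuple_measure mu n) (@tuple_cons _ T n)]_t f t)//.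
rewrite ge0_integral_pushforward//=; last exact: measurable_tuple_cons.
rewrite fubini_tonelli1//.
by apply: measurableT_comp => //; exact: measurable_tuple_cons.
Qed.

End tuple_integral.

(** * Dilations and measurability *)

(** Syntax-directed measurability on the whole space. Local hypotheses serve as leaves; joint
    measurability of a curried [F] is looked up in the form [fun p => F p.1 p.2]. *)
Ltac mfun1 :=
  first
  [ assumption
  | exact: measurable_cst
  | exact: measurable_id
  | exact: measurable_fst
  | exact: measurable_snd
  | exact: measurable_tnth
  | exact: measurable_expR
  | exact: measurable_ln
  | match goal with
    | H : measurable_fun setT ?f |- measurable_fun _ (fun x => ?f (@?g x)) =>
        apply: (measurableT_comp (g := g) H)
    | H : measurable_fun setT (fun p => ?F p.1 p.2)
      |- measurable_fun _ (fun x => ?F (@?a x) (@?b x)) =>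
        refine (@measurableT_comp _ _ _ _ _ _ _ _ (fun x => (a x, b x)) H _)
    | |- measurable_fun _ (fun x => expR (@?g x)) =>
        apply: (measurableT_comp (g := g) (@measurable_expR _))
    | |- measurable_fun _ (fun x => ln (@?g x)) =>
        apply: (measurableT_comp (g := g) (@measurable_ln _))
    | |- measurable_fun _ (fun x => fst (@?g x)) =>
        apply: (measurableT_comp (g := g) measurable_fst)
    | |- measurable_fun _ (fun x => snd (@?g x)) =>
        apply: (measurableT_comp (g := g) measurable_snd)
    | |- measurable_fun _ (fun x => tnth (@?g x) ?i) =>
        apply: (measurableT_comp (g := g) (measurable_tnth i))
    | |- measurable_fun _ (fun x => (@?g x)%:E) => apply/measurable_EFinP; rewrite /comp/=
    | |- measurable_fun _ (fun x => (@?a x, @?b x)) => apply: measurable_fun_pair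
    | |- measurable_fun _ (fun x => (@?a x * @?b x)%E) => apply: emeasurable_funM
    | |- measurable_fun _ (fun x => (@?a x + @?b x)%E) => apply: emeasurable_funD
    | |- measurable_fun _ (fun x => (@?a x * @?b x)%R) => apply: measurable_funM
    | |- measurable_fun _ (fun x => (@?a x - @?b x)%R) => apply: measurable_funB
    | |- measurable_fun _ (fun x => (@?a x + @?b x)%R) => apply: measurable_funD
    | |- measurable_fun _ (fun x => (- @?a x)%R) =>
        apply: (measurableT_comp (g := a) (@oppr_measurable _ _))
    | |- measurable_fun _ (fun x => (@?a x ^+ ?n)%R) => apply: measurable_funX
    | |- measurable_fun _ (fun x => (@?a x < @?b x)%R) => apply: measurable_fun_ltr
    | |- measurable_fun _ (fun x => (@?a x <= @?b x)%R) => apply: measurable_fun_ler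
    | |- measurable_fun _ (fun x => (@?a x == @?b x)%R) => apply: measurable_fun_eqr
    | |- measurable_fun _ (fun x => @?a x && @?b x) => apply: measurable_and
    end
  | apply: measurable_fun_ler
  | apply: measurable_fun_ltr
  | apply: measurable_fun_ifT
  | apply: measurable_sum => ?
  ].
Ltac mfun := repeat mfun1.
Tactic Notation "mcomp" constr(H) uconstr(g) :=
  refine (@measurableT_comp _ _ _ _ _ _ _ _ g H _); mfun.

Section iterated.
Context d1 d2 (T1 : measurableType d1) (T2 : measurableType d2) {R : realType}.
Variables (m1 : {sigma_finite_measure set T1 -> \bar R}).
Variables (m2 : {sigma_finite_measure set T2 -> \bar R}).
Local Open Scope ereal_scope.
Variable F : T1 -> T2 -> \bar R.
Hypothesis mF : measurable_fun setT (fun p : T1 * T2 => F p.1 p.2).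
Hypothesis F0 : forall x y, 0 <= F x y.

Lemma measurable_iterated : measurable_fun setT (fun x => \int[m2]_y F x y).
Proof.
by have := measurable_fun_fubini_tonelli_F (m2 := m2) _ mF (fun p => F0 p.1 p.2).
Qed.

Lemma tonelli : \int[m1]_x \int[m2]_y F x y = \int[m2]_y \int[m1]_x F x y.
Proof.
by have := fubini_tonelli (m1 := m1) (m2 := m2) _ mF (fun p => F0 p.1 p.2).
Qed.

End iterated.
Arguments measurable_iterated {d1 d2 T1 T2 R m2} F.
Arguments tonelli {d1 d2 T1 T2 R m1 m2} F.

(* Modelled on the dilations of R^q and N x = |x|^2. *)
Record nspace (R : realType) d (T : measurableType d)
    (mu : {sigma_finite_measure set T -> \bar R})
    (sc : R -> T -> T) (N : T -> R) (q : nat) : Prop := NSpace {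
  ns_meas_sc : measurable_fun setT (fun p : measurableTypeR R * T => sc p.1 p.2) ;
  ns_meas : measurable_fun setT N ;
  ns_ge0 : forall x, 0 <= N x ;
  ns_scale : forall t x, N (sc t x) = t ^+ 2 * N x ;
  ns_scaleA : forall s t x, sc s (sc t x) = sc (s * t) x ;
  ns_scale1 : forall x, sc 1 x = x ;
  ns_integral_scale : forall t (f : T -> \bar R), 0 < t ->
    measurable_fun setT f -> (forall x, 0 <= f x)%E ->
    (\int[mu]_x f (sc t x) = (t ^- q)%:E * \int[mu]_x f x)%E ;
  ns_gauss : exists2 c : R, 0 < c & (\int[mu]_x (expR (- N x))%:E = c%:E)%E
}.

Section nspace_instances.
Context {R : realType}.
Local Notation L := (@lebesgue_measure R).

Lemma nspace_lebesgue : nspace (T := measurableTypeR R) L *%R (fun x : R => x ^+ 2) 1.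
Proof.
split.
- by mfun.
- by mfun.
- by move=> x; exact: sqr_ge0.
- by move=> t x; rewrite exprMn.
- by move=> s t x; rewrite mulrA.
- by move=> x; rewrite mul1r.
- by move=> t f t0 mf f0; rewrite expr1 ge0_integral_scale.
- exists (Num.sqrt pi); first by rewrite sqrtr_gt0 pi_gt0.
  by rewrite -integralT_gauss.
Qed.

Context d (T : measurableType d).
Variables (mu : {sigma_finite_measure set T -> \bar R}) (sc : R -> T -> T)
  (N : T -> R) (q : nat).
Hypothesis H : nspace mu sc N q.

Definition tuple_scale n (t : R) (x : n.-tuple T) : n.-tuple T := map_tuple (sc t) x.

Let mN := ns_meas H.
Let msc := ns_meas_sc H.

Lemma nspace_tuple n :
  nspace (tuple_measure mu n) (@tuple_scale n)
    (fun x => \sum_(a <- x) N a) (n * q).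
Proof.
have mS k : measurable_fun setT (fun x : k.-tuple T => \sum_(a <- x) N a).
  by under eq_fun do rewrite big_tuple; mfun.
have msct k t : measurable_fun setT (@tuple_scale k t).
  apply/measurable_fun_tnthP => i; rewrite (_ : _ \o _ = fun x => sc t (tnth x i)).
    by mfun.
  by apply/funext => x/=; rewrite tnth_map.
split.
- apply/measurable_fun_tnthP => i.
  rewrite (_ : _ \o _ = fun x => sc x.1 (tnth x.2 i)).
    by mfun.
  by apply/funext => x/=; rewrite tnth_map.
- exact: mS.
- by move=> x; apply: sumr_ge0 => a _; exact: ns_ge0 H a.
- move=> t x; rewrite /tuple_scale/= big_map mulr_sumr.
  by apply: eq_bigr => a _; exact: ns_scale H _ _.
- move=> s t x; apply: eq_from_tnth => i; rewrite !tnth_map; exact: ns_scaleA H _ _ _.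
- move=> x; apply: eq_from_tnth => i; rewrite !tnth_map; exact: ns_scale1 H _.
- move=> t f t0; elim: n f => [f mf f0|n IH f mf f0].
    rewrite !integral_tuple0 ?mul0n ?expr0 ?invr1 ?mul1e//.
      by congr f; exact: val_inj.
    by apply: (measurableT_comp mf); exact: msct.
  rewrite !integral_tupleS//; last by apply: (measurableT_comp mf); exact: msct.
  have mfc : measurable_fun setT (fun p : T * n.-tuple T => f [tuple of p.1 :: p.2]).
    by apply: measurableT_comp mf _; exact: measurable_tuple_cons.
  transitivity (\int[mu]_x ((t ^- (n * q))%:E * \int[tuple_measure mu n]_s f [tuple of sc t x :: s]))%E.
    apply: eq_integral => x _; rewrite -IH//.
      by apply: eq_integral => s _; congr f; exact: val_inj.
    by mcomp mfc (fun s => (sc t x, s)).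
  rewrite ge0_integralZl; [|by []| | |].
  + rewrite (ns_integral_scale H (f := fun x => \int[tuple_measure mu n]_s f [tuple of x :: s])%E)//.
    * by rewrite muleA -EFinM -invfM -exprD addnC mulSn.
    * exact: measurable_iterated.
    * by move=> x; apply: integral_ge0.
  + apply: measurable_iterated => //.
    by mcomp mfc (fun p : T * n.-tuple T => (sc t p.1, p.2)).
  + by move=> x _; apply: integral_ge0.
  + by rewrite lee_fin invr_ge0 exprn_ge0// ltW.
- elim: n => [|n [c c0 IH]].
    exists 1 => //; rewrite integral_tuple0; first by rewrite big_nil oppr0 expR0.
    by have h := mS 0%N; mfun.
  have [e e0 He] := ns_gauss H.
  exists (c * e); first exact: mulr_gt0.
  rewrite integral_tupleS//; last by have h := mS n.+1; mfun.
  transitivity (\int[mu]_x (c%:E * (expR (- N x))%:E))%E.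
    apply: eq_integral => x _; rewrite -IH muleC -ge0_integralZl//.
    + by apply: eq_integral => s _; rewrite -EFinM big_cons opprD expRD.
    + by have h := mS n; mfun.
  rewrite ge0_integralZl ?He//; first by mfun.
  by rewrite lee_fin ltW.
Qed.

(** Supplies the factor 4 of |a + 2 z|^2 = a^2 + 4 |z|^2. Dilating by the square root of c turns one
    Gaussian into the other. *)
Lemma nspace_weight (c : R) : 0 < c -> nspace mu sc (fun x => c * N x) q.
Proof.
move=> c0; have [msc' _ N0 Nsc scA sc1 int [e e0 He]] := H.
split => //.
- by mfun.
- by move=> x; rewrite mulr_ge0// ltW.
- by move=> t x; rewrite Nsc mulrCA.
- have sc0 : 0 < Num.sqrt c by rewrite sqrtr_gt0.
  exists (Num.sqrt c ^- q * e); first by rewrite mulr_gt0// invr_gt0 exprn_gt0.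
  rewrite EFinM -He -int//; last by mfun.
  by apply: eq_integral => x _; rewrite Nsc sqr_sqrtr// ltW.
Qed.

End nspace_instances.

Section nspace_prod.
Context {R : realType} d1 d2 (T1 : measurableType d1) (T2 : measurableType d2).
Variables (m1 : {sigma_finite_measure set T1 -> \bar R}) (sc1 : R -> T1 -> T1)
  (N1 : T1 -> R) (q1 : nat).
Variables (m2 : {sigma_finite_measure set T2 -> \bar R}) (sc2 : R -> T2 -> T2)
  (N2 : T2 -> R) (q2 : nat).
Hypotheses (H1 : nspace m1 sc1 N1 q1) (H2 : nspace m2 sc2 N2 q2).

Lemma nspace_prod : nspace (sigma_finite_prod m1 m2)
  (fun t p => (sc1 t p.1, sc2 t p.2)) (fun p => N1 p.1 + N2 p.2) (q1 + q2).
Proof.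
have [msc1 mN1 N10 Nsc1 scA1 sc11 int1 [e1 e10 He1]] := H1.
have [msc2 mN2 N20 Nsc2 scA2 sc12 int2 [e2 e20 He2]] := H2.
split.
- by mfun.
- by mfun.
- by move=> x; rewrite addr_ge0.
- by move=> t x; rewrite Nsc1 Nsc2 mulrDr.
- by move=> s t x; rewrite scA1 scA2.
- by move=> [x y]; rewrite sc11 sc12.
- move=> t f t0 mf f0; rewrite !integral_sigma_finite_prod//; last by mfun.
  transitivity (\int[m1]_x ((t ^- q2)%:E * \int[m2]_y f (sc1 t x, y)))%E.
    by apply: eq_integral => x _; rewrite -int2//; mfun.
  rewrite ge0_integralZl; [|by []| | |].
  + rewrite (int1 _ (fun x => \int[m2]_y f (x, y))%E)//.
    * by rewrite muleA -EFinM -invfM -exprD addnC.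
    * by apply: measurable_iterated => //; mfun.
    * by move=> x; apply: integral_ge0.
  + by apply: measurable_iterated => //; mfun.
  + by move=> x _; apply: integral_ge0.
  + by rewrite lee_fin invr_ge0 exprn_ge0// ltW.
- exists (e1 * e2); first exact: mulr_gt0.
  rewrite integral_sigma_finite_prod//; last by mfun.
  transitivity (\int[m1]_x (e2%:E * (expR (- N1 x))%:E))%E.
    apply: eq_integral => x _; rewrite -He2 muleC -ge0_integralZl//.
    + by apply: eq_integral => s _; rewrite -EFinM opprD expRD.
    + by mfun.
  rewrite ge0_integralZl ?He1//; last by rewrite lee_fin ltW.
  + by rewrite -EFinM mulrC.
  + by mfun.
Qed.

End nspace_prod.

(** * Polar coordinates by averaging over dilations *)

Section polar.
Context {R : realType} d (T : measurableType d).
Variables (mu : {sigma_finite_measure set T -> \bar R}) (sc : R -> T -> T)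
  (N : T -> R) (q : nat).
Hypothesis H : nspace mu sc N q.
Hypothesis q0 : (0 < q)%N.
Local Notation L := (@lebesgue_measure R).

Let mN := ns_meas H.
Let msc := ns_meas_sc H.

Local Open Scope ereal_scope.

(** The dilation by 2 preserves this set, so its measure is 2^-q times itself; and it is finite, the
    indicator being at most the Gaussian. *)
Lemma nspace_null : mu [set x | N x = 0%R] = 0.
Proof.
have mA : measurable [set x | N x = 0%R].
  rewrite (_ : [set _ | _] = N @^-1` [set 0%R])//.
  by rewrite -[X in measurable X]setTI; exact: mN.
pose z x : R := (if N x == 0 then 1 else 0)%R.
have zE : \int[mu]_x (z x)%:E = mu [set x | N x = 0%R].
  rewrite -[RHS]mul1e -[RHS]integral_cst//.
  rewrite [RHS]integral_mkcond; apply: eq_integral => x _.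
  rewrite /z patchE; case: eqP => Nx; first by rewrite mem_set.
  by rewrite memNset.
have mz : measurable_fun setT (fun x => (z x)%:E) by rewrite /z; mfun.
have z0 x : 0 <= (z x)%:E by rewrite /z; case: ifP; rewrite lee_fin.
have [c c0 Hc] := ns_gauss H.
have zfin : \int[mu]_x (z x)%:E < +oo.
  apply: (@le_lt_trans _ _ c%:E); last by rewrite ltry.
  rewrite -Hc; apply: ge0_le_integral => //.
  - by mfun.
  - move=> x _; rewrite lee_fin /z; case: eqP => [->|_]; last exact: expR_ge0.
    by rewrite oppr0 expR0.
have := ns_integral_scale H (f := fun x => (z x)%:E) (@ltr0n R 2) mz z0.
rewrite (_ : \int[mu]_x (z (sc 2 x))%:E = \int[mu]_x (z x)%:E); last first.
  apply: eq_integral => x _; rewrite /z (ns_scale H) mulf_eq0.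
  by rewrite sqrf_eq0 (pnatr_eq0 R 2).
rewrite -zE.
have : \int[mu]_x (z x)%:E \is a fin_num.
  by rewrite ge0_fin_numE//; exact: integral_ge0.
move=> /fineK <-; rewrite -EFinM => -[] e; congr EFin; move: e.
set a := fine _ => /eqP; rewrite -subr_eq0 -{1}(mul1r a) -mulrBl mulf_eq0.
have -> : ((1 - (2 ^+ q)^-1 == 0 :> R) = false)%R.
  by rewrite subr_eq0 eq_sym invr_eq1 gt_eqF// exprn_egt1 ?ltr1n// -lt0n.
by move/eqP.
Qed.

Lemma nspace_integral_gt0 (f : T -> \bar R) : measurable_fun setT f ->
  (forall x, 0 <= f x) ->
  \int[mu]_x (if (0 < N x)%R then f x else 0) = \int[mu]_x f x.
Proof.
move=> mf f0.
have mA : measurable [set x | N x = 0%R].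
  rewrite (_ : [set _ | _] = N @^-1` [set 0%R])//.
  by rewrite -[X in measurable X]setTI; exact: mN.
rewrite (ge0_negligible_integral mA _ _ _ nspace_null)//; last 2 first.
  by mfun.
  by move=> x _; case: ifP.
rewrite [RHS](ge0_negligible_integral mA _ _ _ nspace_null)//.
apply: eq_integral => x; rewrite inE/= => -[_ /eqP Nx].
by rewrite lt_def Nx (ns_ge0 H).
Qed.

(* Averaging over dilations needs no spheres: almost every orbit v |-> sc (e^v) x meets
   the annulus 1 <= N < e^2 for a set of v of measure 1. *)
Definition annulus (x : T) : R :=
  (if (0 < N x) && ((0 <= ln (N x)) && (ln (N x) < 2)) then 1 else 0)%R.

Lemma measurable_annulus : measurable_fun setT annulus.
Proof. by rewrite /annulus; mfun. Qed.
Let mw := measurable_annulus.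

Lemma annulus_ge0 x : (0 <= annulus x)%R.
Proof. by rewrite /annulus; case: ifP. Qed.

Lemma integral_annulus_ray x : (0 < N x)%R ->
  \int[L]_v (annulus (sc (expR (- v)) x))%:E = 1.
Proof.
move=> Nx.
pose g (v : R) : \bar R := (if (0 <= v) && (v < 1) then 1 else 0)%R%:E.
have mg : measurable_fun setT g by rewrite /g; mfun.
have g0 v : 0 <= g v by rewrite /g; case: ifP; rewrite lee_fin.
(* The condition 0 <= ln (N x) - 2 v < 2 says that ln (N x) / 2 - v lies in [0, 1). *)
transitivity (\int[L]_v g (ln (N x) / 2 + - v)%R).
  apply: eq_integral => v _; rewrite /g /annulus (ns_scale H).
  have e2 : (0 < expR (- v) ^+ 2 :> R)%R by rewrite exprn_gt0// expR_gt0.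
  rewrite pmulr_rgt0// Nx lnM// lnXn ?expR_gt0// expRK/=.
  congr (EFin (if _ && _ then _ else _)).
    by apply/idP/idP; lra.
  by apply/idP/idP; lra.
rewrite (ge0_integral_opp (f := fun v => g (ln (N x) / 2 + v)%R))//; last by mfun.
rewrite ge0_integral_shift//.
rewrite [RHS](_ : _ = \int[L]_(v in `[0%R, 1%R[) cst 1 v); last first.
  by rewrite integral_cst//= lebesgue_measure_itv/= lte01 oppr0 adde0 mul1e.
rewrite [RHS]integral_mkcond; apply: eq_integral => v _; rewrite patchE /g.
case: ifPn => h; first by rewrite mem_set//= in_itv.
by rewrite memNset//= in_itv; exact/negP.
Qed.

(** Insert the integral of [annulus (sc (expR (- v)) x)] over v, which is 1 for almost every x,
    exchange the integrals, and replace x by [sc (expR v) x] at the cost of e^(qv). The annulus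
    plays the part of the unit sphere. *)
Lemma polar (f : T -> \bar R) : measurable_fun setT f -> (forall x, 0 <= f x) ->
  \int[mu]_x f x =
  \int[mu]_x \int[L]_v ((annulus x * expR (q%:R * v))%:E * f (sc (expR v) x)).
Proof.
move=> mf f0.
have w0 := annulus_ge0.
rewrite tonelli; last 2 first.
- by mfun.
- by move=> x y; rewrite mule_ge0// lee_fin mulr_ge0// expR_ge0.
transitivity (\int[L]_v \int[mu]_x ((annulus (sc (expR (- v)) x))%:E * f x)).
  rewrite tonelli; last 2 first.
  - by mfun.
  - by move=> x y; rewrite mule_ge0// lee_fin.
  rewrite -nspace_integral_gt0//; apply: eq_integral => x _.
  rewrite ge0_integralZr//=; last 2 first.
  - by mfun.
  - by move=> v _; rewrite lee_fin.
  case: ifPn => [Nx|]; first by rewrite integral_annulus_ray// mul1e.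
  move=> Nx; rewrite integral0_eq ?mul0e// => v _.
  rewrite /annulus (ns_scale H) pmulr_rgt0 ?exprn_gt0 ?expR_gt0//.
  by rewrite (negbTE Nx).
apply: eq_integral => v _.
under [RHS]eq_integral do rewrite mulrC EFinM -muleA.
rewrite ge0_integralZl//; last 2 first.
- by mfun.
- by move=> x _; rewrite mule_ge0// lee_fin.
have := ns_integral_scale H (t := expR v)
  (f := fun x => (annulus (sc (expR (- v)) x))%:E * f x) (expR_gt0 _).
rewrite -expRM_natl -expRN => h; rewrite -[LHS]mul1e.
have -> : (1 = (expR (q%:R * v))%:E * (expR (- (q%:R * v)))%:E :> \bar R).
  by rewrite -EFinM -expRD subrr expR0.
rewrite -muleA -h.
- congr (_ * _); apply: eq_integral => x _.
  by rewrite (ns_scaleA H) -expRD addNr expR0 (ns_scale1 H).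
- by mfun.
- by move=> x; rewrite mule_ge0// lee_fin.
Qed.

End polar.

Section polar_consequences.
Context {R : realType}.
Local Notation L := (@lebesgue_measure R).
Local Open Scope ereal_scope.

Lemma mule_eq_fin_gt0 (a b : \bar R) (c : R) : (0 < c)%R -> 0 <= a -> 0 <= b ->
  a * b = c%:E -> exists2 C : R, (0 < C)%R & a = C%:E.
Proof.
move=> c0; case: a => [a a0 b0 ab|a0|//].
  exists a => //; rewrite lt_neqAle -lee_fin a0 andbT; apply/eqP => a00.
  by move: ab; rewrite -a00 mul0e => -[] c00; rewrite -c00 ltxx in c0.
rewrite le_eqVlt => /orP[/eqP <-|b0].
  by rewrite mule0 => -[] c00; rewrite -c00 ltxx in c0.
by rewrite gt0_mulye.
Qed.

Context d (T : measurableType d).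
Variables (mu : {sigma_finite_measure set T -> \bar R}) (sc : R -> T -> T)
  (N : T -> R) (q : nat).
Hypothesis H : nspace mu sc N q.
Hypothesis q0 : (0 < q)%N.

Let mN := ns_meas H.
Let msc := ns_meas_sc H.

(** On the orbit of x the function N takes the values e^(ln (N x) + 2 v). With this exponent as new
    variable the inner integral of [polar] depends on x only through the factor [a x], and C is the
    integral of [a]. *)
Lemma radial : exists2 C : R, (0 < C)%R & forall g : R -> \bar R,
  measurable_fun setT g -> (forall x, 0 <= g x) ->
  \int[mu]_x g (N x) = C%:E * \int[L]_v ((expR (q%:R / 2 * v))%:E * g (expR v)).
Proof.
pose a x : R := (annulus N x * expR (- (q%:R / 2 * ln (N x))) * 2^-1)%R.
have a0 x : 0 <= (a x)%:E.
  by rewrite lee_fin !mulr_ge0 ?expR_ge0 ?annulus_ge0 ?invr_ge0.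
have mw := measurable_annulus H.
have ma : measurable_fun setT (fun x => (a x)%:E) by rewrite /a; mfun.
have key (g : R -> \bar R) :  measurable_fun setT g -> (forall x, 0 <= g x) ->
  \int[mu]_x g (N x) =
    \int[mu]_x (a x)%:E * \int[L]_v ((expR (q%:R / 2 * v))%:E * g (expR v)).
  move=> mg g0; pose h v := (expR (q%:R / 2 * v))%:E * g (expR v).
  have mh : measurable_fun setT h by rewrite /h; mfun.
  have h0 v : 0 <= h v by rewrite mule_ge0// lee_fin expR_ge0.
  rewrite (polar H q0)//; last by mfun.
  rewrite -ge0_integralZr//; last by apply: integral_ge0 => v _; exact: h0.
  apply: eq_integral => x _.
  have [Nx|Nx] := ltP 0%R (N x); last first.
    rewrite /a /annulus ltNge Nx/= !mul0r mul0e integral0_eq// => v _.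
    by rewrite mul0r mul0e.
  transitivity (\int[L]_v ((annulus N x * expR (- (q%:R / 2 * ln (N x))))%:E *
      h (ln (N x) + 2 * v)%R)).
    apply: eq_integral => v _; rewrite /h muleA -EFinM.
    congr (EFin _ * g _).
      by rewrite -[RHS]mulrA -expRD; congr (_ * expR _)%R; lra.
    by rewrite (ns_scale H) expRD lnK// mulrC expRM_natl.
  rewrite ge0_integralZl; [|by []| |by []|]; last 2 first.
  - by mfun.
  - by rewrite lee_fin mulr_ge0 ?annulus_ge0 ?expR_ge0.
  rewrite (ge0_integral_scale (f := fun v => h (ln (N x) + v)%R))//; last by mfun.
  by rewrite ge0_integral_shift// muleA -EFinM.
(* Testing on the Gaussian shows that C is finite and nonzero: two nonnegative factors have a
   positive real product. *)
have [c c0 Hc] := ns_gauss H.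
have [C C0 aC] : exists2 C : R, (0 < C)%R & \int[mu]_x (a x)%:E = C%:E.
  have := key (fun u => (expR (- u))%:E); rewrite Hc => e.
  apply: (mule_eq_fin_gt0 c0 _ _ (esym (e _ _))).
  - by apply: integral_ge0.
  - by apply: integral_ge0 => v _; rewrite -EFinM lee_fin mulr_ge0 ?expR_ge0.
  - by mfun.
  - by move=> x; rewrite lee_fin expR_ge0.
by exists C => // g mg g0; rewrite key// aC.
Qed.

(** On the orbit v |-> [sc (expR v) x] the inversion is v |-> - v - ln (N x) combined with [cj]: a
    reflection and a translation of the line, both preserving Lebesgue measure. The weight e^(qv) of
    [polar] then yields the density N^-q, N being the square of a length. *)
Lemma kelvin (cj : T -> T) (f : T -> \bar R) :
  measurable_fun setT cj -> (forall x, N (cj x) = N x) ->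
  (forall t x, sc t (cj x) = cj (sc t x)) ->
  (forall g : T -> \bar R, measurable_fun setT g -> (forall x, 0 <= g x) ->
    \int[mu]_x g (cj x) = \int[mu]_x g x) ->
  measurable_fun setT f -> (forall x, 0 <= f x) ->
  \int[mu]_x f (sc (expR (- ln (N x))) (cj x)) =
  \int[mu]_x ((expR (- (q%:R * ln (N x))))%:E * f x).
Proof.
move=> mcj Ncj scj icj mf f0.
have mw := measurable_annulus H.
rewrite -[RHS]icj; last 2 first.
- by mfun.
- by move=> x; rewrite mule_ge0// lee_fin expR_ge0.
rewrite [LHS](polar H q0)//; last by mfun.
rewrite [RHS](polar H q0)//; last 2 first.
- by mfun.
- by move=> x; rewrite mule_ge0// lee_fin expR_ge0.
apply: eq_integral => x _.
have [Nx|Nx] := ltP 0%R (N x); last first.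
  by apply: eq_integral => v _; rewrite /annulus ltNge Nx/= !mul0r !mul0e.
pose h v := (annulus N x * expR (- (q%:R * (v + ln (N x)))))%:E *
  f (sc (expR v) (cj x)).
have mh : measurable_fun setT h by rewrite /h; mfun.
have h0 v : 0 <= h v.
  by rewrite mule_ge0// lee_fin mulr_ge0 ?annulus_ge0 ?expR_ge0.
transitivity (\int[L]_v h (- ln (N x) + (- v))%R).
  apply: eq_integral => v _; rewrite /h; congr ((_ * expR _)%R%:E * f _).
    by ring.
  rewrite -scj (ns_scaleA H) (ns_scale H) -expRM_natl lnM ?posrE ?expR_gt0//.
  by rewrite expRK -expRD; congr (sc (expR _) _); ring.
rewrite (ge0_integral_opp (f := fun v => h (- ln (N x) + v)%R))//; last by mfun.
rewrite ge0_integral_shift//; apply: eq_integral => v _; rewrite /h muleA -EFinM -scj.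
rewrite -[in RHS]mulrA -expRD (ns_scale H) Ncj -expRM_natl lnM ?posrE ?expR_gt0// expRK.
by congr ((_ * expR _)%R%:E * _); ring.
Qed.

End polar_consequences.

Section half_line.
Context {R : realType}.
Local Notation L := (@lebesgue_measure R).
Local Open Scope ereal_scope.

(** The substitution x = e^v, by the method of [radial] applied to functions supported on one half
    of the line. The half Gaussian shows that the constant is finite and nonzero. *)
Lemma half_line : exists2 C : R, (0 < C)%R & forall g : R -> \bar R,
  measurable_fun setT g -> (forall x, 0 <= g x) ->
  \int[L]_x (if (0 < x)%R then g x else 0) =
  C%:E * \int[L]_v ((expR v)%:E * g (expR v)).
Proof.
have H := nspace_lebesgue (R := R).
pose A := annulus (fun x : R => x ^+ 2)%R.
pose a x : R := (if 0 < x then A x * expR (- ln x) else 0)%R.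
have a0 x : 0 <= (a x)%:E.
  rewrite lee_fin /a; case: ifP => // _.
  by rewrite !mulr_ge0 ?expR_ge0 ?annulus_ge0.
have mw : measurable_fun setT A := measurable_annulus H.
have ma : measurable_fun setT (fun x => (a x)%:E) by rewrite /a; mfun.
have key (g : R -> \bar R) :  measurable_fun setT g -> (forall x, 0 <= g x) ->
  \int[L]_x (if (0 < x)%R then g x else 0) =
    \int[L]_x (a x)%:E * \int[L]_v ((expR v)%:E * g (expR v)).
  move=> mg g0; pose h v := (expR v)%:E * g (expR v).
  have mh : measurable_fun setT h by rewrite /h; mfun.
  have h0 v : 0 <= h v by rewrite mule_ge0// lee_fin expR_ge0.
  rewrite (polar H)//; last 2 first.
  - by mfun.
  - by move=> x; case: ifP.
  rewrite -ge0_integralZr//; last by apply: integral_ge0 => v _; exact: h0.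
  apply: eq_integral => x _; rewrite /a.
  case: ifPn => x0; last first.
    rewrite mul0e integral0_eq// => v _.
    by rewrite pmulr_rgt0 ?expR_gt0// (negbTE x0) mule0.
  transitivity (\int[L]_v ((A x * expR (- ln x))%:E * h (ln x + v)%R)).
    apply: eq_integral => v _; rewrite /h muleA -EFinM pmulr_rgt0 ?expR_gt0// x0.
    congr (EFin _ * g _); first by rewrite -/A -mulrA -expRD mul1r; congr (_ * expR _)%R; ring.
    by rewrite expRD lnK// mulrC.
  rewrite ge0_integralZl; [|by []| |by []|]; last 2 first.
  - by mfun.
  - by rewrite lee_fin mulr_ge0 ?annulus_ge0 ?expR_ge0.
  by rewrite ge0_integral_shift.
have c0 : (0 < Num.sqrt pi / 2 :> R)%R by rewrite divr_gt0// sqrtr_gt0 pi_gt0.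
have Hc : \int[L]_x (if (0 < x)%R then (expR (- x ^+ 2))%:E else 0) = (Num.sqrt pi / 2)%:E.
  rewrite -integral0y_gauss -integral_itv_obnd_cbnd; last first.
    by apply: measurable_funTS; rewrite /gauss_fun; mfun.
  rewrite [RHS]integral_mkcond; apply: eq_integral => x _; rewrite patchE.
  case: ifPn => x0; first by rewrite mem_set//= in_itv/= x0.
  by rewrite memNset//= in_itv/= andbT; exact/negP.
have [C C0 aC] : exists2 C : R, (0 < C)%R & \int[L]_x (a x)%:E = C%:E.
  have := key (fun u => (expR (- u ^+ 2))%:E); rewrite Hc => e.
  apply: (mule_eq_fin_gt0 c0 _ _ (esym (e _ _))).
  - by apply: integral_ge0.
  - by apply: integral_ge0 => v _; rewrite -EFinM lee_fin mulr_ge0 ?expR_ge0.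
  - by mfun.
  - by move=> x; rewrite lee_fin expR_ge0.
by exists C => // g mg g0; rewrite key// aC.
Qed.

End half_line.

(** * Translations and linear isometries *)

Record tspace (R : realType) d (T : measurableType d)
    (mu : {sigma_finite_measure set T -> \bar R})
    (add : T -> T -> T) (opp : T -> T) : Prop := TSpace {
  ts_meas_add : measurable_fun setT (fun p : T * T => add p.1 p.2) ;
  ts_meas_opp : measurable_fun setT opp ;
  ts_addC : forall x y, add x y = add y x ;
  ts_addK : forall x y, add (opp x) (add x y) = y ;
  ts_oppK : forall x, opp (opp x) = x ;
  ts_oppD : forall x y, opp (add x y) = add (opp x) (opp y) ;
  ts_integral_add : forall x (f : T -> \bar R),
    measurable_fun setT f -> (forall y, 0 <= f y)%E ->
    (\int[mu]_y f (add x y) = \int[mu]_y f y)%E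
}.

Section tspace_instances.
Context {R : realType}.
Local Notation L := (@lebesgue_measure R).

Lemma tspace_lebesgue : tspace (T := measurableTypeR R) L +%R -%R.
Proof.
split.
- by mfun.
- exact: oppr_measurable.
- exact: addrC.
- by move=> x y; rewrite addKr.
- exact: opprK.
- exact: opprD.
- by move=> x f mf f0; rewrite ge0_integral_shift.
Qed.

Context d (T : measurableType d).
Variables (mu : {sigma_finite_measure set T -> \bar R}) (add : T -> T -> T)
  (opp : T -> T).
Hypothesis H : tspace mu add opp.

Definition tuple_add n (x y : n.-tuple T) : n.-tuple T :=
  [tuple add (tnth x i) (tnth y i) | i < n].
Definition tuple_opp n (x : n.-tuple T) : n.-tuple T :=
  [tuple opp (tnth x i) | i < n].

Let madd := ts_meas_add H.
Let mopp := ts_meas_opp H.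

Lemma tspace_tuple n : tspace (tuple_measure mu n) (@tuple_add n) (@tuple_opp n).
Proof.
have ma k : measurable_fun setT (fun p : k.-tuple T * k.-tuple T => tuple_add p.1 p.2).
  apply/measurable_fun_tnthP => i.
  rewrite (_ : _ \o _ = fun x => add (tnth x.1 i) (tnth x.2 i)); first by mfun.
  by apply/funext => x/=; rewrite tnth_mktuple.
have mav k (a : k.-tuple T) : measurable_fun setT (tuple_add a) by mcomp (ma k) (fun x => (a, x)).
split; first exact: ma.
- apply/measurable_fun_tnthP => i.
  rewrite (_ : _ \o _ = fun x => opp (tnth x i)); first by mfun.
  by apply/funext => x/=; rewrite tnth_mktuple.
- by move=> x y; apply: eq_from_tnth => i; rewrite !tnth_mktuple (ts_addC H).
- by move=> x y; apply: eq_from_tnth => i; rewrite !tnth_mktuple (ts_addK H).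
- by move=> x; apply: eq_from_tnth => i; rewrite !tnth_mktuple (ts_oppK H).
- by move=> x y; apply: eq_from_tnth => i; rewrite !tnth_mktuple (ts_oppD H).
- elim: n => [|n IH] a f mf f0; have ha := mav _ a.
    rewrite !integral_tuple0//; last by mfun.
    by congr f; apply: eq_from_tnth => -[].
  rewrite !integral_tupleS//; last by mfun.
  have mfc : measurable_fun setT (fun p : T * n.-tuple T => f [tuple of p.1 :: p.2]).
    by apply: measurableT_comp mf _; exact: measurable_tuple_cons.
  case/tupleP: a {ha} => a s.
  transitivity (\int[mu]_x \int[tuple_measure mu n]_t f [tuple of add a x :: t])%E.
    apply: eq_integral => x _.
    rewrite -[RHS](IH s (fun t => f [tuple of add a x :: t]))//.
      apply: eq_integral => t _; congr f; apply: eq_from_tnth => i.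
      rewrite tnth_mktuple; case: (unliftP ord0 i) => [j ->|->].
        by rewrite !tnthS tnth_mktuple.
      by rewrite !tnth0.
    by mcomp mfc (fun t => (add a x, t)).
  rewrite (ts_integral_add H a (f := fun x => \int[tuple_measure mu n]_t f [tuple of x :: t])%E)//.
    exact: measurable_iterated.
  by move=> x; apply: integral_ge0.
Qed.

End tspace_instances.

(* By uniqueness of the translation-invariant measure, a linear isometry preserves
   it up to a factor, which the Gaussian integral shows to be 1.  Linearity and
   surjectivity enter only through the second hypothesis. *)
Lemma integral_isometry (R : realType) d (T : measurableType d)
    (mu : {sigma_finite_measure set T -> \bar R})
    (add : T -> T -> T) (opp : T -> T) (sc : R -> T -> T) (N : T -> R) (q : nat)
    (M : T -> T) (f : T -> \bar R) :
  tspace mu add opp -> nspace mu sc N q -> measurable_fun setT M ->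
  (forall v, exists v', forall x, add v (M x) = M (add v' x)) ->
  (forall x, N (opp x) = N x) -> (forall x, N (M x) = N x) ->
  measurable_fun setT f -> (forall x, 0 <= f x)%E ->
  (\int[mu]_x f (M x) = \int[mu]_x f x)%E.
Proof.
move=> H HN mM linM Nopp NM mf f0.
have [madd mopp addC addK oppK oppD intD] := H.
have mN := ns_meas HN.
have [c c0 Hc] := ns_gauss HN.
pose g x := (expR (- N x))%:E.
have mg : measurable_fun setT g by rewrite /g; mfun.
have g0 x : (0 <= g x)%E by rewrite lee_fin expR_ge0.
(* The double integral of f (y + M x) g y is evaluated twice: translating x leads to the left side,
   translating y to the right side. *)
have key : (\int[mu]_x f (M x) * c%:E = \int[mu]_x f x * c%:E)%E.
  transitivity (\int[mu]_y \int[mu]_x (f (M x) * g y))%E.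
    rewrite -Hc -ge0_integralZl//; last by apply: integral_ge0.
    apply: eq_integral => y _; rewrite ge0_integralZr//.
    by mfun.
  transitivity (\int[mu]_y \int[mu]_x (f (add y (M x)) * g y))%E.
    apply: eq_integral => y _; have [y' hy] := linM y.
    under [RHS]eq_integral do rewrite hy.
    rewrite [RHS](intD y' (fun x => f (M x) * g y)%E)//; first by mfun.
    by move=> x; rewrite mule_ge0.
  rewrite tonelli; last 2 first.
  - by mfun.
  - by move=> x y; rewrite mule_ge0.
  transitivity (\int[mu]_x \int[mu]_y (f y * g (add (opp y) (M x))))%E.
    apply: eq_integral => x _.
    rewrite -[RHS](intD (M x)); last 2 first.
    - by mfun.
    - by move=> y; rewrite mule_ge0.
    apply: eq_integral => y _; rewrite addC; congr (_ * _)%E.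
    by rewrite /g [in RHS]addC oppD -{1}(oppK (M x)) addK Nopp.
  rewrite tonelli; last 2 first.
  - by mfun.
  - by move=> x y; rewrite mule_ge0.
  rewrite -ge0_integralZr//; last by rewrite lee_fin ltW.
  apply: eq_integral => y _.
  rewrite ge0_integralZl//; last by mfun.
  congr (_ * _)%E; have [y' hy] := linM (opp y).
  under eq_integral do rewrite hy.
  rewrite (intD y' (fun x => g (M x)))//; last by mfun.
  by rewrite -Hc; apply: eq_integral => x _; rewrite /g NM.
have cK a : (a = (a * c%:E) * (c^-1)%:E)%E.
  by rewrite -muleA -EFinM divff ?mule1// gt_eqF.
by rewrite [LHS]cK key -cK.
Qed.

(** * Complex integrals *)

Lemma muleBr_fin (R : realType) (c : R) (a b : \bar R) :
  a \is a fin_num -> b \is a fin_num -> (c%:E * (a - b) = c%:E * a - c%:E * b)%E.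
Proof. by move=> fa fb; rewrite muleBr// fin_num_adde_defr. Qed.

Section transfer.
Context {R : realType} d1 d2 d3 (X : measurableType d1) (Y : measurableType d2)
  (Z : measurableType d3).
Variables (mu : {measure set X -> \bar R}) (nu : {measure set Y -> \bar R}).
Variables (w : X -> R) (w' : Y -> R) (phi : X -> Z) (psi : Y -> Z) (C : R).

(* Such identities follow from Tonelli's theorem alone, and cintegral_transfer carries
   them over to complex integrals. *)
Definition same_law := forall G : Z -> \bar R,
  measurable_fun setT G -> (forall z, 0 <= G z)%E ->
  (\int[mu]_x ((w x)%:E * G (phi x)) = C%:E * \int[nu]_y ((w' y)%:E * G (psi y)))%E.

Hypotheses (law : same_law) (C0 : 0 <= C) (w0 : forall x, 0 <= w x)
  (w0' : forall x, 0 <= w' x).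
Hypotheses (mw : measurable_fun setT w) (mw' : measurable_fun setT w')
  (mphi : measurable_fun setT phi) (mpsi : measurable_fun setT psi).

Lemma Re_realM (a : R) (z : R[i]) : complex.Re (a%:C * z) = a * complex.Re z.
Proof. by case: z => r i /=; rewrite mul0r subr0. Qed.

Lemma Im_realM (a : R) (z : R[i]) : complex.Im (a%:C * z) = a * complex.Im z.
Proof. by case: z => r i /=; rewrite mul0r addr0. Qed.

Lemma eq_fun_Re (T : Type) (k : T -> R) (F : T -> R[i]) :
  (fun x => (complex.Re ((k x)%:C * F x))%:E) = (fun x => (k x * complex.Re (F x))%:E).
Proof. by apply/funext => x; rewrite Re_realM. Qed.

Lemma eq_fun_Im (T : Type) (k : T -> R) (F : T -> R[i]) :
  (fun x => (complex.Im ((k x)%:C * F x))%:E) = (fun x => (k x * complex.Im (F x))%:E).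
Proof. by apply/funext => x; rewrite Im_realM. Qed.

Section real.
Variable h : Z -> R.
Hypotheses (mh : measurable_fun setT h)
  (ih : nu.-integrable setT (fun y => (w' y * h (psi y))%:E)).

Lemma transfer_integrable : mu.-integrable setT (fun x => (w x * h (phi x))%:E).
Proof.
apply/integrableP; split; first by mfun.
under eq_integral do rewrite abse_EFin normrM ger0_norm// EFinM.
rewrite (law (G := fun z => `|h z|%:E))//; last first.
  by apply/measurable_EFinP; exact: measurableT_comp.
have /integrableP[_] := ih.
under eq_integral do rewrite abse_EFin normrM ger0_norm// EFinM.
by move=> fin; rewrite lte_mul_pinfty// lee_fin.
Qed.

Lemma transfer_integral :
  (\int[mu]_x (w x * h (phi x))%:E = C%:E * \int[nu]_y (w' y * h (psi y))%:E)%E.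
Proof.
pose h1 z := Num.max (h z) 0; pose h2 z := Num.max (- h z) 0.
have h10 z : 0 <= h1 z by rewrite le_max lexx orbT.
have h20 z : 0 <= h2 z by rewrite le_max lexx orbT.
have mh1 : measurable_fun setT h1 by apply: measurable_maxr => //; exact: measurable_cst.
have mh2 : measurable_fun setT h2.
  by apply: measurable_maxr; [exact: measurable_funN|exact: measurable_cst].
have dec (T : Type) (k : T -> R) (u : T -> Z) : (forall x, 0 <= k x) ->
    ((fun x => (k x * h (u x))%:E)^\+ = (fun x => (k x)%:E * (h1 (u x))%:E))%E /\
    ((fun x => (k x * h (u x))%:E)^\- = (fun x => (k x)%:E * (h2 (u x))%:E))%E.
  move=> k0; split; apply/funext => x.
    by rewrite funeposE -EFin_max -EFinM; congr EFin; rewrite /h1 maxr_pMr ?mulr0.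
  rewrite funenegE -EFinN -EFin_max -EFinM; congr EFin.
  by rewrite /h2 maxr_pMr ?mulr0 ?mulrN.
have [dp dn] := dec _ w' psi w0'.
have := integrable_pos_fin_num measurableT ih; have := integrable_neg_fin_num measurableT ih.
rewrite dp dn => fn fp.
rewrite integralE [in RHS]integralE; have [-> ->] := dec _ w phi w0.
rewrite dp dn (law (G := fun z => (h1 z)%:E))//; last by mfun.
rewrite (law (G := fun z => (h2 z)%:E))//; last by mfun.
by apply/esym/muleBr_fin.
Qed.

End real.

(** Integrability is assumed for [nu] and concluded for [mu]. The absolute convergence of the double
    integral is thus obtained together with its value. *)
Lemma cintegral_transfer (F : Z -> R[i]) :
  measurable_fun setT (fun z => complex.Re (F z)) ->
  measurable_fun setT (fun z => complex.Im (F z)) ->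
  cintegrable nu setT (fun y => (w' y)%:C * F (psi y)) ->
  cintegrable mu setT (fun x => (w x)%:C * F (phi x)) /\
  cintegral mu setT (fun x => (w x)%:C * F (phi x)) =
    C%:C * cintegral nu setT (fun y => (w' y)%:C * F (psi y)).
Proof.
move=> mRe mIm [iRe iIm].
rewrite (eq_fun_Re w') in iRe; rewrite (eq_fun_Im w') in iIm.
split.
  split; rewrite ?(eq_fun_Re w) ?(eq_fun_Im w).
    exact: (transfer_integrable (h := fun z => complex.Re (F z))).
  exact: (transfer_integrable (h := fun z => complex.Im (F z))).
rewrite /cintegral/Rintegral.
rewrite !(eq_fun_Re w') !(eq_fun_Re w) !(eq_fun_Im w') !(eq_fun_Im w).
rewrite (transfer_integral (h := fun z => complex.Re (F z)))//.
rewrite (transfer_integral (h := fun z => complex.Im (F z)))//.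
have := integrable_fin_num measurableT iRe; have := integrable_fin_num measurableT iIm.
move: (integral _ _ _) (integral _ _ _) => b a.
by move=> /fineK <- /fineK <-; rewrite -!EFinM/=; apply/eqP; rewrite eq_complex Re_realM Im_realM !eqxx.
Qed.

End transfer.

Section product_integrals.
Context {R : realType} d1 d2 (X : measurableType d1) (Y : measurableType d2).
Variables (mu : {sigma_finite_measure set X -> \bar R})
  (nu : {sigma_finite_measure set Y -> \bar R}).
Local Notation pi := (sigma_finite_prod mu nu).

Section real.
Variables (f : X -> R) (g : Y -> R).
Hypotheses (fi : mu.-integrable setT (EFin \o f)) (gi : nu.-integrable setT (EFin \o g)).

Let mf : measurable_fun setT f.
Proof. by have /integrableP[/measurable_EFinP] := fi. Qed.
Let mg : measurable_fun setT g.
Proof. by have /integrableP[/measurable_EFinP] := gi. Qed.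

Lemma integrable_prod : pi.-integrable setT (EFin \o (fun p => f p.1 * g p.2)).
Proof.
apply/integrableP; split; first by rewrite /comp; mfun.
have mnf : measurable_fun setT (fun x => `|f x|%:E).
  by apply/measurable_EFinP; exact: measurableT_comp.
have mng : measurable_fun setT (fun x => `|g x|%:E).
  by apply/measurable_EFinP; exact: measurableT_comp.
rewrite integral_sigma_finite_prod//; last first.
  by apply: measurableT_comp => //; rewrite /comp; mfun.
have /integrableP[_ fi'] := fi; have /integrableP[_ gi'] := gi.
rewrite (_ : (\int[mu]_x _)%E = (\int[mu]_x `|f x|%:E * \int[nu]_y `|g y|%:E)%E).
  by rewrite lte_mul_pinfty//; [exact: integral_ge0|rewrite ge0_fin_numE//; exact: integral_ge0].
rewrite -ge0_integralZr//; last exact: integral_ge0.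
apply: eq_integral => x _; rewrite -ge0_integralZl//.
by apply: eq_integral => y _; rewrite /= normrM EFinM.
Qed.

Lemma Rintegral_prod : (\int[pi]_p (f p.1 * g p.2) = (\int[mu]_x f x) * (\int[nu]_y g y))%R.
Proof.
have pii := integrable_prod.
rewrite /Rintegral.
rewrite [X in fine X](_ : _ = \int[mu]_x (f x)%:E * \int[nu]_y (g y)%:E)%E; last first.
  have -> : (\int[pi]_p (f p.1 * g p.2)%:E = \int[mu]_x \int[nu]_y (f x * g y)%:E)%E.
    by rewrite [LHS](esym (integral12_prod_meas1 (m1 := mu) (m2 := nu) pii)).
  have /fineK gE := integrable_fin_num measurableT gi.
  rewrite -[in RHS]gE -integralZr//; apply: eq_integral => x _.
  by rewrite gE -integralZl.
have /fineK <- := integrable_fin_num measurableT gi.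
by have /fineK <- := integrable_fin_num measurableT fi.
Qed.

End real.

Lemma cintegral_prod (f : X -> R[i]) (g : Y -> R[i]) :
  cintegrable mu setT f -> cintegrable nu setT g ->
  cintegrable pi setT (fun p => f p.1 * g p.2) /\
  cintegral pi setT (fun p => f p.1 * g p.2) = cintegral mu setT f * cintegral nu setT g.
Proof.
move=> [rf If] [rg Ig].
have rr := integrable_prod rf rg; have ii := integrable_prod If Ig.
have ri := integrable_prod rf Ig; have ir := integrable_prod If rg.
have ReE : (fun p => complex.Re (f p.1 * g p.2)) = (fun p =>
    complex.Re (f p.1) * complex.Re (g p.2) - complex.Im (f p.1) * complex.Im (g p.2)).
  by apply/funext => p; case: (f _) (g _) => a b [c e].
have ImE : (fun p => complex.Im (f p.1 * g p.2)) = (fun p =>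
    complex.Re (f p.1) * complex.Im (g p.2) + complex.Im (f p.1) * complex.Re (g p.2)).
  by apply/funext => p; case: (f _) (g _) => a b [c e].
split.
  split.
    rewrite [X in _.-integrable _ X](_ : _ = EFin \o (fun p => complex.Re (f p.1 * g p.2)))//.
    rewrite ReE; exact: (integrableB measurableT rr ii).
  rewrite [X in _.-integrable _ X](_ : _ = EFin \o (fun p => complex.Im (f p.1 * g p.2)))//.
  rewrite ImE; exact: (integrableD measurableT ri ir).
rewrite /cintegral ReE ImE RintegralB// RintegralD//.
rewrite (Rintegral_prod rf rg) (Rintegral_prod If Ig).
rewrite (Rintegral_prod rf Ig) (Rintegral_prod If rg).
by apply/eqP; rewrite eq_complex/= !eqxx.
Qed.

Lemma Rintegral_iterated (f : X * Y -> R) : pi.-integrable setT (EFin \o f) ->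
  \int[mu]_x (\int[nu]_y f (x, y)) = \int[pi]_p f p.
Proof.
move=> fi; rewrite {3}/Rintegral.
rewrite [in RHS](esym (integral12_prod_meas1 (m1 := mu) (m2 := nu) fi)).
(* The inner integral is known to be finite for almost every x only; where it is not, [fine] returns
   a default value. *)
congr fine; apply: ae_eq_integral => //.
- have h := measurable_int _ (integrable_fubini_F (m1 := mu) (m2 := nu) fi).
  apply/measurable_EFinP; exact: (measurableT_comp (@fine_measurable R setT measurableT) h).
- exact: measurable_int (integrable_fubini_F (m1 := mu) (m2 := nu) fi).
- apply: filterS (ae_integrable1 (m1 := mu) (m2 := nu) fi) => x fx _.
  by rewrite /Rintegral fineK// (integrable_fin_num measurableT fx).
Qed.

Lemma cintegral_iterated (f : X -> Y -> R[i]) :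
  cintegrable pi setT (fun p => f p.1 p.2) ->
  cintegral mu setT (fun x => cintegral nu setT (f x)) =
  cintegral pi setT (fun p => f p.1 p.2).
Proof.
by move=> [rf If]; congr (_ +i* _); rewrite -Rintegral_iterated.
Qed.

End product_integrals.

Section complex_exponential.
Context {R : realType}.
Implicit Types (s : R[i]) (t : R).

(** e^(st) for complex s and real t. All powers are handled through real logarithms, [cpow a s]
    being [cexp s (ln a)]. As [ln] vanishes at 0, the junk value of [cpow] there is 1 and the
    identities between powers need no exceptions. *)
Definition cexp s t : R[i] :=
  (expR (complex.Re s * t) * cos (complex.Im s * t)) +i*
  (expR (complex.Re s * t) * sin (complex.Im s * t)).

Lemma cpow_cexp (a : R) s : cpow a s = cexp s (ln a).
Proof. by []. Qed.

Lemma cexpD s t u : cexp s (t + u) = cexp s t * cexp s u.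
Proof.
rewrite /cexp !mulrDr expRD cosD sinD; apply/eqP; rewrite eq_complex/=.
by apply/andP; split; apply/eqP; ring.
Qed.

Lemma cexpDl s s' t : cexp (s + s') t = cexp s t * cexp s' t.
Proof.
case: s s' => [a b] [a' b'].
rewrite /cexp/= !mulrDl expRD cosD sinD; apply/eqP; rewrite eq_complex/=.
by apply/andP; split; apply/eqP; ring.
Qed.

Lemma cexp_real (a : R) t : cexp a%:C t = (expR (a * t))%:C.
Proof. by rewrite /cexp/= mul0r cos0 sin0 mulr1 mulr0. Qed.

Lemma cexpM s (c : R) t : cexp s (c * t) = cexp (c%:C * s) t.
Proof.
by rewrite /cexp Re_realM Im_realM -!mulrA !(mulrCA c).
Qed.

Lemma cexp0 s : cexp s 0 = 1.
Proof. by rewrite /cexp !mulr0 expR0 cos0 sin0 mulr0 mul1r. Qed.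

Lemma cexp0l t : cexp 0 t = 1.
Proof. by rewrite /cexp/= !mul0r expR0 cos0 sin0 mulr0 mul1r. Qed.

Lemma cexpN s t : cexp (- s) t = cexp s (- t).
Proof. by case: s => a b; rewrite /cexp/= !mulrN !mulNr. Qed.

Lemma Re_cexp_le s t : `|complex.Re (cexp s t)| <= expR (complex.Re s * t).
Proof.
rewrite /cexp/= normrM ger0_norm ?expR_ge0// ler_piMr ?expR_ge0//.
by rewrite ler_norml cos_geN1 cos_le1.
Qed.

Lemma Im_cexp_le s t : `|complex.Im (cexp s t)| <= expR (complex.Re s * t).
Proof.
rewrite /cexp/= normrM ger0_norm ?expR_ge0// ler_piMr ?expR_ge0//.
by rewrite ler_norml sin_geN1 sin_le1.
Qed.

Definition cmeasurable d (T : measurableType d) (F : T -> R[i]) :=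
  measurable_fun setT (fun x => complex.Re (F x)) /\
  measurable_fun setT (fun x => complex.Im (F x)).

Lemma measurable_cexp d (T : measurableType d) s (f : T -> R) : measurable_fun setT f ->
  cmeasurable (fun x => cexp s (f x)).
Proof.
move=> mf; split; apply: measurable_funM; apply: measurableT_comp => //=; try by mfun.
- exact: (continuous_measurable_fun (@continuous_cos R)).
- exact: (continuous_measurable_fun (@continuous_sin R)).
Qed.

Lemma cmeasurableM d (T : measurableType d) (f g : T -> R[i]) :
  cmeasurable f -> cmeasurable g -> cmeasurable (fun x => f x * g x).
Proof.
move=> [rf If] [rg Ig]; split.
  rewrite (_ : (fun _ => _) = fun x => complex.Re (f x) * complex.Re (g x) -
    complex.Im (f x) * complex.Im (g x)); first by mfun.
  by apply/funext => x; case: (f _) (g _) => a b [c e].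
rewrite (_ : (fun _ => _) = fun x => complex.Re (f x) * complex.Im (g x) +
    complex.Im (f x) * complex.Re (g x)); first by mfun.
by apply/funext => x; case: (f _) (g _) => a b [c e].
Qed.

Lemma cmeasurable_real d (T : measurableType d) (f : T -> R) : measurable_fun setT f ->
  cmeasurable (fun x => (f x)%:C).
Proof. by move=> mf; split => //=; exact: measurable_cst. Qed.

Lemma cintegrable_le d (T : measurableType d) (mu : {measure set T -> \bar R})
    (F : T -> R[i]) (b : T -> R) : cmeasurable F -> mu.-integrable setT (EFin \o b) ->
  (forall x, `|complex.Re (F x)| <= b x) -> (forall x, `|complex.Im (F x)| <= b x) ->
  cintegrable mu setT F.
Proof.
move=> [mr mi] bi rb ib; split; apply: le_integrable bi => //; try by mfun.
  by move=> x _; rewrite lee_fin (le_trans (rb x))// ler_norm.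
by move=> x _; rewrite lee_fin (le_trans (ib x))// ler_norm.
Qed.

End complex_exponential.

(** * The Gamma function *)

Section gamma.
Context {R : realType}.
Local Notation L := (@lebesgue_measure R).

Lemma integral_pos_neq0 d (T : measurableType d) (mu : {measure set T -> \bar R})
    (f : T -> R) : measurable_fun setT f -> (forall x, 0 < f x) -> mu setT != 0%E ->
  (\int[mu]_x (f x)%:E != 0)%E.
Proof.
move=> mf f0 muT; apply/negP => /eqP h.
have /(ae_eq_integral_abs mu measurableT) : measurable_fun setT (EFin \o f).
  by rewrite /comp; mfun.
case=> + _; rewrite (eq_integral (EFin \o f)); last first.
  by move=> x _; rewrite /= ger0_norm// ltW.
move=> /(_ h) [A [mA A0 sA]]; move/eqP: muT; apply.
apply/eqP; rewrite -measure_le0 -A0 le_measure ?inE//.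
move=> x _; apply: sA => /= /(_ I) [] e.
by have := f0 x; rewrite e ltxx.
Qed.

Definition gamma_weight (v : R) : R := expR (- expR v).

Lemma gamma_weight_gt0 v : 0 < gamma_weight v. Proof. exact: expR_gt0. Qed.

Lemma measurable_gamma_weight : measurable_fun setT gamma_weight.
Proof. by rewrite /gamma_weight; mfun. Qed.

Lemma integrable_gamma (a : R) : 0 < a ->
  L.-integrable setT (EFin \o (fun v => expR (a * v) * gamma_weight v)).
Proof.
move=> a0; have mw := measurable_gamma_weight.
apply/integrableP; split; first by rewrite /comp; mfun.
rewrite [X in (X < _)%E](_ : _ = \int[L]_v (expR (a * v) * gamma_weight v)%:E)%E; last first.
  by apply: eq_integral => v _; rewrite /= ger0_norm// mulr_ge0 ?expR_ge0// ltW// gamma_weight_gt0.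
pose q := (Num.truncn (2 * a)).+1.
have qa : 2 * a <= q%:R by rewrite ltW// truncnS_gt.
pose c : R := q%:R / 2 / a.
have c1 : 1 <= c by rewrite ler_pdivlMr// mul1r ler_pdivlMr//; lra.
have c0 : 0 < c by rewrite (lt_le_trans _ c1).
pose h v := (expR (a * v) * gamma_weight v)%:E.
have mh : measurable_fun setT h by rewrite /h; mfun.
have h0 v : (0 <= h v)%E.
  by rewrite lee_fin mulr_ge0 ?expR_ge0// ltW// gamma_weight_gt0.
have H := nspace_tuple (nspace_lebesgue (R := R)) q.
have q0 : (0 < q * 1)%N by rewrite muln1.
have [C C0 rad] := radial H q0; have [e e0 He] := ns_gauss H.
have := rad (fun u => (expR (- u))%:E); rewrite He.
move=> /(_ _ _)/esym hrad.
have fin : (\int[L]_v (expR (q%:R / 2 * v) * gamma_weight v)%:E < +oo)%E.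
  have Cge : (0 <= \int[L]_v (expR (q%:R / 2 * v) * gamma_weight v)%:E)%E.
    by apply: integral_ge0 => v _; rewrite lee_fin mulr_ge0 ?expR_ge0// ltW// gamma_weight_gt0.
  have [||C1 _ ->] := mule_eq_fin_gt0 e0 Cge (b := C%:E); rewrite ?ltry//.
    by rewrite lee_fin ltW.
  by rewrite muleC -hrad ?muln1//; mfun.
rewrite -[X in (X < _)%E]/(\int[L]_v h v)%E.
have -> : (\int[L]_v h v = c%:E * \int[L]_v h (c * v)%R)%E.
  by rewrite ge0_integral_scale// muleA -EFinM divff ?mul1e// gt_eqF.
apply: lte_mul_pinfty; [by rewrite lee_fin ltW|by []|].
apply: (@le_lt_trans _ _ (\int[L]_v ((expR 1)%:E * (expR (q%:R / 2 * v) * gamma_weight v)%:E))%E).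
  apply: ge0_le_integral => //.
  - by mfun.
  - by mfun.
  move=> v _; rewrite /h -EFinM lee_fin /gamma_weight -!expRD ler_expR.
  have -> : a * (c * v) = q%:R / 2 * v by rewrite /c; field; rewrite gt_eqF.
  suff : expR v <= 1 + expR (c * v) by lra.
  have [v0|v0] := leP 0 v.
    have : expR v <= expR (c * v) by rewrite ler_expR ler_peMl.
    by lra.
  have : expR v <= 1 by rewrite expR_le1 ltW.
  by have := expR_ge0 (c * v); lra.
rewrite ge0_integralZl//; last 2 first.
- by mfun.
- by move=> v _; rewrite lee_fin mulr_ge0 ?expR_ge0// ltW// gamma_weight_gt0.
by rewrite lte_mul_pinfty// lee_fin expR_ge0.
Qed.

(* Euler's integral after the substitution t = e^v. *)
Definition Gam (s : R[i]) : R[i] :=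
  cintegral L setT (fun v => cexp s v * (gamma_weight v)%:C).

Lemma cintegrable_gamma (s : R[i]) : 0 < complex.Re s ->
  cintegrable L setT (fun v => cexp s v * (gamma_weight v)%:C).
Proof.
move=> s0; have mw := measurable_gamma_weight.
apply: cintegrable_le (integrable_gamma s0) _ _.
- by apply: cmeasurableM; [apply: measurable_cexp; mfun|exact: cmeasurable_real].
- move=> v; rewrite mulrC Re_realM mulrC normrM (ger0_norm (ltW (gamma_weight_gt0 v))).
  by rewrite ler_wpM2r ?(ltW (gamma_weight_gt0 v))// Re_cexp_le.
- move=> v; rewrite mulrC Im_realM mulrC normrM (ger0_norm (ltW (gamma_weight_gt0 v))).
  by rewrite ler_wpM2r ?(ltW (gamma_weight_gt0 v))// Im_cexp_le.
Qed.

Lemma cGamma_Gam : exists2 C : R, 0 < C &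
  forall s, 0 < complex.Re s -> cGamma s = C%:C * Gam s.
Proof.
have [C C0 half] := half_line (R := R).
exists C => // s s0.
(* The indicator of the half-line is used as a weight, which puts [half_line] in the shape of
   [same_law]. *)
pose w (x : R) : R := if 0 < x then 1 else 0.
have mw := measurable_gamma_weight.
have mw1 : measurable_fun setT w by rewrite /w; mfun.
pose F t := cpow t (s - 1) * (expR (- t))%:C.
have [mRe mIm] : cmeasurable F.
  apply: cmeasurableM; last by apply: cmeasurable_real; mfun.
  by apply: measurable_cexp; mfun.
have Fexp : (fun v => (expR v)%:C * F (expR v)) = (fun v => cexp s v * (gamma_weight v)%:C).
  apply/funext => v; rewrite /F cpow_cexp expRK mulrA; congr (_ * _).
  have -> : cexp s v = cexp (s - 1) v * cexp 1 v by rewrite -cexpDl subrK.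
  by rewrite mulrC; congr (_ * _); have := cexp_real 1 v; rewrite mul1r.
have law : same_law L L w expR id expR C.
  move=> G mG G0; rewrite -half//; apply: eq_integral => x _.
  by rewrite /w; case: ifP => _; rewrite ?mul1e ?mul0e.
have w0 x : 0 <= w x by rewrite /w; case: ifP.
have [] := cintegral_transfer law (ltW C0) w0 (@expR_ge0 R) mw1
  (@measurable_id _ _ _) mRe mIm.
  by rewrite Fexp; exact: cintegrable_gamma.
move=> _; rewrite Fexp => <-.
rewrite /cGamma /cintegral; congr (_ +i* _); rewrite Rintegral_mkcond;
  apply: eq_Rintegral => x _; rewrite patchE ?Re_realM ?Im_realM /w;
  by rewrite mem_setE in_itv/= andbT; case: ifP => _; rewrite ?mul1r ?mul0r.
Qed.

End gamma.

(** * Beta integrals *)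

Section beta.
Context {R : realType}.
Local Notation L := (@lebesgue_measure R).
Local Notation gw := (@gamma_weight R).
Local Notation R' := (measurableTypeR R).

Let mw := @measurable_gamma_weight R.
Let gw0 v : 0 <= gw v. Proof. by rewrite ltW// gamma_weight_gt0. Qed.
Let N1 (u : R) : 0 < 1 + expR u. Proof. by rewrite ltr_pwDl// expR_ge0. Qed.

(* The substitution v |-> v + ln (1 + e^u), then u |-> u - v: the sum and the ratio of two
   independent Gamma variables are independent. *)
Lemma gamma_beta_law (G : R -> R -> \bar R) :
  measurable_fun setT (fun p : R' * R' => G p.1 p.2) -> (forall v u, 0 <= G v u)%E ->
  (\int[L]_v \int[L]_u ((gw v)%:E * G (v - ln (1 + expR u))%R u) =
   \int[L]_v \int[L]_u ((gw v * gw u)%:E * G v (u - v)%R))%E.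
Proof.
move=> mG G0.
rewrite tonelli; last 2 first.
- by mfun.
- by move=> v u; rewrite mule_ge0// lee_fin.
transitivity (\int[L]_u \int[L]_v ((gw v * gw (v + u))%:E * G v u))%E.
  apply: eq_integral => u _.
  rewrite -[LHS](ge0_integral_shift (ln (1 + expR u))); last 2 first.
  - by mfun.
  - by move=> v; rewrite mule_ge0// lee_fin.
  apply: eq_integral => v _; rewrite /gamma_weight addrAC subrr add0r -expRD expRD.
  by rewrite lnK ?posrE ?N1// mulrDl mul1r opprD -expRD (addrC u).
rewrite [LHS](tonelli (fun u v : R' => (gw v * gw (v + u))%:E * G v u)%E); last 2 first.
- by mfun.
- by move=> u v; rewrite mule_ge0// lee_fin mulr_ge0.
apply: eq_integral => v _.
rewrite -[RHS](ge0_integral_shift v); last 2 first.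
- by mfun.
- by move=> u; rewrite mule_ge0// lee_fin mulr_ge0.
by apply: eq_integral => u _; rewrite addrAC subrr add0r.
Qed.

Let Gr (a : R) := (\int[L]_v (expR (a * v) * gw v)%:E)%E.

Let Gr_ge0 a : (0 <= Gr a)%E.
Proof. by apply: integral_ge0 => v _; rewrite lee_fin mulr_ge0 ?expR_ge0. Qed.

Let Gr_fin a : 0 < a -> (Gr a < +oo)%E.
Proof.
by move=> a0; have /(integrable_fin_num measurableT) := integrable_gamma a0;
  rewrite ge0_fin_numE//; exact: Gr_ge0.
Qed.

Let Gr_lty (A : \bar R) a : (0 <= A)%E -> (A * Gr a < +oo)%E -> (A < +oo)%E.
Proof.
case: A => [A _ _| _|//]; first by rewrite ltry.
rewrite gt0_mulye// lt_def Gr_ge0 andbT; apply: integral_pos_neq0.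
- by mfun.
- by move=> v; rewrite mulr_gt0 ?expR_gt0 ?gamma_weight_gt0.
- have := lebesgue_measure_itv `]-oo, +oo[ : L _ = _.
  by rewrite set_itvNyy/= => ->.
Qed.

(** [gamma_beta_law] applied to e^(bv) e^(au) gives, in [0, +oo], the beta integral times Gamma(b)
    as Gamma(b - a) Gamma(a). The right side is finite and Gamma(b) is positive, so the beta
    integral is finite. *)
Lemma integrable_beta (a b : R) : 0 < a -> a < b ->
  L.-integrable setT (EFin \o (fun u => expR (a * u) * expR (- b * ln (1 + expR u)))).
Proof.
move=> a0 ab; apply/integrableP; split; first by rewrite /comp; mfun.
rewrite [X in (X < _)%E](_ : _ =
    \int[L]_u (expR (a * u) * expR (- b * ln (1 + expR u)))%:E)%E; last first.
  by apply: eq_integral => u _; rewrite /= ger0_norm// mulr_ge0 ?expR_ge0.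
pose B u := expR (a * u) * expR (- b * ln (1 + expR u)).
have B0 u : 0 <= B u by rewrite mulr_ge0 ?expR_ge0.
have mB : measurable_fun setT B by rewrite /B; mfun.
rewrite -/(\int[L]_u (B u)%:E)%E.
have A0 : (0 <= \int[L]_u (B u)%:E)%E.
  by apply: integral_ge0 => u _; rewrite lee_fin.
apply: (@Gr_lty _ b) => //.
have sep (f g : R -> R) : measurable_fun setT f -> measurable_fun setT g ->
    (forall v, 0 <= f v) -> (forall u, 0 <= g u) ->
    (\int[L]_v \int[L]_u (f v * g u)%:E = \int[L]_v (f v)%:E * \int[L]_u (g u)%:E)%E.
  move=> mf mg f0 g0.
  transitivity (\int[L]_v ((f v)%:E * \int[L]_u (g u)%:E))%E.
    apply: eq_integral => v _.
    transitivity (\int[L]_u ((f v)%:E * (g u)%:E))%E; first exact: eq_integral.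
    rewrite ge0_integralZl//; [by mfun|by move=> u _; rewrite lee_fin|by rewrite lee_fin].
  rewrite ge0_integralZr//; [by mfun|by move=> u _; rewrite lee_fin|].
  by apply: integral_ge0 => u _; rewrite lee_fin.
have -> : (\int[L]_u (B u)%:E * Gr b = Gr (b - a) * Gr a)%E.
  have := gamma_beta_law (G := fun v u => (expR (b * v) * expR (a * u))%:E).
  have -> : (\int[L]_v \int[L]_u ((gw v)%:E *
      (expR (b * (v - ln (1 + expR u))) * expR (a * u))%:E) =
      \int[L]_v \int[L]_u (expR (b * v) * gw v * B u)%:E)%E.
    apply: eq_integral => v _; apply: eq_integral => u _; rewrite -EFinM; congr EFin.
    by rewrite mulrBr expRD /B mulNr; ring.
  have -> : (\int[L]_v \int[L]_u ((gw v * gw u)%:E *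
      (expR (b * v) * expR (a * (u - v)))%:E) =
      \int[L]_v \int[L]_u ((expR ((b - a) * v) * gw v) * (expR (a * u) * gw u))%:E)%E.
    apply: eq_integral => v _; apply: eq_integral => u _; rewrite -EFinM; congr EFin.
    by rewrite mulrBr mulrBl !expRD; ring.
  have k0 c v : 0 <= expR (c * v) * gw v by rewrite mulr_ge0 ?expR_ge0.
  have mk c : measurable_fun setT (fun v : R => expR (c * v) * gw v) by mfun.
  rewrite (sep (fun v => expR (b * v) * gw v) B (mk b) mB (k0 b) B0).
  rewrite (sep _ _ (mk (b - a)) (mk a) (k0 (b - a)) (k0 a)).
  move=> h; rewrite muleC; apply: h; first by mfun.
  by move=> v u; rewrite lee_fin mulr_ge0 ?expR_ge0.
by rewrite lte_mul_pinfty ?Gr_fin ?Gr_ge0 ?ge0_fin_numE ?Gr_ge0 ?Gr_fin ?subr_gt0.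
Qed.

Lemma Re_cexpM_le (s s' : R[i]) (t t' : R) :
  `|complex.Re (cexp s t * cexp s' t')| <= expR (complex.Re s * t) * expR (complex.Re s' * t').
Proof.
rewrite -expRD; pose z : R[i] := (complex.Re s * t + complex.Re s' * t') +i*
  (complex.Im s * t + complex.Im s' * t').
have -> : cexp s t * cexp s' t' = cexp z 1.
  apply/eqP; rewrite /cexp/= !mulr1 expRD cosD sinD eq_complex/=.
  by apply/andP; split; apply/eqP; ring.
by have := Re_cexp_le z 1; rewrite /= mulr1.
Qed.

Lemma Im_cexpM_le (s s' : R[i]) (t t' : R) :
  `|complex.Im (cexp s t * cexp s' t')| <= expR (complex.Re s * t) * expR (complex.Re s' * t').
Proof.
rewrite -expRD; pose z : R[i] := (complex.Re s * t + complex.Re s' * t') +i*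
  (complex.Im s * t + complex.Im s' * t').
have -> : cexp s t * cexp s' t' = cexp z 1.
  apply/eqP; rewrite /cexp/= !mulr1 expRD cosD sinD eq_complex/=.
  by apply/andP; split; apply/eqP; ring.
by have := Im_cexp_le z 1; rewrite /= mulr1.
Qed.

Lemma cintegrable_beta (a b : R[i]) : 0 < complex.Re a -> complex.Re a < complex.Re b ->
  cintegrable L setT (fun u => cexp a u * cexp (- b) (ln (1 + expR u))).
Proof.
move=> a0 ab; apply: cintegrable_le (integrable_beta a0 ab) _ _.
- by apply: cmeasurableM; apply: measurable_cexp; mfun.
- by move=> u; rewrite (le_trans (Re_cexpM_le _ _ _ _))//; case: (b).
- by move=> u; rewrite (le_trans (Im_cexpM_le _ _ _ _))//; case: (b).
Qed.

(** Euler's beta integral of t^(a-1) (1-t)^(b-a-1) in the variable u = ln (t / (1 - t)). The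
    function e^(bv) e^(au) separates on both sides of [gamma_beta_law]. *)
Lemma beta_Gam (a b : R[i]) : 0 < complex.Re a -> complex.Re a < complex.Re b ->
  Gam b * cintegral L setT (fun u => cexp a u * cexp (- b) (ln (1 + expR u))) =
  Gam (b - a) * Gam a.
Proof.
move=> a0 ab.
have b0 := lt_trans a0 ab.
have ba0 : 0 < complex.Re (b - a) by case: (a) (b) ab => ? ? [? ?] /=; lra.
pose w (p : R' * R') := gw p.1.
pose w' (p : R' * R') := gw p.1 * gw p.2.
pose phi (p : R' * R') : R' * R' := (p.1 - ln (1 + expR p.2), p.2).
pose psi (p : R' * R') : R' * R' := (p.1, p.2 - p.1).
have law : same_law (sigma_finite_prod L L) (sigma_finite_prod L L) w w' phi psi 1.
  move=> G mG G0; rewrite mul1e.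
  transitivity (\int[L]_v \int[L]_u ((gw v)%:E * G ((v - ln (1 + expR u))%R, u)))%E.
    apply: integral_sigma_finite_prod; first by rewrite /w /phi; mfun.
    by move=> p; rewrite mule_ge0// lee_fin /w.
  rewrite (gamma_beta_law (G := fun u v => G (u, v)))//; last by mfun.
  symmetry; apply: integral_sigma_finite_prod; first by rewrite /w' /psi; mfun.
  by move=> p; rewrite mule_ge0// lee_fin /w' mulr_ge0.
have w0 p : 0 <= w p by exact: gw0.
have w0' p : 0 <= w' p by rewrite mulr_ge0.
have mw1 : measurable_fun setT w by rewrite /w; mfun.
have mphi : measurable_fun setT phi by rewrite /phi; mfun.
pose F (p : R' * R') := cexp b p.1 * cexp a p.2.
have [mr mi] : cmeasurable F by apply: cmeasurableM; apply: measurable_cexp; mfun.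
have wF : (fun p => (w' p)%:C * F (psi p)) = (fun p =>
    (cexp (b - a) p.1 * (gw p.1)%:C) * (cexp a p.2 * (gw p.2)%:C)).
  apply/funext => p; rewrite /w' /F /psi/= cexpD cexpDl cexpN rmorphM/=; ring.
have wF' : (fun p => (w p)%:C * F (phi p)) = (fun p =>
    (cexp b p.1 * (gw p.1)%:C) * (cexp a p.2 * cexp (- b) (ln (1 + expR p.2)))).
  apply/funext => p; rewrite /w /F /phi/= cexpD cexpN; ring.
have [i1 e1] := cintegral_prod (cintegrable_gamma ba0) (cintegrable_gamma a0).
have [_ e2] := cintegral_prod (cintegrable_gamma b0) (cintegrable_beta a0 ab).
rewrite -wF in i1.
have [_] := cintegral_transfer law ler01 w0 w0' mw1 mphi mr mi i1.
by rewrite wF' wF mul1r e1 e2.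
Qed.

End beta.

(** * The functional equation of Gamma *)

Section gamma_functional_equation.
Context {R : realType}.
Local Notation L := (@lebesgue_measure R).
Local Notation gw := (@gamma_weight R).
Let mw := @measurable_gamma_weight R.

Section derivative.
Variables (a t c : R).
Hypothesis a0 : 0 < a.

(** A primitive whose derivative integrates to 0, which is the functional equation. The phase c lets
    one computation serve both parts of the complex identity: c = 0 for the real part and c = - pi /
    2, turning cosine into sine, for the imaginary part. *)
Let G (v : R) : R := expR (a * v - expR v) * cos (t * v + c).
Let G' (v : R) : R :=
  expR (a * v) * gw v * (a * cos (t * v + c) - t * sin (t * v + c)) -
  expR ((a + 1) * v) * gw v * cos (t * v + c).

Let G'E (v : R) : is_derive v 1 G (G' v).
Proof.
rewrite /G /G' /gamma_weight; apply: is_derive_eq.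
rewrite /GRing.scale/= !mulrDl mul1r !expRD; ring.
Qed.

Let mcos : measurable_fun setT (fun v : R => cos (t * v + c)).
Proof.
apply: measurableT_comp; last by mfun.
exact: (continuous_measurable_fun (@continuous_cos R)).
Qed.

Let msin : measurable_fun setT (fun v : R => sin (t * v + c)).
Proof.
apply: measurableT_comp; last by mfun.
exact: (continuous_measurable_fun (@continuous_sin R)).
Qed.

Let iG' : L.-integrable setT (EFin \o G').
Proof.
have i1 := integrableZl measurableT (`|a| + `|t|) (integrable_gamma a0).
have i2 : L.-integrable setT (EFin \o (fun v => expR ((a + 1) * v) * gw v)).
  by apply: integrable_gamma; rewrite addr_gt0.
apply: le_integrable (integrableD measurableT i1 i2) => //.
  by rewrite /comp /G'; mfun.
move=> v _; rewrite /= lee_fin.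
rewrite [leRHS]ger0_norm; last first.
  by rewrite addr_ge0 ?mulr_ge0 ?addr_ge0 ?expR_ge0// ltW// gamma_weight_gt0.
have gv := ltW (gamma_weight_gt0 v).
have cos1 : `|cos (t * v + c)| <= 1 by rewrite ler_norml cos_geN1 cos_le1.
have sin1 : `|sin (t * v + c)| <= 1 by rewrite ler_norml sin_geN1 sin_le1.
rewrite /G' (le_trans (ler_normB _ _))// lerD//.
  have e1 : 0 <= expR (a * v) * gw v by rewrite mulr_ge0 ?expR_ge0.
  rewrite normrM mulrC (ger0_norm e1) ler_wpM2r//.
  rewrite (le_trans (ler_normB _ _))// !normrM lerD// -[leRHS]mulr1; exact: ler_wpM2l.
have e2 : 0 <= expR ((a + 1) * v) * gw v by rewrite mulr_ge0 ?expR_ge0.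
by rewrite normrM (ger0_norm e2) ler_piMr.
Qed.

Let G_bound (n : nat) : `|G n%:R - G (- n%:R)| <= (1 + expR (2 * a ^+ 2)) * expR (- a) ^+ n.
Proof.
have cos1 v : `|cos (t * v + c)| <= 1 by rewrite ler_norml cos_geN1 cos_le1.
rewrite (le_trans (ler_normB _ _))// mulrDl mul1r addrC lerD//.
  rewrite /G normrM ger0_norm ?expR_ge0// -expRM_natl (le_trans (ler_piMr _ (cos1 _)))// ?expR_ge0//.
  by rewrite ler_expR; have := expR_ge0 (- n%:R : R); lra.
rewrite /G normrM ger0_norm ?expR_ge0// -expRM_natl (le_trans (ler_piMr _ (cos1 _)))// ?expR_ge0//.
rewrite -expRD ler_expR.
(* e^n >= n^2 / 2 >= 2 a n - 2 a^2, the second inequality being (n - 2 a)^2 >= 0. This is the origin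
   of the constant 2 a^2 in the bound. *)
have := @expR_ge1Dxn R n%:R 1 (ler0n _ _); rewrite (_ : 2`!%:R = 2 :> R)//.
have := sqr_ge0 (n%:R - 2 * a); nra.
Qed.

Let derivable_G' (v : R) : derivable G' v 1.
Proof. by rewrite /G' /gamma_weight; apply: ex_derive. Qed.

(** The fundamental theorem of calculus on [-n, n], where [G_bound] makes the boundary terms tend to
    0; dominated convergence passes to the whole line. *)
Lemma integral_gamma_derivative : (\int[L]_v (G' v)%:E = 0)%E.
Proof.
have cG (v : R) : {for v, continuous G}.
  exact/differentiable_continuous/derivable1_diffP/ex_derive.
have cG' (v : R) : {for v, continuous G'}.
  exact/differentiable_continuous/derivable1_diffP.
have b0 := @cvg_geometric R (1 + expR (2 * a ^+ 2)) (expR (- a)).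
rewrite ger0_norm ?expR_ge0// expR_lt1 oppr_lt0 in b0; move: b0 => /(_ a0) b0.
have lim0 : (G n%:R - G (- n%:R) @[n --> \oo] --> (0 : R)).
  apply: norm_cvg0; apply: (squeeze_cvgr _ (cvg_cst 0) b0); near=> n.
  by rewrite normr_ge0 /= G_bound.
pose f_ (n : nat) : R -> \bar R := (EFin \o G') \_ `[(- n%:R)%R, (n%:R)%R].
have lim1 : (\int[L]_v f_ n v @[n --> \oo] --> \int[L]_v (G' v)%:E)%E.
  apply: (@dominated_cvg _ (measurableTypeR R) R L setT measurableT f_ (EFin \o G') (abse \o (EFin \o G'))).
  - move=> n; apply/(measurable_restrictT _ _).1 => //.
    by apply: measurable_funTS; rewrite /comp/G'; mfun.
  - move=> x _; apply: cvg_near_cst; near=> n; rewrite /f_ patchE mem_setE in_itv/=.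
    by rewrite -ler_norml ifT//; near: n; exact: nbhs_infty_ger.
  - by move=> x _.
  - exact: integrable_abse.
  - move=> n x _; rewrite /f_ patchE; case: ifP => // _.
    by rewrite (_ : point = 0%E)// abse0 abse_ge0.
apply: (cvg_unique _ lim1) => //.
rewrite /=; have lim0' : ((G n%:R - G (- n%:R))%:E @[n --> \oo] --> (0%:E : \bar R)).
  by apply: cvg_comp lim0 _; exact: cvg_id.
apply: cvg_trans lim0'.
apply: near_eq_cvg; near=> n.
have n0 : (0 < n)%N by near: n; exact: nbhs_infty_gt.
rewrite /f_ -integral_mkcond/= (@continuous_FTC2 _ _ G)//.
- have n1 : (0 < n%:R :> R) by rewrite ltr0n.
  by apply: (lt_trans _ n1); rewrite oppr_lt0.
- by apply: continuous_subspaceT => x; exact: cG'.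
- split; first by move=> x _; apply: ex_derive.
  + exact/cvg_at_right_filter/cG.
  + exact/cvg_at_left_filter/cG.
- by move=> x _; rewrite derive1E; have /@derive_val -> := G'E x.
Unshelve. all: by end_near.
Qed.

End derivative.

Lemma Gam_ReIm (s : R[i]) : Gam s =
  (\int[L]_v (expR (complex.Re s * v) * gw v * cos (complex.Im s * v))) +i*
  (\int[L]_v (expR (complex.Re s * v) * gw v * sin (complex.Im s * v))).
Proof.
rewrite /Gam /cintegral; congr (_ +i* _); apply: eq_Rintegral => v _.
  by rewrite mulrC Re_realM /cexp/=; ring.
by rewrite mulrC Im_realM /cexp/=; ring.
Qed.

Lemma Gam_ReIm_integrable (s : R[i]) : 0 < complex.Re s ->
  L.-integrable setT
    (EFin \o (fun v => expR (complex.Re s * v) * gw v * cos (complex.Im s * v))) /\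
  L.-integrable setT
    (EFin \o (fun v => expR (complex.Re s * v) * gw v * sin (complex.Im s * v))).
Proof.
move=> s0; have [h1 h2] := cintegrable_gamma s0; split.
  apply: eq_integrable h1 => // v _; rewrite mulrC Re_realM /cexp/=; congr EFin; ring.
apply: eq_integrable h2 => // v _; rewrite mulrC Im_realM /cexp/=; congr EFin; ring.
Qed.

Lemma GamS (s : R[i]) : 0 < complex.Re s -> Gam (s + 1) = s * Gam s.
Proof.
move=> s0; have [ic iS] := Gam_ReIm_integrable s0.
have s1 : 0 < complex.Re (s + 1) by case: (s) s0 => /= *; lra.
have [ic1 is1] := Gam_ReIm_integrable s1.
rewrite !Gam_ReIm.
case: s s0 {s1} ic iS ic1 is1 => a t /= a0; rewrite addr0 => ic iS ic1 is1.
have e0 := integral_gamma_derivative t 0 a0.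
have e1 := integral_gamma_derivative t (- (pi / 2)) a0.
have combine (f g h : R -> R) (b c : R) :
    L.-integrable setT (EFin \o f) -> L.-integrable setT (EFin \o g) ->
    L.-integrable setT (EFin \o h) ->
    (\int[L]_v (b * f v + c * g v - h v)%:E = 0)%E ->
    \int[L]_v h v = b * \int[L]_v f v + c * \int[L]_v g v.
  move=> fi gi hi e.
  have fi' : L.-integrable setT (EFin \o (fun v => b * f v)) := integrableZl measurableT b fi.
  have gi' : L.-integrable setT (EFin \o (fun v => c * g v)) := integrableZl measurableT c gi.
  have si : L.-integrable setT (EFin \o (fun v => b * f v + c * g v)) := integrableD measurableT fi' gi'.
  apply/esym/eqP; rewrite -subr_eq0 -!RintegralZl// -RintegralD// -RintegralB//.
  by rewrite /Rintegral e.
rewrite (combine _ _ _ a (- t) ic iS ic1); last first.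
  rewrite -[RHS]e0; apply: eq_integral => v _; congr EFin; rewrite addr0; ring.
rewrite (combine _ _ _ a t iS ic is1); last first.
  rewrite -[RHS]e1; apply: eq_integral => v _; congr EFin.
  by rewrite cosB sinB cos_pihalf sin_pihalf; ring.
by apply/eqP; rewrite eq_complex/=; apply/andP; split; apply/eqP; ring.
Qed.

End gamma_functional_equation.

(** * Non-vanishing of Gamma *)

Section gamma_nonzero.
Context {R : realType}.
Local Notation L := (@lebesgue_measure R).
Local Notation gw := (@gamma_weight R).
Let mw := @measurable_gamma_weight R.

Lemma sqr_sin_le (y : R) : sin y ^+ 2 <= y ^+ 2.
Proof.
wlog y0 : y / 0 <= y.
  move=> h; have [/h//|y0] := leP 0 y.
  by have := h (- y); rewrite sinN !sqrrN oppr_ge0 => /(_ (ltW y0)).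
have [c _] : exists2 c, c \in `[0, y] & sin y - sin 0 = cos c * (y - 0).
  apply: (@MVT_segment _ sin cos) => //.
  by apply: continuous_subspaceT; exact: continuous_sin.
by rewrite sin0 !subr0 => ->; rewrite exprMn ler_piMl ?sqr_ge0.
Qed.

Lemma cos_ge1B (x : R) : 1 - x ^+ 2 / 2 <= cos x.
Proof.
have -> : cos x = 1 - 2 * sin (x / 2) ^+ 2.
  rewrite {1}(_ : x = x / 2 + x / 2); last by field.
  by rewrite cosD -!expr2 cos2sin2; ring.
by have := sqr_sin_le (x / 2); lra.
Qed.

(** The bracket is the square of e^(v/2) - e^(-v/2). The factor 4 leaves room for the crude estimate
    of this difference by v / 2 when v >= 0. *)
Lemma sqr_le_expR (v : R) : v ^+ 2 <= 4 * (expR v - 2 + expR (- v)).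
Proof.
wlog v0 : v / 0 <= v.
  move=> h; have [/h//|v0] := leP 0 v.
  have := h (- v); rewrite sqrrN opprK oppr_ge0 => /(_ (ltW v0)); lra.
set e := expR (v / 2); set f := expR (- (v / 2)).
have ef : e * f = 1 by rewrite -expRD subrr expR0.
have e1 : 1 + v / 2 <= e by exact: expR_ge1Dx.
have f0 : 0 <= f by exact: expR_ge0.
have -> : expR v = e ^+ 2 by rewrite -expRM_natl; congr expR; field.
have -> : expR (- v) = f ^+ 2 by rewrite -expRM_natl; congr expR; field.
have -> : e ^+ 2 - 2 + f ^+ 2 = (e - f) ^+ 2 + 2 * (e * f - 1) by ring.
rewrite ef subrr mulr0 addr0.
have h : v / 2 <= e - f.
  have f1 : f <= 1 by rewrite expR_le1; lra.
  lra.
have : (v / 2) ^+ 2 <= (e - f) ^+ 2 by rewrite ler_sqr ?nnegrE; lra.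
lra.
Qed.

Definition rGam (a : R) : R := \int[L]_v (expR (a * v) * gw v).

Lemma Gam_real (a : R) : Gam a%:C = (rGam a)%:C.
Proof.
rewrite Gam_ReIm /rGam/=; congr (_ +i* _).
  by apply: eq_Rintegral => v _; rewrite mul0r cos0 mulr1.
rewrite /Rintegral integral0_eq// => v _.
by rewrite mul0r sin0 mulr0.
Qed.

Lemma rGamS (a : R) : 0 < a -> rGam (a + 1) = a * rGam a.
Proof.
move=> a0; have := @GamS R a%:C a0.
by rewrite -[X in _ + X]/(1%:C) -rmorphD/= !Gam_real -rmorphM/= => -[].
Qed.

Lemma lebesgue_setT_neq0 : L [set: R] != 0%E.
Proof.
have := lebesgue_measure_itv `]-oo, +oo[ : L _ = _.
by rewrite set_itvNyy/= => ->.
Qed.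

Lemma rGam_gt0 (a : R) : 0 < a -> 0 < rGam a.
Proof.
move=> a0; rewrite lt_def; apply/andP; split; last first.
  by apply: Rintegral_ge0 => v _; rewrite mulr_ge0 ?expR_ge0// ltW// gamma_weight_gt0.
have := integrable_fin_num measurableT (integrable_gamma a0).
have : (\int[L]_v (expR (a * v) * gw v)%:E != 0)%E.
  apply: integral_pos_neq0; first by mfun.
    by move=> v; rewrite mulr_gt0 ?expR_gt0 ?gamma_weight_gt0.
  exact: lebesgue_setT_neq0.
rewrite /rGam /Rintegral /comp => + /fineK e; apply: contraNN => /eqP f0.
by rewrite -e f0.
Qed.

(* With l = ln (Re s), rotating by the phase at v = l leaves the Gamma integral of
   cos (Im s (v - l)), where cos x >= 1 - x^2/2 and (v - l)^2 <= 4 (e^(v-l) - 2 +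
   e^(l-v)), the integral of which is explicit. *)
Lemma Gam_neq0_large (s : R[i]) : 1 + 2 * complex.Im s ^+ 2 < complex.Re s -> Gam s != 0.
Proof.
case: s => a t /= at1.
have a1 : 0 < a - 1 by have := sqr_ge0 t; lra.
have a0 : 0 < a by lra.
have aS : 0 < a + 1 by lra.
have ia := integrable_gamma a0; have ia1 := integrable_gamma a1.
have iaS := integrable_gamma aS.
have rS := rGamS a0; have r1 := rGamS a1; rewrite subrK in r1.
have ra := rGam_gt0 a0.
have s0 : 0 < complex.Re (a +i* t) by [].
have [ic iS] := Gam_ReIm_integrable s0; rewrite /= in ic iS.
apply/eqP; rewrite Gam_ReIm/= => -[C0 S0].
set l := ln a.
pose f v := expR (a * v) * gw v.
pose g v := cos (t * l) * (f v * cos (t * v)) + sin (t * l) * (f v * sin (t * v)).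
have ic' : L.-integrable setT (EFin \o (fun v => cos (t * l) * (f v * cos (t * v)))).
  exact: (integrableZl measurableT (cos (t * l)) ic).
have iS' : L.-integrable setT (EFin \o (fun v => sin (t * l) * (f v * sin (t * v)))).
  exact: (integrableZl measurableT (sin (t * l)) iS).
have ig : L.-integrable setT (EFin \o g) := integrableD measurableT ic' iS'.
have g0 : \int[L]_v g v = 0.
  by rewrite /g RintegralD// !RintegralZl// C0 S0 !mulr0 addr0.
pose h1 v := (1 + 4 * t ^+ 2) * f v.
pose h2 v := (2 * t ^+ 2 / a) * (expR ((a + 1) * v) * gw v).
pose h3 v := (2 * t ^+ 2 * a) * (expR ((a - 1) * v) * gw v).
have i1 : L.-integrable setT (EFin \o h1) := integrableZl measurableT _ ia.
have i2 : L.-integrable setT (EFin \o h2) := integrableZl measurableT _ iaS.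
have i3 : L.-integrable setT (EFin \o h3) := integrableZl measurableT _ ia1.
have i12 : L.-integrable setT (EFin \o (fun v => h1 v - h2 v)) := integrableB measurableT i1 i2.
have ih : L.-integrable setT (EFin \o (fun v => h1 v - h2 v - h3 v)) :=
  integrableB measurableT i12 i3.
have : \int[L]_v (h1 v - h2 v - h3 v) <= \int[L]_v g v.
  apply: le_Rintegral => // v _.
  have -> : g v = f v * cos (t * (v - l)) by rewrite /g mulrBr cosB; ring.
  have -> : h1 v - h2 v - h3 v =
      f v * (1 - 2 * t ^+ 2 * (expR (v - l) - 2 + expR (- (v - l)))).
    rewrite /h1 /h2 /h3 /f.
    have -> : expR ((a + 1) * v) = expR (a * v) * expR v by rewrite mulrDl mul1r expRD.
    have -> : expR ((a - 1) * v) = expR (a * v) / expR v by rewrite mulrBl mul1r expRD expRN.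
    have -> : expR (v - l) = expR v / a by rewrite expRD expRN lnK ?posrE.
    have -> : expR (- (v - l)) = a / expR v by rewrite opprB expRD expRN lnK ?posrE.
    by field; rewrite !gt_eqF ?expR_gt0.
  apply: ler_wpM2l; first by rewrite mulr_ge0 ?expR_ge0// ltW// gamma_weight_gt0.
  apply: le_trans (cos_ge1B _); rewrite lerD2l lerN2 exprMn.
  have := sqr_le_expR (v - l); have := sqr_ge0 t; set X := _ - 2 + _; nra.
rewrite g0 RintegralB// RintegralB// /h1 /h2 /h3 !RintegralZl//.
rewrite -/(rGam a) -/(rGam (a + 1)) -/(rGam (a - 1)) rS leNgt => /negP; apply.
(* The lower bound is explicit by the functional equation, and its sign explains the threshold 1 + 2
   (Im s)^2. *)
have -> : (1 + 4 * t ^+ 2) * rGam a - 2 * t ^+ 2 / a * (a * rGam a) -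
    2 * t ^+ 2 * a * rGam (a - 1) = rGam (a - 1) * (a - 1 - 2 * t ^+ 2).
  by rewrite r1; field; rewrite gt_eqF.
by rewrite mulr_gt0 ?rGam_gt0//; lra.
Qed.

(** By the functional equation a zero at s propagates to all s + n. Their imaginary parts are
    constant, so for large n [Gam_neq0_large] is contradicted. *)
Lemma Gam_neq0 (s : R[i]) : 0 < complex.Re s -> Gam s != 0.
Proof.
move=> s0; apply/negP => /eqP G0.
have Gn n : Gam (s + n%:R) = 0 /\ 0 < complex.Re (s + n%:R) /\
    complex.Re (s + n%:R) = complex.Re s + n%:R /\ complex.Im (s + n%:R) = complex.Im s.
  elim: n => [|n [IH [r0 [rn im]]]]; first by rewrite !addr0.
  have e : s + n.+1%:R = (s + n%:R) + 1 by rewrite -natr1 addrA.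
  have re1 (z : R[i]) : complex.Re (z + 1) = complex.Re z + 1 by case: z.
  have im1 (z : R[i]) : complex.Im (z + 1) = complex.Im z by case: z => * /=; rewrite addr0.
  by rewrite e GamS// IH mulr0 re1 im1 rn im -natr1 addrA; split => //; split => //; lra.
pose n := (Num.truncn (1 + 2 * complex.Im s ^+ 2)).+1.
have [Gn0 [_ [rn im]]] := Gn n.
have := @Gam_neq0_large (s + n%:R); rewrite rn im Gn0 eqxx => h.
suff : false by []; apply: h.
have := truncnS_gt (1 + 2 * complex.Im s ^+ 2); rewrite -/n; lra.
Qed.

End gamma_nonzero.

(** * Beta integrals of radial functions *)

Section radial_beta.
Context {R : realType}.
Local Notation L := (@lebesgue_measure R).

(** The shift of the exponent by q / 2 absorbs the radial density e^(q v / 2), so that a and b are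
    the parameters of the beta integral. *)
Lemma nspace_beta d (T : measurableType d) (mu : {sigma_finite_measure set T -> \bar R})
    (sc : R -> T -> T) (N : T -> R) (q : nat) :
  nspace mu sc N q -> (0 < q)%N -> exists2 C : R, 0 < C &
  forall a b : R[i], 0 < complex.Re a -> complex.Re a < complex.Re b ->
    cintegrable mu setT
      (fun x => cexp (a - (q%:R / 2)%:C) (ln (N x)) * cexp (- b) (ln (1 + N x))) /\
    Gam b * cintegral mu setT
      (fun x => cexp (a - (q%:R / 2)%:C) (ln (N x)) * cexp (- b) (ln (1 + N x))) =
    C%:C * (Gam (b - a) * Gam a).
Proof.
move=> H q0; have [C C0 HC] := radial H q0; exists C => // a b a0 ab.
pose F (t : R) := cexp (a - (q%:R / 2)%:C) (ln t) * cexp (- b) (ln (1 + t)).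
have mN := ns_meas H.
have law : same_law mu L (fun=> 1) (fun v : measurableTypeR R => expR (q%:R / 2 * v))
    N (@expR R) C.
  move=> G mG G0; under eq_integral do rewrite mul1e.
  exact: HC.
have mF : cmeasurable (F : measurableTypeR R -> R[i]).
  by apply: cmeasurableM; apply: measurable_cexp; mfun.
have e : (fun v : measurableTypeR R => (expR (q%:R / 2 * v))%:C * F (expR v)) =
    (fun u => cexp a u * cexp (- b) (ln (1 + expR u))).
  apply/funext => v; rewrite /F (expRK v) mulrA -(cexp_real (q%:R / 2) v) -(cexpDl _ _ v).
  by rewrite [(q%:R / 2)%:C + _]addrC subrK.
have e' : (fun x => (1 : R)%:C * F (N x)) = (fun x => F (N x)).
  by apply/funext => x; rewrite mul1r.
have mw1 : measurable_fun setT (fun _ : T => 1 : R) by mfun.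
have [] := cintegral_transfer law (ltW C0) (fun=> ler01) (fun=> expR_ge0 _) mw1 mN mF.1 mF.2.
  by rewrite e; exact: cintegrable_beta.
rewrite e e' => ? ->; split => //.
by rewrite mulrCA beta_Gam.
Qed.

(** The case n = 0 arises for m = 1, where x_1 is absent, and for F = R, where Im F is 0. The space
    is then a point, the integrand is 1, and the identity is trivial for every b. For n > 0 the
    constant absorbs Gamma(nq / 2). *)
Lemma tuple_beta d (T : measurableType d) (mu : {sigma_finite_measure set T -> \bar R})
    (sc : R -> T -> T) (N : T -> R) (q n : nat) :
  nspace mu sc N q -> (0 < q)%N -> exists2 C : R, 0 < C &
  forall b : R[i], (n == 0%N) || ((n * q)%:R / 2 < complex.Re b) ->
    cintegrable (tuple_measure mu n) setT
      (fun x => cexp (- b) (ln (1 + \sum_(a <- x) N a))) /\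
    Gam b * cintegral (tuple_measure mu n) setT
      (fun x => cexp (- b) (ln (1 + \sum_(a <- x) N a))) =
    C%:C * Gam (b - ((n * q)%:R / 2)%:C).
Proof.
move=> H q0; have Hn := nspace_tuple H n.
have mS := ns_meas Hn.
case: n => [|n] in Hn mS *.
  exists 1 => // b _; rewrite mul0n mul0r subr0 mul1r.
  have dirac (f : 0.-tuple T -> R) : measurable_fun setT f ->
      (tuple_measure mu 0).-integrable setT (EFin \o f) /\
      \int[tuple_measure mu 0]_x f x = f [tuple].
    move=> mf; have mfE : measurable_fun setT (EFin \o f) by apply/measurable_EFinP.
    split; last by rewrite /Rintegral (integral_tuple0 mu mfE).
    apply/integrableP; split => //.
    rewrite (integral_tuple0 mu (f := fun x => `|(f x)%:E|%E)) ?ltry//.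
    exact: measurableT_comp mfE.
  have [mr mi] := measurable_cexp (- b) (f := fun x : 0.-tuple T => ln (1 + \sum_(a <- x) N a))
    ltac:(mfun).
  have [ir er] := dirac _ mr; have [ii ei] := dirac _ mi.
  split; first by split.
  rewrite /cintegral er ei big_nil addr0 ln1 cexp0 /=.
  by rewrite -[RHS]mulr1.
have nq : (0 < n.+1 * q)%N by rewrite muln_gt0.
have [C C0 HC] := nspace_beta Hn nq.
have Q0 : 0 < (n.+1 * q)%:R / 2 :> R by rewrite divr_gt0// ltr0n.
exists (C * rGam ((n.+1 * q)%:R / 2)); first by rewrite mulr_gt0// rGam_gt0.
move=> b /= hb; have [] := HC ((n.+1 * q)%:R / 2)%:C b Q0 hb.
under eq_fun do rewrite subrr cexp0l mul1r.
by move=> ? ->; split => //; rewrite Gam_real (rmorphM _ C) mulrA [RHS]mulrAC.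
Qed.

(* Takes the place of the duplication formula. *)
Lemma Gam_ratio (e : nat) (t : R[i]) : 0 < complex.Re t ->
  Gam (t / 2) * Gam ((t + 1) / 2) * Gam (t + e%:R) =
  2 ^+ e * (Gam ((t + e%:R) / 2) * Gam ((t + e%:R + 1) / 2) * Gam t).
Proof.
move=> t0; elim: e => [|e IH]; first by rewrite addr0 mul1r.
have te : 0 < complex.Re (t + e%:R).
  have -> : (e%:R : R[i]) = (e%:R : R)%:C by rewrite rmorph_nat.
  by case: (t) t0 => a b /= a0; rewrite ltr_wpDr.
have te2 : 0 < complex.Re ((t + e%:R) / 2).
  have -> : (t + e%:R) / 2 = (2^-1 : R)%:C * (t + e%:R) by rewrite mulrC fmorphV rmorph_nat.
  rewrite Re_realM; apply: mulr_gt0 => //; by rewrite invr_gt0 ltr0n.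
(* From e to e + 1 the left side gains the factor t + e and the Gamma factors on the right gain (t +
   e) / 2, whence one more 2. *)
rewrite -(@natr1 _ e) addrA GamS// [LHS]mulrCA IH exprS.
have -> : (t + e%:R + 1 + 1) / 2 = (t + e%:R) / 2 + 1 by field.
by rewrite GamS//; field.
Qed.

End radial_beta.

(** * Cayley-Dickson algebras *)

Definition cd_norm (R : realType) k (a : nat -> R) : R := \sum_(i < 2 ^ k) a i ^+ 2.

(** Expands a coordinate of an identity into a polynomial in the entries of its arguments. Indices
    are evaluated to numerals so that [ring] recognises equal entries. *)
Ltac cd_compute :=
  rewrite /cd_norm ?big_ord_recl ?big_ord0 /= /cd_conj /bump /=;
  repeat match goal with
  | |- context [addn ?x ?y] =>
      let z := eval compute in (addn x y) in change (addn x y) with z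
  | |- context [expn ?x ?y] =>
      let z := eval compute in (expn x y) in change (expn x y) with z
  end; rewrite /=.

Section cayley_dickson_identities.
Context {R : realType}.
Implicit Types (a b c : nat -> R) (k : nat).

(** Elements are sequences of which only the first 2^k entries count, and most rewritings below are
    valid for these entries only. *)
Lemma cd_mul_ext k a a' b b' :
  (forall i, (i < 2 ^ k)%N -> a i = a' i) -> (forall i, (i < 2 ^ k)%N -> b i = b' i) ->
  forall j, cd_mul k a b j = cd_mul k a' b' j.
Proof.
elim: k a a' b b' => [|k IH] a a' b b' ha hb j /=.
  by rewrite ha ?hb.
have lt i : (i < 2 ^ k)%N -> (i < 2 ^ k.+1)%N /\ (2 ^ k + i < 2 ^ k.+1)%N.
  by rewrite expnS mul2n -addnn => ik; rewrite ltn_add2l ik (leq_trans ik) ?leq_addr.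
have sa i : (i < 2 ^ k)%N -> a i = a' i /\ a (2 ^ k + i)%N = a' (2 ^ k + i)%N.
  by move=> /lt[? ?]; split; exact: ha.
have sb i : (i < 2 ^ k)%N -> b i = b' i /\ b (2 ^ k + i)%N = b' (2 ^ k + i)%N.
  by move=> /lt[? ?]; split; exact: hb.
have k0 : (0 < 2 ^ k)%N by rewrite expn_gt0.
case: ifP => _; congr (_ + _); try congr (- _); apply: IH => i ik;
  have [? ?] := sa i ik; have [? ?] := sb i ik; rewrite /cd_conj//.
- by case: ifP => _ //; [have [_ ->] := sb _ k0|congr (- _)].
- by case: ifP => _ //; [have [->] := sb _ k0|congr (- _)].
Qed.

Lemma cd_norm_ext k a a' : (forall i, (i < 2 ^ k)%N -> a i = a' i) ->
  cd_norm k a = cd_norm k a'.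
Proof. by move=> h; apply: eq_bigr => i _; rewrite h. Qed.

Lemma cd_normZ k (r : R) a : cd_norm k (fun i => r * a i) = r ^+ 2 * cd_norm k a.
Proof. by rewrite /cd_norm mulr_sumr; apply: eq_bigr => i _; rewrite exprMn. Qed.

Lemma cd_norm_conj k a : cd_norm k (cd_conj a) = cd_norm k a.
Proof. by apply: eq_bigr => i _; rewrite /cd_conj; case: ifP => [/eqP ->//|_]; rewrite sqrrN. Qed.

Lemma cd_norm_ge0 k a : 0 <= cd_norm k a.
Proof. by apply: sumr_ge0 => i _; exact: sqr_ge0. Qed.

Lemma cd_mulD k : (forall a a' b j,
    cd_mul k (fun i => a i + a' i) b j = cd_mul k a b j + cd_mul k a' b j) /\
  (forall a b b' j,
    cd_mul k a (fun i => b i + b' i) j = cd_mul k a b j + cd_mul k a b' j).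
Proof.
have cjD a b : cd_conj (fun i => a i + b i) = (fun i => cd_conj a i + cd_conj b i).
  by apply/funext => i; rewrite /cd_conj; case: ifP => // _; rewrite opprD.
elim: k => [|k [IHl IHr]]; split=> [a a' b j|a b b' j] /=.
- by rewrite mulrDl.
- by rewrite mulrDr.
- by case: ifP => _; rewrite ?cjD !(IHl, IHr); ring.
- by case: ifP => _; rewrite ?cjD !(IHl, IHr); ring.
Qed.

Lemma cd_mulDl k a a' b j :
  cd_mul k (fun i => a i + a' i) b j = cd_mul k a b j + cd_mul k a' b j.
Proof. exact: (cd_mulD k).1. Qed.

Lemma cd_mulDr k a b b' j :
  cd_mul k a (fun i => b i + b' i) j = cd_mul k a b j + cd_mul k a b' j.
Proof. exact: (cd_mulD k).2. Qed.

Lemma cd_mulZ k : (forall (r : R) a b j,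
    cd_mul k (fun i => r * a i) b j = r * cd_mul k a b j) /\
  (forall (r : R) a b j, cd_mul k a (fun i => r * b i) j = r * cd_mul k a b j).
Proof.
have cjZ (r : R) a : cd_conj (fun i => r * a i) = (fun i => r * cd_conj a i).
  by apply/funext => i; rewrite /cd_conj; case: ifP => // _; rewrite mulrN.
elim: k => [|k [IHl IHr]]; split=> r a b j /=.
- by rewrite mulrA.
- by rewrite mulrCA.
- by case: ifP => _; rewrite ?cjZ !(IHl, IHr); ring.
- by case: ifP => _; rewrite ?cjZ !(IHl, IHr); ring.
Qed.

Lemma cd_mulZl k (r : R) a b j : cd_mul k (fun i => r * a i) b j = r * cd_mul k a b j.
Proof. exact: (cd_mulZ k).1. Qed.

Lemma cd_mulZr k (r : R) a b j : cd_mul k a (fun i => r * b i) j = r * cd_mul k a b j.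
Proof. exact: (cd_mulZ k).2. Qed.

Lemma cd_mul_suml k p (f : 'I_p -> nat -> R) b j :
  cd_mul k (fun j => \sum_(i < p) f i j) b j = \sum_(i < p) cd_mul k (f i) b j.
Proof.
elim: p f => [|p IH] f.
  rewrite big_ord0 -[RHS](mul0r (cd_mul k (fun=> 0) b j)) -cd_mulZl.
  by apply: cd_mul_ext => // i _; rewrite big_ord0 mul0r.
rewrite big_ord_recl -IH -cd_mulDl; apply: cd_mul_ext => // i _.
by rewrite big_ord_recl.
Qed.

Lemma cd_mul_sumr k p (f : 'I_p -> nat -> R) a j :
  cd_mul k a (fun j => \sum_(i < p) f i j) j = \sum_(i < p) cd_mul k a (f i) j.
Proof.
elim: p f => [|p IH] f.
  rewrite big_ord0 -[RHS](mul0r (cd_mul k a (fun=> 0) j)) -cd_mulZr.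
  by apply: cd_mul_ext => // i _; rewrite big_ord0 mul0r.
rewrite big_ord_recl -IH -cd_mulDr; apply: cd_mul_ext => // i _.
by rewrite big_ord_recl.
Qed.

Lemma cd_mulA k a b c j : (k <= 2)%N -> (j < 2 ^ k)%N ->
  cd_mul k (cd_mul k a b) c j = cd_mul k a (cd_mul k b c) j.
Proof.
case: k => [_|[_|[_|//]]].
- by do 1 (case: j => [|j]; [by move=> _; cd_compute; ring|]).
- by do 2 (case: j => [|j]; [by move=> _; cd_compute; ring|]).
- by do 4 (case: j => [|j]; [by move=> _; cd_compute; ring|]).
Qed.

Lemma cd_conjM k a b j : (k <= 3)%N -> (j < 2 ^ k)%N ->
  cd_conj (cd_mul k a b) j = cd_mul k (cd_conj b) (cd_conj a) j.
Proof.
case: k => [_|[_|[_|[_|//]]]].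
- by do 1 (case: j => [|j]; [by move=> _; cd_compute; ring|]).
- by do 2 (case: j => [|j]; [by move=> _; cd_compute; ring|]).
- by do 4 (case: j => [|j]; [by move=> _; cd_compute; ring|]).
- by do 8 (case: j => [|j]; [by move=> _; cd_compute; ring|]).
Qed.

Lemma cd_normM k a b : (k <= 3)%N ->
  cd_norm k (cd_mul k a b) = cd_norm k a * cd_norm k b.
Proof. by case: k => [_|[_|[_|[_|//]]]]; cd_compute; ring. Qed.

(** With [cd_mulVK] this is the form in which alternativity replaces associativity. It survives in
    the octonions, where [cd_mulA] fails. *)
Lemma cd_mulK k a b j : (k <= 3)%N -> (j < 2 ^ k)%N ->
  cd_mul k (cd_mul k a b) (cd_conj b) j = cd_norm k b * a j.
Proof.
case: k => [_|[_|[_|[_|//]]]].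
- by do 1 (case: j => [|j]; [by move=> _; cd_compute; ring|]).
- by do 2 (case: j => [|j]; [by move=> _; cd_compute; ring|]).
- by do 4 (case: j => [|j]; [by move=> _; cd_compute; ring|]).
- by do 8 (case: j => [|j]; [by move=> _; cd_compute; ring|]).
Qed.

Lemma cd_mulVK k a b j : (k <= 3)%N -> (j < 2 ^ k)%N ->
  cd_mul k a (cd_mul k (cd_conj a) b) j = cd_norm k a * b j.
Proof.
case: k => [_|[_|[_|[_|//]]]].
- by do 1 (case: j => [|j]; [by move=> _; cd_compute; ring|]).
- by do 2 (case: j => [|j]; [by move=> _; cd_compute; ring|]).
- by do 4 (case: j => [|j]; [by move=> _; cd_compute; ring|]).
- by do 8 (case: j => [|j]; [by move=> _; cd_compute; ring|]).
Qed.

Definition cd_one : nat -> R := fun i => (i == 0%N)%:R.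

Lemma cd_mul_sqr k a j : (k <= 3)%N -> (j < 2 ^ k)%N ->
  cd_mul k a a j = 2 * a 0%N * a j - cd_norm k a * cd_one j.
Proof.
rewrite /cd_one; case: k => [_|[_|[_|[_|//]]]].
- by do 1 (case: j => [|j]; [by move=> _; cd_compute; ring|]).
- by do 2 (case: j => [|j]; [by move=> _; cd_compute; ring|]).
- by do 4 (case: j => [|j]; [by move=> _; cd_compute; ring|]).
- by do 8 (case: j => [|j]; [by move=> _; cd_compute; ring|]).
Qed.

Lemma cd_mul1l k b j : (k <= 3)%N -> (j < 2 ^ k)%N -> cd_mul k cd_one b j = b j.
Proof.
rewrite /cd_one; case: k => [_|[_|[_|[_|//]]]].
- by do 1 (case: j => [|j]; [by move=> _; cd_compute; ring|]).
- by do 2 (case: j => [|j]; [by move=> _; cd_compute; ring|]).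
- by do 4 (case: j => [|j]; [by move=> _; cd_compute; ring|]).
- by do 8 (case: j => [|j]; [by move=> _; cd_compute; ring|]).
Qed.

Lemma cd_mulr1 k a j : (k <= 3)%N -> (j < 2 ^ k)%N -> cd_mul k a cd_one j = a j.
Proof.
rewrite /cd_one; case: k => [_|[_|[_|[_|//]]]].
- by do 1 (case: j => [|j]; [by move=> _; cd_compute; ring|]).
- by do 2 (case: j => [|j]; [by move=> _; cd_compute; ring|]).
- by do 4 (case: j => [|j]; [by move=> _; cd_compute; ring|]).
- by do 8 (case: j => [|j]; [by move=> _; cd_compute; ring|]).
Qed.

Lemma cd_mul_conj_re k a b : (k <= 3)%N ->
  cd_mul k (cd_conj a) b 0 = \sum_(i < 2 ^ k) a i * b i.
Proof. by case: k => [_|[_|[_|[_|//]]]]; cd_compute; ring. Qed.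

Lemma cd_mul_conjl k a j : (k <= 3)%N -> (j < 2 ^ k)%N ->
  cd_mul k (cd_conj a) a j = cd_norm k a * cd_one j.
Proof.
rewrite /cd_one; case: k => [_|[_|[_|[_|//]]]].
- by do 1 (case: j => [|j]; [by move=> _; cd_compute; ring|]).
- by do 2 (case: j => [|j]; [by move=> _; cd_compute; ring|]).
- by do 4 (case: j => [|j]; [by move=> _; cd_compute; ring|]).
- by do 8 (case: j => [|j]; [by move=> _; cd_compute; ring|]).
Qed.

End cayley_dickson_identities.

(** * Motions of the domain: algebra *)

Section siegel_domain.
Context {R : realType} (k p : nat).
(** Here p = m - 1. For the octonions p = 0, and the sums over ['I_p] whose terms would have to be
    reassociated are empty. *)
Hypotheses (k3 : (k <= 3)%N) (assoc : (k <= 2)%N \/ p = 0%N).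
Implicit Types (x y : 'I_p -> nat -> R) (z w : nat -> R) (a b : R).
Local Notation N := (@cd_norm R k).
Local Notation "a ** b" := (cd_mul k a b) (at level 40).

(* A point (x, z, a) of F^(m-1) x Im F x R stands for the pair of x and a + 2 z; the
   domain a > |x|^2 is the hyperbolic space of the subgroup. *)
Definition cd_zeta a z : nat -> R := fun i => if i is j.+1 then 2 * z j else a.

Definition fprod y x : nat -> R := fun j => \sum_(i < p) (cd_conj (y i) ** x i) j.
Definition fnorm x : R := \sum_(i < p) N (x i).

Lemma fprodDr y x x' j : fprod y (fun i l => x i l + x' i l) j = fprod y x j + fprod y x' j.
Proof. by rewrite /fprod -big_split; apply: eq_bigr => i _; rewrite /= cd_mulDr. Qed.

Lemma fprodZr y (r : R) x j : fprod y (fun i l => r * x i l) j = r * fprod y x j.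
Proof. by rewrite /fprod mulr_sumr; apply: eq_bigr => i _; rewrite cd_mulZr. Qed.

Lemma fprodZl y (r : R) x j : fprod (fun i l => r * y i l) x j = r * fprod y x j.
Proof.
rewrite /fprod mulr_sumr; apply: eq_bigr => i _; rewrite -cd_mulZl.
apply: cd_mul_ext => // l _; rewrite /cd_conj; case: ifP => // _; by rewrite mulrN.
Qed.

Let no_ord : p = 0%N -> 'I_p -> False. Proof. by move=> -> []. Qed.

Lemma fprod_mulr y x c j : (j < 2 ^ k)%N ->
  fprod y (fun i => x i ** c) j = (fprod y x ** c) j.
Proof.
move=> jk; rewrite /fprod cd_mul_suml; apply: eq_bigr => i _.
by case: assoc => [k2|p0]; [rewrite cd_mulA|case: (no_ord p0 i)].
Qed.

Lemma fprod_mull y x c j : (j < 2 ^ k)%N ->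
  fprod (fun i => y i ** c) x j = (cd_conj c ** fprod y x) j.
Proof.
move=> jk; rewrite /fprod cd_mul_sumr; apply: eq_bigr => i _.
case: assoc => [k2|p0]; last by case: (no_ord p0 i).
by rewrite -cd_mulA//; apply: cd_mul_ext => // l lk; rewrite cd_conjM.
Qed.

Lemma fprod_self y j : (j < 2 ^ k)%N -> fprod y y j = fnorm y * cd_one j.
Proof.
by move=> jk; rewrite /fprod /fnorm mulr_suml; apply: eq_bigr => i _; rewrite cd_mul_conjl.
Qed.

Lemma fnormD y x : fnorm (fun i l => y i l + x i l) = fnorm y + fnorm x + 2 * fprod y x 0.
Proof.
rewrite /fnorm /fprod mulr_sumr -!big_split; apply: eq_bigr => i _ /=.
rewrite cd_mul_conj_re// /cd_norm mulr_sumr -!big_split; apply: eq_bigr => j _ /=; ring.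
Qed.

Lemma fnormZ (r : R) x : fnorm (fun i l => r * x i l) = r ^+ 2 * fnorm x.
Proof. by rewrite /fnorm mulr_sumr; apply: eq_bigr => i _; rewrite cd_normZ. Qed.

Lemma fnorm_mul x c : fnorm (fun i => x i ** c) = fnorm x * N c.
Proof. by rewrite /fnorm mulr_suml; apply: eq_bigr => i _; rewrite cd_normM. Qed.

(* The left translation by (y, w), extended to the domain. *)
Definition tau_x y x : 'I_p -> nat -> R := fun i l => y i l + x i l.
Definition tau_z y w x z : nat -> R := fun j => w j + z j + fprod y x j.+1.
Definition tau_a y x a : R := fnorm y + a + 2 * fprod y x 0.

Lemma tau_height y x a : tau_a y x a - fnorm (tau_x y x) = a - fnorm x.
Proof. by rewrite /tau_a /tau_x fnormD; ring. Qed.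

Lemma cd_zeta_tau y w x z a j :
  cd_zeta (tau_a y x a) (tau_z y w x z) j =
  cd_zeta (fnorm y) w j + cd_zeta a z j + 2 * fprod y x j.
Proof. by case: j => [|j] /=; rewrite /tau_z; [|ring]. Qed.

(* The fourth power of the gauge of (- g) h, see heis_norm_Qpoly. *)
Definition Qpoly y w x z a : R :=
  N (fun j => cd_zeta a z j + cd_conj (cd_zeta (fnorm y) w) j - 2 * fprod y x j).

(** Left invariance of the gauge: the translation by (y, w) carries the origin to (y, w), and for
    the origin Q is |zeta|^2. *)
Lemma Qpoly_tau y w x z a :
  Qpoly y w (tau_x y x) (tau_z y w x z) (tau_a y x a) = N (cd_zeta a z).
Proof.
apply: cd_norm_ext => j jk; rewrite cd_zeta_tau fprodDr fprod_self//.
by case: j jk => [|j] _ /=; rewrite /cd_one /cd_conj/= ?mulr1 ?mulr0; ring.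
Qed.

(** The point is the image of (x, z, a) under inversion and then translation. Its element 1 + zeta
    is the product of the element on the right with n^-1 conj zeta, because (eta zeta) conj zeta = n
    eta; and n^-1 conj zeta has norm n^-1. *)
Lemma N_cd_one_zeta y w x z a (eta := fun j => cd_one j + cd_zeta (fnorm y) w j)
    (zeta := cd_zeta a z) (n := N zeta) : 0 < n ->
  N (fun j => cd_one j + cd_zeta (tau_a y (fun i l => n^-1 * (x i ** cd_conj zeta) l) (n^-1 * a))
     (tau_z y w (fun i l => n^-1 * (x i ** cd_conj zeta) l) (fun j => - (n^-1 * z j))) j) =
  N (fun j => (eta ** zeta) j + (cd_one j + 2 * fprod y x j)) * n^-1.
Proof.
move=> n0; set u := fun j => _ + (_ + _).
have n1 : n^-1 = N (fun j => n^-1 * cd_conj zeta j).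
  by rewrite cd_normZ cd_norm_conj -/n expr2 -mulrA mulVf ?mulr1// gt_eqF.
rewrite [in RHS]n1 -cd_normM//; apply: cd_norm_ext => j jk.
rewrite cd_mulZr cd_zeta_tau fprodZr fprod_mulr// /u cd_mulDl cd_mulK// cd_mulDl cd_mul1l//.
rewrite cd_mulZl -/n /eta.
have -> : cd_zeta (n^-1 * a) (fun j => - (n^-1 * z j)) j = n^-1 * cd_conj zeta j.
  by rewrite /zeta; case: j jk => [|j] _ //=; rewrite /cd_conj/=; ring.
by field; rewrite gt_eqF.
Qed.

(* The dilation by s followed by the translation by (xq, wq) brings the base point (0, 0, 1)
   to its image under the inverse of the translation by (y, w) followed by the inversion. *)
Lemma N_normalize y w x z a (eta := fun j => cd_one j + cd_zeta (fnorm y) w j) (e := N eta)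
    (s : R) (xq := fun i l => - e^-1 * (y i ** eta) l) (wq := fun j => e^-1 * w j) :
  0 < e -> s ^+ 2 = e^-1 ->
  N (fun j => (eta ** cd_zeta (tau_a xq (fun i l => s * x i l) (s ^+ 2 * a))
      (tau_z xq wq (fun i l => s * x i l) (fun j => s ^+ 2 * z j))) j +
     (cd_one j + 2 * fprod y (tau_x xq (fun i l => s * x i l)) j)) =
  e^-1 * N (fun j => cd_one j + cd_zeta a z j).
Proof.
move=> e0 s2.
have ene : e != 0 by rewrite gt_eqF.
have nxq : fnorm xq = e^-1 * fnorm y.
  by rewrite /xq fnormZ fnorm_mul -/e sqrrN; field.
(* Since eta has norm e, both sides become norms of elements of F, and the elements e^-1 eta (1 +
   zeta) turn out to agree coordinate by coordinate. *)
have -> : e^-1 * N (fun j => cd_one j + cd_zeta a z j) =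
    N (fun j => e^-1 * (eta ** (fun j => cd_one j + cd_zeta a z j)) j).
  by rewrite cd_normZ cd_normM// -/e; field.
apply: cd_norm_ext => j jk.
have hz l : (l < 2 ^ k)%N -> cd_zeta (tau_a xq (fun i l => s * x i l) (s ^+ 2 * a))
    (tau_z xq wq (fun i l => s * x i l) (fun j => s ^+ 2 * z j)) l =
    e^-1 * ((eta l - cd_one l) + cd_zeta a z l + - (2 * s) * (cd_conj eta ** fprod y x) l).
  move=> lk; rewrite cd_zeta_tau fprodZr /xq fprodZl fprod_mull// nxq s2.
  by rewrite /eta; case: l lk => [|l] _ /=; rewrite /cd_one/= /wq; ring.
rewrite (cd_mul_ext (a' := eta) _ hz)// cd_mulZr.
have eta0 : eta 0%N = 1 + fnorm y by [].
have -> : fprod y (tau_x xq (fun i l => s * x i l)) j =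
    - e^-1 * fnorm y * eta j + s * fprod y x j.
  rewrite fprodDr !fprodZr fprod_mulr// -mulrA; congr (_ * _ + _).
  rewrite -[in RHS](cd_mul1l eta k3 jk) -cd_mulZl; apply: cd_mul_ext => // i ik.
  exact: fprod_self.
move: (eta) (e) eta0 ene (erefl : N eta = e) => h f h0 f0 hf.
rewrite (cd_mulDr k h (fun l => h l - cd_one l + cd_zeta a z l)) cd_mulZr cd_mulVK// hf.
rewrite (cd_mulDr k h (fun l => h l - cd_one l)) (cd_mulDr k h h (fun l => - cd_one l)).
(* The quadratic equation eta^2 = 2 (1 + |y|^2) eta - e cancels the remaining terms in |y|^2. *)
rewrite cd_mul_sqr// hf (cd_mulDr k h cd_one) cd_mulr1// h0.
have -> : (h ** (fun l => - cd_one l)) j = - h j.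
  have := @cd_mulZr R k (-1) h cd_one j; rewrite cd_mulr1// mulN1r => <-.
  by apply: cd_mul_ext => // i _; rewrite mulN1r.
by field.
Qed.

End siegel_domain.

(** * The Siegel domain *)

Section coordinates.
Context {R : realType} (k : nat).
Local Notation R' := (measurableTypeR R).
Local Notation F := (cdalg R k).
Local Notation Z := ((2 ^ k).-1.-tuple R').
Local Notation N := (@cd_norm R k).

(** [nth] with default 0 turns tuples into the sequences on which [cd_mul] operates; [vec] and
    [vecZ] lead back. The composite agrees with the original sequence only below the length of the
    tuple. *)
Definition crd p (x : p.-tuple F) : 'I_p -> nat -> R := fun i => nth 0 (tnth x i).
Definition vec p (f : 'I_p -> nat -> R) : p.-tuple F :=
  [tuple [tuple f i l | l < 2 ^ k] | i < p].
Definition vecZ (f : nat -> R) : Z := [tuple f j | j < (2 ^ k).-1].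

Lemma nth_mktuple0 q (f : nat -> R) l : (l < q)%N ->
  nth 0 [tuple f j | j < q] l = f l.
Proof.
by move=> lq; rewrite -[l]/(val (Ordinal lq)) -tnth_nth tnth_mktuple.
Qed.

Lemma crd_vec p (f : 'I_p -> nat -> R) i l : (l < 2 ^ k)%N -> crd (vec f) i l = f i l.
Proof. by move=> lk; rewrite /crd tnth_mktuple nth_mktuple0. Qed.

Lemma cd_zeta_vecZ a (f : nat -> R) j : (j < 2 ^ k)%N ->
  cd_zeta a (nth 0 (vecZ f)) j = cd_zeta a f j.
Proof.
case: j => // j jk; rewrite /cd_zeta /= nth_mktuple0//.
by rewrite -ltnS prednK// expn_gt0.
Qed.

Lemma measurable_cd_conj d (T : measurableType d) (c : T -> nat -> R) :
  (forall i, measurable_fun setT (fun t => c t i)) ->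
  forall i, measurable_fun setT (fun t => cd_conj (c t) i).
Proof.
by move=> mc [|i]; [exact: mc 0%N|]; have h := mc i.+1; rewrite /cd_conj/=; mfun.
Qed.

Lemma measurable_cd_mul d (T : measurableType d) l (a b : T -> nat -> R) :
  (forall i, measurable_fun setT (fun t => a t i)) ->
  (forall i, measurable_fun setT (fun t => b t i)) ->
  forall j, measurable_fun setT (fun t => cd_mul l (a t) (b t) j).
Proof.
elim: l a b => [|l IH] a b ma mb j /=; first by have ha := ma 0%N; have hb := mb 0%N; mfun.
case: (j < 2 ^ l)%N; [apply: measurable_funB|apply: measurable_funD];
  apply: IH => // i; exact: measurable_cd_conj.
Qed.

Lemma measurable_cd_norm d (T : measurableType d) (a : T -> nat -> R) :
  (forall i, measurable_fun setT (fun t => a t i)) ->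
  measurable_fun setT (fun t => N (a t)).
Proof. by move=> ma; apply: measurable_sum => i; have h := ma i; mfun. Qed.

Lemma measurable_cd_zeta d (T : measurableType d) (a : T -> R) (z : T -> nat -> R) :
  measurable_fun setT a -> (forall i, measurable_fun setT (fun t => z t i)) ->
  forall i, measurable_fun setT (fun t => cd_zeta (a t) (z t) i).
Proof. by move=> ma mz [|i] //=; have h := mz i; mfun. Qed.

Lemma measurable_fprod d (T : measurableType d) p (y x : T -> 'I_p -> nat -> R) :
  (forall i l, measurable_fun setT (fun t => y t i l)) ->
  (forall i l, measurable_fun setT (fun t => x t i l)) ->
  forall j, measurable_fun setT (fun t => fprod k (y t) (x t) j).
Proof.
move=> my mx j; apply: measurable_sum => i.
apply: measurable_cd_mul => [l|l]; last exact: mx.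
exact: (measurable_cd_conj (c := fun t => y t i)).
Qed.

Lemma measurable_fnorm d (T : measurableType d) p (x : T -> 'I_p -> nat -> R) :
  (forall i l, measurable_fun setT (fun t => x t i l)) ->
  measurable_fun setT (fun t => fnorm k (x t)).
Proof. by move=> mx; apply: measurable_sum => i; apply: measurable_cd_norm => l. Qed.

Lemma measurable_nth0 d (T : measurableType d) q (f : T -> q.-tuple R') l :
  measurable_fun setT f -> measurable_fun setT (fun t => nth 0 (f t) l : R).
Proof.
move=> mf; have [lq|lq] := ltnP l q; last first.
  by under eq_fun do rewrite nth_default ?size_tuple//; mfun.
rewrite (_ : (fun t => _) = fun t => tnth (f t) (Ordinal lq)); first by mfun.
by apply/funext => t; rewrite (tnth_nth 0).
Qed.

Lemma measurable_crd d (T : measurableType d) p (f : T -> p.-tuple F) i l :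
  measurable_fun setT f -> measurable_fun setT (fun t => crd (f t) i l).
Proof. by move=> mf; apply: measurable_nth0; mfun. Qed.

Lemma measurable_mktuple d (T : measurableType d) d' (T' : measurableType d') q
    (f : T -> 'I_q -> T') : (forall i, measurable_fun setT (fun t => f t i)) ->
  measurable_fun setT (fun t => [tuple f t i | i < q]).
Proof.
move=> mf; apply/measurable_fun_tnthP => i.
by rewrite (_ : _ \o _ = fun t => f t i)//; apply/funext => t /=; rewrite tnth_mktuple.
Qed.

Lemma measurable_vec d (T : measurableType d) p (f : T -> 'I_p -> nat -> R) :
  (forall i l, measurable_fun setT (fun t => f t i l)) ->
  measurable_fun setT (fun t => vec (f t)).
Proof.
move=> mf; apply: measurable_mktuple => i.
by apply: (measurable_mktuple (T' := R') (f := fun t (l : 'I_(2 ^ k)) => f t i l)) => l; exact: mf.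
Qed.

Lemma measurable_vecZ d (T : measurableType d) (f : T -> nat -> R) :
  (forall l, measurable_fun setT (fun t => f t l)) ->
  measurable_fun setT (fun t => vecZ (f t)).
Proof.
by move=> mf; apply: (measurable_mktuple (T' := R') (f := fun t (l : 'I__) => f t l)) => l; exact: mf.
Qed.

Definition nsq p (x : p.-tuple F) : R := \sum_(a <- x) \sum_(t <- (a : seq R)) t ^+ 2.

Lemma fnorm_crd p (x : p.-tuple F) : fnorm k (crd x) = nsq x.
Proof.
rewrite /fnorm /nsq big_tuple; apply: eq_bigr => i _; rewrite /cd_norm big_tuple.
by apply: eq_bigr => l _; rewrite /crd -tnth_nth.
Qed.

Lemma N_cd_zeta (a : R) (z : Z) :
  N (cd_zeta a (nth 0 z)) = a ^+ 2 + 4 * \sum_(t <- z) t ^+ 2.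
Proof.
rewrite /cd_norm; have : (2 ^ k)%N = (2 ^ k).-1.+1 by rewrite prednK// expn_gt0.
move: (2 ^ k).-1 z => q z ->; rewrite big_ord_recl /=; congr (_ + _); rewrite big_tuple mulr_sumr.
apply: eq_bigr => i _; rewrite exprMn (tnth_nth 0); congr (_ * _); ring.
Qed.

End coordinates.

(** * Lebesgue measure under the motions *)

Section siegel_measure.
Context {R : realType} (k p : nat).
Hypotheses (k3 : (k <= 3)%N) (assoc : (k <= 2)%N \/ p = 0%N).
Local Notation R' := (measurableTypeR R).
Local Notation F := (cdalg R k).
Local Notation X := (p.-tuple F).
Local Notation Z := ((2 ^ k).-1.-tuple R').
Local Notation U := (Z * R')%type.
Local Notation N := (@cd_norm R k).
Local Notation L := (@lebesgue_measure R).
Local Notation D := (2 ^ k)%N.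
Local Notation "a ** b" := (cd_mul k a b) (at level 40).

Definition muX : {sigma_finite_measure set X -> \bar R} := tuple_measure (tuple_measure L D) p.
Definition muZ : {sigma_finite_measure set Z -> \bar R} := tuple_measure L D.-1.
Definition muU : {sigma_finite_measure set U -> \bar R} := sigma_finite_prod muZ L.
Definition scX : R -> X -> X := @tuple_scale _ _ _ (@tuple_scale R _ R' *%R D) p.
Definition scZ : R -> Z -> Z := @tuple_scale R _ R' *%R D.-1.
Definition nrmU (u : U) : R := N (cd_zeta u.2 (nth 0 u.1)).

Lemma nspace_X : nspace muX scX (@nsq R k p) (p * D).
Proof.
have := nspace_tuple (nspace_tuple (@nspace_lebesgue R) D) p.
by rewrite muln1.
Qed.

Lemma nspace_Z : nspace muZ scZ (fun z => \sum_(t <- z) t ^+ 2) D.-1.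
Proof. by have := nspace_tuple (@nspace_lebesgue R) D.-1; rewrite muln1. Qed.

Lemma nspace_U : nspace muU (fun t u => (scZ t u.1, t * u.2)) nrmU D.
Proof.
have h4 : 0 < 4 :> R by rewrite ltr0n.
have := nspace_prod (nspace_weight nspace_Z h4) (@nspace_lebesgue R).
rewrite addn1 prednK ?expn_gt0//.
rewrite (_ : (fun p => _ + _) = nrmU)//.
by apply/funext => u; rewrite /nrmU N_cd_zeta addrC.
Qed.

Definition addX : X -> X -> X := @tuple_add _ _ (@tuple_add _ R' +%R D) p.
Definition addZ : Z -> Z -> Z := @tuple_add _ R' +%R D.-1.

Lemma tspace_X : tspace muX addX (@tuple_opp _ _ (@tuple_opp _ R' -%R D) p).
Proof. exact: tspace_tuple (tspace_tuple (@tspace_lebesgue R) D) p. Qed.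

Lemma tspace_Z : tspace muZ addZ (@tuple_opp _ R' -%R D.-1).
Proof. exact: tspace_tuple (@tspace_lebesgue R) D.-1. Qed.

Lemma integral_mul_unit (c : nat -> R) (f : X -> \bar R) : N c = 1 ->
  measurable_fun setT f -> (forall x, 0 <= f x)%E ->
  (\int[muX]_x f (vec k (fun i => crd x i ** c)) = \int[muX]_x f x)%E.
Proof.
move=> c1 mf f0.
apply: (integral_isometry (M := fun x => vec k (fun i => crd x i ** c)) tspace_X nspace_X) => //.
- apply: measurable_vec => i l; apply: measurable_cd_mul => // j.
  exact: measurable_crd.
(* v + x c = (v conj c + x) c, because (v conj c) c = v when c has norm 1. *)
- move=> v; exists (vec k (fun i => crd v i ** cd_conj c)) => x.
  apply: eq_from_tnth => i; rewrite !tnth_mktuple; apply: eq_from_tnth => l.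
  rewrite !tnth_mktuple.
  have cK : cd_conj (cd_conj c) = c.
    by apply/funext => -[|j] //=; rewrite /cd_conj/= opprK.
  transitivity (((fun l => (crd v i ** cd_conj c) l + crd x i l) ** c) l); last first.
    apply: cd_mul_ext => // j jk; rewrite -[j]/(val (Ordinal jk)).
    by rewrite {3}/crd -tnth_nth !tnth_mktuple /crd -tnth_nth.
  have := cd_mulK (crd v i) (cd_conj c) k3 (ltn_ord l).
  by rewrite cK cd_norm_conj c1 mul1r cd_mulDl => ->; rewrite {2}/crd -tnth_nth.
- move=> x; rewrite /nsq !big_tuple; apply: eq_bigr => i _.
  by rewrite tnth_mktuple !big_tuple; apply: eq_bigr => l _; rewrite tnth_mktuple sqrrN.
- move=> x; rewrite -!fnorm_crd -[RHS]mulr1 -c1 -fnorm_mul//.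
  by apply: eq_bigr => i _; apply: cd_norm_ext => j jk; rewrite crd_vec.
Qed.

(** Expresses the inverse, with its value 0 at 0, through functions known to be measurable. *)
Lemma inv_expR (t : R) : 0 <= t -> t^-1 = if 0 < t then expR (- ln t) else 0.
Proof.
by rewrite le_eqVlt => /predU1P[<-|t0]; [rewrite ltxx invr0|rewrite t0 expRN lnK].
Qed.

(** The integral runs over all of F^(m-1) x Im F x R. The domain will enter through the support of
    [siegel_weight]. *)
Definition siegel_int (K : X -> U -> \bar R) : \bar R :=
  (\int[muX]_x \int[muU]_u K x u)%E.

(** The inversion (x, zeta) |-> (x zeta^-1, zeta^-1) with zeta = a + 2 z and zeta^-1 = conj zeta /
    |zeta|^2. It divides the height a - |x|^2 by |zeta|^2. *)
Definition invX (u : U) (x : X) : X :=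
  vec k (fun i l => (nrmU u)^-1 * (crd x i ** cd_conj (cd_zeta u.2 (nth 0 u.1))) l).
Definition invU (u : U) : U :=
  (vecZ k (fun j => - ((nrmU u)^-1 * nth 0 u.1 j)), (nrmU u)^-1 * u.2).

Lemma measurable_invXU : measurable_fun setT (fun q : U * X => (invX q.1 q.2, invU q.1)).
Proof.
have mN := ns_meas nspace_U.
have mnV : measurable_fun setT (fun q : U * X => (nrmU q.1)^-1).
  rewrite (_ : (fun q => _) = fun q => if 0 < nrmU q.1 then expR (- ln (nrmU q.1)) else 0).
    by mfun.
  by apply/funext => q; rewrite inv_expR// cd_norm_ge0.
apply: measurable_fun_pair.
- apply: measurable_vec => i l; apply: measurable_funM; first by mfun.
  apply: measurable_cd_mul => j; first by apply: measurable_crd; mfun.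
  apply: measurable_cd_conj => i'; apply: measurable_cd_zeta => [|i'']; first by mfun.
  by apply: measurable_nth0; mfun.
- apply: measurable_fun_pair; last by mfun.
  apply: measurable_vecZ => l.
  have h : measurable_fun setT (fun q : U * X => nth 0 q.1.1 l : R).
    by apply: measurable_nth0; mfun.
  by mfun.
Qed.

Section invariance.
Variable K : X -> U -> \bar R.
Hypotheses (mK : measurable_fun setT (fun q : X * U => K q.1 q.2))
  (K0 : forall x u, (0 <= K x u)%E).

Let mKu x : measurable_fun setT (K x).
Proof. by mcomp mK (fun u => (x, u)). Qed.
Let mKx u : measurable_fun setT (fun x => K x u).
Proof. by mcomp mK (fun x => (x, u)). Qed.

(** A shear: for fixed x the variable u is shifted by a vector depending on x, and afterwards x is
    shifted by y. *)
Lemma siegel_int_translate (y : 'I_p -> nat -> R) (w : nat -> R) :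
  siegel_int (fun x u => K (vec k (tau_x y (crd x)))
    (vecZ k (tau_z k y w (crd x) (nth 0 u.1)), tau_a k y (crd x) u.2)) = siegel_int K.
Proof.
have shiftU (c : Z) (a : R) (f : U -> \bar R) : measurable_fun setT f ->
    (forall u, 0 <= f u)%E -> (\int[muU]_u f (addZ c u.1, (a + u.2)%R) = \int[muU]_u f u)%E.
  move=> mf f0; have mc : measurable_fun setT (addZ c).
    by mcomp (ts_meas_add tspace_Z) (fun z => (c, z)).
  have mf' : measurable_fun setT (fun u => f (addZ c u.1, (a + u.2)%R)) by mfun.
  have -> := integral_sigma_finite_prod muZ L mf f0.
  have -> := integral_sigma_finite_prod muZ L mf' (fun u => f0 _).
  transitivity (\int[muZ]_z \int[L]_t f (addZ c z, t))%E.
    apply: eq_integral => z _; rewrite (ge0_integral_shift a (f := fun t => f (addZ c z, t)))//.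
    by mfun.
  apply: (ts_integral_add tspace_Z c (f := fun z => \int[L]_t f (z, t))%E).
  - by apply: measurable_iterated => //; mfun.
  - by move=> z; apply: integral_ge0.
transitivity (\int[muX]_x \int[muU]_u K (addX (vec k y) x) u)%E.
  apply: eq_integral => x _.
  rewrite -(shiftU (vecZ k (fun j => w j + fprod k y (crd x) j.+1))
    (fnorm k y + 2 * fprod k y (crd x) 0%N) (K (addX (vec k y) x)))//.
  apply: eq_integral => u _; congr K; [|congr pair].
  - apply: eq_from_tnth => i; rewrite !tnth_mktuple; apply: eq_from_tnth => l.
    by rewrite !tnth_mktuple /tau_x /crd -tnth_nth.
  - by apply: eq_from_tnth => l; rewrite !tnth_mktuple /tau_z -tnth_nth addrAC.
  - by rewrite /tau_a addrAC.
apply: (ts_integral_add tspace_X (vec k y) (f := fun x => \int[muU]_u K x u)%E).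
- exact: measurable_iterated.
- by move=> x; apply: integral_ge0.
Qed.

Lemma siegel_int_dilate (s : R) : 0 < s ->
  siegel_int (fun x u => K (scX s x) (scZ (s ^+ 2) u.1, s ^+ 2 * u.2)) =
  ((s ^- (p * D + 2 * D))%:E * siegel_int K)%E.
Proof.
move=> s0; have s20 : 0 < s ^+ 2 by rewrite exprn_gt0.
transitivity (\int[muX]_x ((s ^+ 2 ^- D)%:E * \int[muU]_u K (scX s x) u))%E.
  by apply: eq_integral => x _; rewrite -(ns_integral_scale nspace_U s20).
have mI : measurable_fun setT (fun x => \int[muU]_u K x u)%E by exact: measurable_iterated.
have msc : measurable_fun setT (scX s) by mcomp (ns_meas_sc nspace_X) (fun x => (s, x)).
have I0 x : (0 <= \int[muU]_u K x u)%E by apply: integral_ge0.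
have mIs : measurable_fun setT (fun x => \int[muU]_u K (scX s x) u)%E.
  exact: (measurableT_comp mI msc).
have c0 : 0 <= s ^+ 2 ^- D by rewrite invr_ge0 exprn_ge0// ltW.
have -> := ge0_integralZl_EFin muX measurableT (fun x _ => I0 (scX s x)) mIs c0.
have -> := ns_integral_scale nspace_X s0 mI I0.
rewrite muleA -EFinM.
by rewrite -invfM -!exprM -exprD addnC.
Qed.

Let oppZ : Z -> Z := @tuple_opp _ R' -%R D.-1.
Let cjU (u : U) : U := (oppZ u.1, u.2).

Let integral_cjU (g : U -> \bar R) : measurable_fun setT g -> (forall u, 0 <= g u)%E ->
  (\int[muU]_u g (cjU u) = \int[muU]_u g u)%E.
Proof.
move=> mg g0; have mo : measurable_fun setT oppZ by exact: ts_meas_opp tspace_Z.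
have mf' : measurable_fun setT (fun u => g (cjU u)) by rewrite /cjU; mfun.
have -> := integral_sigma_finite_prod muZ L mg g0.
have -> := integral_sigma_finite_prod muZ L mf' (fun u => g0 _).
apply: (integral_isometry (M := oppZ) (f := fun z => \int[L]_t g (z, t))%E tspace_Z nspace_Z) => //.
- move=> v; exists (oppZ v) => x.
  by rewrite /oppZ (ts_oppD tspace_Z) (ts_oppK tspace_Z).
- by move=> x; rewrite big_tuple [RHS]big_tuple; apply: eq_bigr => l _; rewrite tnth_mktuple sqrrN.
- by move=> x; rewrite big_tuple [RHS]big_tuple; apply: eq_bigr => l _; rewrite tnth_mktuple sqrrN.
- by apply: measurable_iterated => //; mfun.
- by move=> z; apply: integral_ge0.
Qed.

(** For fixed u the map on x is right multiplication by a unit followed by the dilation of ratio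
    |zeta|^-1, which contributes |zeta|^(pd). What remains is the inversion of u in R^d, where
    [kelvin] applies. Together they give the exponent d + pd / 2 of |zeta|^2. *)
Lemma siegel_int_invert :
  siegel_int (fun x u => K (invX u x) (invU u)) =
  siegel_int (fun x u => (expR (- ((D%:R + (p * D)%:R / 2) * ln (nrmU u))))%:E * K x u)%E.
Proof.
pose g (u : U) : \bar R := (\int[muX]_x K x u)%E.
pose f (u : U) : \bar R := ((expR (- ((p * D)%:R / 2 * ln (nrmU u))))%:E * g u)%E.
have mN := ns_meas nspace_U.
have g0 u : (0 <= g u)%E by apply: integral_ge0.
have mg : measurable_fun setT g.
  by apply: (measurable_iterated (fun u x => K x u)) => //; mfun.
have f0 u : (0 <= f u)%E by rewrite mule_ge0// lee_fin expR_ge0.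
have mf : measurable_fun setT f by rewrite /f; mfun.
have expRlnV (u : U) : 0 < nrmU u -> expR (- ln (nrmU u)) = (nrmU u)^-1.
  by move=> n0; rewrite expRN lnK.
have invUE u : 0 < nrmU u ->
    invU u = (scZ (expR (- ln (nrmU u))) (cjU u).1, expR (- ln (nrmU u)) * (cjU u).2).
  move=> n0; rewrite expRlnV//; congr pair.
  by apply: eq_from_tnth => l; rewrite tnth_mktuple [RHS]tnth_map tnth_mktuple mulrN -tnth_nth.
have nrm_cj u : nrmU (cjU u) = nrmU u.
  rewrite /nrmU !N_cd_zeta; congr (_ + 4 * _); rewrite big_tuple [RHS]big_tuple.
  by apply: eq_bigr => l _; rewrite tnth_mktuple sqrrN.
have nrm_inv u : 0 < nrmU u -> nrmU (invU u) = (nrmU u)^-1.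
  move=> n0; rewrite invUE// (ns_scale nspace_U) nrm_cj expRlnV//.
  by field; rewrite gt_eqF.
have inner u : 0 < nrmU u -> (\int[muX]_x K (invX u x) (invU u))%E = f (invU u).
  move=> n0; pose t := expR (- (ln (nrmU u) / 2)).
  have t0 : 0 < t by exact: expR_gt0.
  have t2 : t ^+ 2 = (nrmU u)^-1 by rewrite -expRlnV// -expRM_natl; congr expR; field.
  pose c l := t * cd_conj (cd_zeta u.2 (nth 0 u.1)) l.
  have c1 : N c = 1 by rewrite /c cd_normZ cd_norm_conj t2 mulVf// gt_eqF.
  have mt : measurable_fun setT (fun x => K (scX t x) (invU u)).
    have h : measurable_fun setT (scX t) by mcomp (ns_meas_sc nspace_X) (fun x => (t, x)).
    by mcomp (mKx (invU u)) (scX t).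
  transitivity (\int[muX]_x K (scX t (vec k (fun i => crd x i ** c))) (invU u))%E.
    apply: eq_integral => x _; congr K.
    apply: eq_from_tnth => i; rewrite tnth_mktuple tnth_map tnth_mktuple.
    apply: eq_from_tnth => l; rewrite tnth_mktuple tnth_map tnth_mktuple.
    by rewrite /c cd_mulZr mulrA -expr2 t2.
  rewrite (integral_mul_unit c1 mt (fun x => K0 _ _)).
  have -> := ns_integral_scale nspace_X t0 (mKx (invU u)) (fun x => K0 _ _).
  rewrite /f nrm_inv//; congr (_%:E * _)%E.
  by rewrite /t -expRM_natl -expRN lnV ?posrE//; congr expR; field.
have mI : measurable_fun setT (fun q : U * X => K (invX q.1 q.2) (invU q.1)).
  exact: (measurableT_comp mK measurable_invXU).
have mI' : measurable_fun setT (fun u => \int[muX]_x K (invX u x) (invU u))%E.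
  exact: (measurable_iterated (fun u x => K (invX u x) (invU u))).
have D0 : (0 < D)%N by rewrite expn_gt0.
have mcj : measurable_fun setT cjU.
  by have h : measurable_fun setT oppZ := ts_meas_opp tspace_Z; rewrite /cjU; mfun.
have msc := ns_meas_sc nspace_U.
have mk : measurable_fun setT (fun u => f (scZ (expR (- ln (nrmU u))) (cjU u).1,
    expR (- ln (nrmU u)) * (cjU u).2)).
  apply: (measurableT_comp mf).
  exact: (measurableT_comp msc (g := fun u => (expR (- ln (nrmU u)), cjU u)) ltac:(mfun)).
have kel := kelvin nspace_U D0 mcj nrm_cj _ integral_cjU mf f0.
transitivity (\int[muU]_u f (scZ (expR (- ln (nrmU u))) (cjU u).1,
    (expR (- ln (nrmU u)) * (cjU u).2)%R))%E.
  have <- : (\int[muU]_u \int[muX]_x K (invX u x) (invU u) =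
      siegel_int (fun x u => K (invX u x) (invU u)))%E.
    exact: (tonelli (fun u x => K (invX u x) (invU u))).
  (* The inversion degenerates at zeta = 0, a null set which is removed on both sides. *)
  rewrite -(nspace_integral_gt0 nspace_U D0 mI' (fun u => integral_ge0 _ _))//.
  rewrite -[RHS](nspace_integral_gt0 nspace_U D0 mk (fun u => f0 _)).
  by apply: eq_integral => u _; case: ifP => // n0; rewrite inner// invUE.
rewrite kel; last first.
  move=> s u; congr pair; apply: eq_from_tnth => l.
  by rewrite tnth_map !tnth_mktuple tnth_map mulrN.
pose E (u : U) : R := expR (- ((D%:R + (p * D)%:R / 2) * ln (nrmU u))).
have mE : measurable_fun setT E by rewrite /E; mfun.
have <- : (\int[muU]_u \int[muX]_x ((E u)%:E * K x u) =
    siegel_int (fun x u => (E u)%:E * K x u))%E.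
  apply: (tonelli (fun u x => (E u)%:E * K x u)%E); last first.
    by move=> u x; rewrite mule_ge0// lee_fin expR_ge0.
  by mfun.
apply: eq_integral => u _.
rewrite (ge0_integralZl_EFin muX measurableT (fun x _ => K0 x u) (mKx u) (expR_ge0 _)).
by rewrite /f muleA -EFinM -expRD; congr ((expR _)%:E * _)%E; ring.
Qed.

End invariance.
End siegel_measure.

(** * The invariant measure and the joint law of Q and R *)

Section siegel_law.
Context {R : realType} (k p : nat).
Hypotheses (k3 : (k <= 3)%N) (assoc : (k <= 2)%N \/ p = 0%N).
Local Notation R' := (measurableTypeR R).
Local Notation F := (cdalg R k).
Local Notation X := (p.-tuple F).
Local Notation Z := ((2 ^ k).-1.-tuple R').
Local Notation U := (Z * R')%type.
Local Notation P := (X * U)%type.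
Local Notation N := (@cd_norm R k).
Local Notation D := (2 ^ k)%N.
Local Notation "a ** b" := (cd_mul k a b) (at level 40).
Implicit Types (q : P) (y : 'I_p -> nat -> R) (w : nat -> R).

Lemma fprod_ext (y y' x x' : 'I_p -> nat -> R) j :
  (forall i l, (l < D)%N -> y i l = y' i l) -> (forall i l, (l < D)%N -> x i l = x' i l) ->
  fprod k y x j = fprod k y' x' j.
Proof.
move=> hy hx; apply: eq_bigr => i _; apply: cd_mul_ext => l lk; last exact: hx.
by rewrite /cd_conj !hy// expn_gt0.
Qed.

Lemma fnorm_ext (x x' : 'I_p -> nat -> R) :
  (forall i l, (l < D)%N -> x i l = x' i l) -> fnorm k x = fnorm k x'.
Proof. by move=> hx; apply: eq_bigr => i _; apply: cd_norm_ext => l lk; exact: hx. Qed.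

Definition tau y w q : P :=
  (vec k (tau_x y (crd q.1)),
   (vecZ k (tau_z k y w (crd q.1) (nth 0 q.2.1)), tau_a k y (crd q.1) q.2.2)).
Definition inv q : P := (invX q.2 q.1, invU q.2).
Definition dil (s : R) q : P := (scX s q.1, (scZ (s ^+ 2) q.2.1, s ^+ 2 * q.2.2)).
Definition height q : R := q.2.2 - nsq q.1.
Definition zeta q : nat -> R := cd_zeta q.2.2 (nth 0 q.2.1).
Definition zeta1 q : nat -> R := fun j => cd_one j + zeta q j.

Lemma crd_scX s (x : X) i l : (l < D)%N -> crd (scX s x) i l = s * crd x i l.
Proof.
move=> lk; rewrite -[l]/(val (Ordinal lk)) /crd -!tnth_nth.
by rewrite [tnth (scX s x) i]tnth_map tnth_map.
Qed.

Lemma zeta_dil s q j : (j < D)%N ->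
  zeta (dil s q) j = cd_zeta (s ^+ 2 * q.2.2) (fun j => s ^+ 2 * nth 0 q.2.1 j) j.
Proof.
case: j => [|j jk] //=; rewrite (nth_map 0)// size_tuple.
by rewrite -ltnS prednK// expn_gt0.
Qed.

Lemma zeta_tau y w q j : (j < D)%N ->
  zeta (tau y w q) j = cd_zeta (fnorm k y) w j + zeta q j + 2 * fprod k y (crd q.1) j.
Proof. by move=> jk; rewrite /zeta cd_zeta_vecZ// cd_zeta_tau. Qed.

Lemma height_tau y w q : height (tau y w q) = height q.
Proof.
rewrite /height -!fnorm_crd -[RHS](tau_height k3 y); congr (_ - _).
by apply: fnorm_ext => i l lk; rewrite crd_vec.
Qed.

Lemma height_dil s q : height (dil s q) = s ^+ 2 * height q.
Proof.
rewrite /height /= -!fnorm_crd mulrBr -fnormZ; congr (_ - _).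
by apply: fnorm_ext => i l lk; rewrite crd_scX.
Qed.

Lemma zeta_inv q j : (j < D)%N ->
  zeta (inv q) j = cd_zeta ((nrmU q.2)^-1 * q.2.2) (fun j => - ((nrmU q.2)^-1 * nth 0 q.2.1 j)) j.
Proof. by move=> jk; rewrite /zeta cd_zeta_vecZ. Qed.

Lemma N_zeta_inv q : 0 < nrmU q.2 -> N (zeta (inv q)) = (nrmU q.2)^-1.
Proof.
move=> n0.
transitivity (N (fun j => (nrmU q.2)^-1 * cd_conj (zeta q) j)).
  by apply: cd_norm_ext => j jk; rewrite zeta_inv//; case: j jk => [|j] jk //=;
    rewrite /cd_conj/=; ring.
rewrite cd_normZ cd_norm_conj /zeta -/(nrmU q.2); field; by rewrite gt_eqF.
Qed.

Lemma height_inv q : height (inv q) = (nrmU q.2)^-1 * height q.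
Proof.
have : 0 <= nrmU q.2 by exact: cd_norm_ge0.
rewrite /height /= -!fnorm_crd mulrBr => n0; congr (_ - _).
transitivity (fnorm k (fun i l => (nrmU q.2)^-1 * (crd q.1 i ** cd_conj (zeta q)) l)).
  by apply: fnorm_ext => i l lk; rewrite crd_vec.
rewrite fnormZ fnorm_mul// cd_norm_conj -/(nrmU q.2) expr2.
have [->|n1] := eqVneq (nrmU q.2) 0; first by rewrite invr0 !mul0r.
by field.
Qed.

Lemma nsq_ge0 (x : X) : 0 <= nsq x.
Proof. by rewrite -fnorm_crd; apply: sumr_ge0 => i _; exact: cd_norm_ge0. Qed.

Lemma nrmU_gt0 q : 0 < height q -> 0 < nrmU q.2.
Proof.
rewrite subr_gt0 => h; have a0 := le_lt_trans (nsq_ge0 q.1) h.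
rewrite /nrmU N_cd_zeta ltr_pwDl ?exprn_gt0// mulr_ge0//.
by apply: sumr_ge0 => t _; exact: sqr_ge0.
Qed.

Lemma N_one_zeta_gt0 (a : R) (z : nat -> R) : 0 <= a ->
  0 < N (fun j => cd_one j + cd_zeta a z j).
Proof.
move=> a0; rewrite /cd_norm (bigD1 (Ordinal (expn_gt0 2 k : (0 < D)%N)))//=.
rewrite ltr_pwDl//; last by apply: sumr_ge0 => i _; exact: sqr_ge0.
by rewrite exprn_gt0// /cd_one/= ltr_pwDl.
Qed.

Lemma N_zeta1_tau_inv y w q (eta := fun j => cd_one j + cd_zeta (fnorm k y) w j) :
  0 < nrmU q.2 ->
  N (zeta1 (tau y w (inv q))) =
  N (fun j => (eta ** zeta q) j + (cd_one j + 2 * fprod k y (crd q.1) j)) * (nrmU q.2)^-1.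
Proof.
move=> n0; rewrite -(N_cd_one_zeta k3 assoc _ _ _ n0); apply: cd_norm_ext => j jk.
rewrite /zeta1 zeta_tau// zeta_inv// cd_zeta_tau; congr (_ + (_ + 2 * _)).
by apply: fprod_ext => // i l lk; rewrite crd_vec.
Qed.

Section base_point.
Variables (y : 'I_p -> nat -> R) (w : nat -> R).
Let eta j := cd_one j + cd_zeta (fnorm k y) w j.
Let e := N eta.
Let s := Num.sqrt e^-1.
Let yq : 'I_p -> nat -> R := fun i l => - e^-1 * (y i ** eta) l.
Let wq j := e^-1 * w j.

Let fnorm_ge0 (x : 'I_p -> nat -> R) : 0 <= fnorm k x.
Proof. by apply: sumr_ge0 => i _; exact: cd_norm_ge0. Qed.

Let e0 : 0 < e. Proof. exact: N_one_zeta_gt0. Qed.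
Let s2 : s ^+ 2 = e^-1. Proof. by rewrite sqr_sqrtr// invr_ge0 ltW. Qed.

Let motion q := tau y w (inv (tau yq wq (dil s q))).

Lemma N_zeta1_motion q (n := nrmU (tau yq wq (dil s q)).2) : 0 < n ->
  N (zeta1 (motion q)) = e^-1 * N (zeta1 q) * n^-1.
Proof.
move=> n0; rewrite N_zeta1_tau_inv//; congr (_ * _).
rewrite -(N_normalize k3 assoc (crd q.1) (nth 0 q.2.1) q.2.2 e0 s2).
apply: cd_norm_ext => j jk; congr (_ + (_ + 2 * _)).
  apply: cd_mul_ext => // l lk; rewrite zeta_tau// zeta_dil// cd_zeta_tau.
  by congr (_ + 2 * _); apply: fprod_ext => // i l' lk'; rewrite crd_scX.
by apply: fprod_ext => // i l lk; rewrite crd_vec// /tau_x crd_scX.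
Qed.

Lemma N_zeta1_gt0 q : 0 < height q -> 0 < N (zeta1 q).
Proof.
rewrite subr_gt0 => h; apply: N_one_zeta_gt0.
exact: ltW (le_lt_trans (nsq_ge0 _) h).
Qed.

Let s0 : 0 < s. Proof. by rewrite sqrtr_gt0 invr_gt0. Qed.

(** The last translation is by (y, w), so Q becomes |zeta|^2 at the inverted point, that is n^-1.
    The height is n^-1 e^-1 times the original one, and the quotient no longer contains n. *)
Lemma motion_Qpoly q : 0 < height q ->
  let q' := motion q in
  ln (Qpoly k y w (crd q'.1) (nth 0 q'.2.1) q'.2.2) - ln (height q') = ln e - ln (height q).
Proof.
move=> h0 q'.
have hn : height (tau yq wq (dil s q)) = e^-1 * height q.
  by rewrite height_tau height_dil s2.
have n0 : 0 < nrmU (tau yq wq (dil s q)).2.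
  by apply: nrmU_gt0; rewrite hn mulr_gt0// invr_gt0.
have -> : height q' = (nrmU (tau yq wq (dil s q)).2)^-1 * (e^-1 * height q).
  by rewrite height_tau height_inv hn.
have -> : Qpoly k y w (crd q'.1) (nth 0 q'.2.1) q'.2.2 = (nrmU (tau yq wq (dil s q)).2)^-1.
  rewrite -N_zeta_inv// /zeta -(Qpoly_tau k3 y w (crd (inv (tau yq wq (dil s q))).1)).
  apply: cd_norm_ext => j jk; rewrite cd_zeta_vecZ//; congr (_ + _ - 2 * _).
  by apply: fprod_ext => // i l lk; rewrite crd_vec.
by rewrite !lnM ?lnV ?posrE ?mulr_gt0 ?invr_gt0//; ring.
Qed.

Lemma motion_zeta1 q : 0 < height q ->
  ln (N (zeta1 (motion q))) - ln (height (motion q)) = ln (N (zeta1 q)) - ln (height q).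
Proof.
move=> h0.
have hn : height (tau yq wq (dil s q)) = e^-1 * height q.
  by rewrite height_tau height_dil s2.
have n0 : 0 < nrmU (tau yq wq (dil s q)).2.
  by apply: nrmU_gt0; rewrite hn mulr_gt0// invr_gt0.
rewrite N_zeta1_motion// height_tau height_inv hn.
by rewrite !lnM ?lnV ?posrE ?mulr_gt0 ?invr_gt0 ?N_zeta1_gt0//; ring.
Qed.

End base_point.

(** Lebesgue measure scales with degree pd + 2d under [dil] and the height with degree 2, so
    invariance forces the exponent to be half of the former. It equals rho_H + 1. *)
Local Notation kappa := (D%:R + (p * D)%:R / 2 : R).

(* The density of a measure on the domain invariant under tau, inv and dil. *)
Definition siegel_weight (t : R) : R := if 0 < t then expR (- (kappa * ln t)) else 0.

Definition siegel_mass (f : P -> \bar R) : \bar R :=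
  siegel_int (fun x u => (siegel_weight (height (x, u)))%:E * f (x, u))%E.

Lemma siegel_weight_ge0 t : 0 <= siegel_weight t.
Proof. by rewrite /siegel_weight; case: ifP => // _; exact: expR_ge0. Qed.

Lemma measurable_height : measurable_fun setT height.
Proof. by rewrite /height; have h := ns_meas (@nspace_X R k p); mfun. Qed.

Lemma measurable_siegel_weight : measurable_fun setT siegel_weight.
Proof. by rewrite /siegel_weight; mfun. Qed.

Lemma measurable_zeta j : measurable_fun setT (fun q => zeta q j).
Proof.
by apply: (measurable_cd_zeta (a := fun q : P => q.2.2) (z := fun q : P => nth 0 q.2.1));
  [mfun|move=> l; apply: measurable_nth0; mfun].
Qed.

Lemma measurable_N_zeta1 : measurable_fun setT (fun q => N (zeta1 q)).
Proof.
apply: measurable_cd_norm => j; have h := measurable_zeta j; rewrite /zeta1; mfun.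
Qed.

Lemma measurable_Qpoly y w :
  measurable_fun setT (fun q : P => Qpoly k y w (crd q.1) (nth 0 q.2.1) q.2.2).
Proof.
apply: measurable_cd_norm => j; have h := measurable_zeta j.
have h' : measurable_fun setT (fun q : P => fprod k y (crd q.1) j).
  by apply: measurable_fprod => i l; [mfun|apply: measurable_crd; mfun].
by mfun.
Qed.

Lemma measurable_tau y w : measurable_fun setT (tau y w).
Proof.
have h j : measurable_fun setT (fun q : P => fprod k y (crd q.1) j).
  by apply: measurable_fprod => i l; [mfun|apply: measurable_crd; mfun].
apply: measurable_fun_pair; [|apply: measurable_fun_pair].
- apply: measurable_vec => i l; rewrite /tau_x.
  have h' : measurable_fun setT (fun q : P => crd q.1 i l) by apply: measurable_crd; mfun.
  by mfun.
- apply: measurable_vecZ => l; rewrite /tau_z; have h0 := h l.+1.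
  have h' : measurable_fun setT (fun q : P => nth 0 q.2.1 l : R).
    by apply: measurable_nth0; mfun.
  by mfun.
- by rewrite /tau_a; have h0 := h 0%N; mfun.
Qed.

Lemma measurable_inv : measurable_fun setT inv.
Proof.
by mcomp (@measurable_invXU R k p) (fun q : P => (q.2, q.1)).
Qed.

Section mass_invariance.
Variable f : P -> \bar R.
Hypotheses (mf : measurable_fun setT f) (f0 : forall q, (0 <= f q)%E).

Let mh := measurable_height.
Let mw := measurable_siegel_weight.
Let K (x : X) (u : U) : \bar R := ((siegel_weight (height (x, u)))%:E * f (x, u))%E.

Let mK : measurable_fun setT (fun q : X * U => K q.1 q.2).
Proof. by rewrite /K; mfun. Qed.
Let K0 x u : (0 <= K x u)%E.
Proof. by rewrite mule_ge0// lee_fin siegel_weight_ge0. Qed.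

Lemma siegel_mass_tau y w : siegel_mass (f \o tau y w) = siegel_mass f.
Proof.
rewrite /siegel_mass -(siegel_int_translate mK K0 y w).
apply: eq_integral => x _; apply: eq_integral => u _.
by rewrite -[X in siegel_weight X](height_tau y w (x, u)).
Qed.

(** As the height is divided by |zeta|^2, the weight is multiplied by |zeta|^(2 kappa). This
    compensates exactly the density in [siegel_int_invert]. *)
Lemma siegel_mass_inv : siegel_mass (f \o inv) = siegel_mass f.
Proof.
pose E (c : R) (u : U) : R := expR (c * ln (nrmU u)).
have mN := ns_meas (@nspace_U R k).
have mE : measurable_fun setT (fun q : P => ((E kappa q.2)%:E * K q.1 q.2)%E).
  by rewrite /E; mfun.
have E0 x u : (0 <= (E kappa u)%:E * K x u)%E by rewrite mule_ge0// lee_fin expR_ge0.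
transitivity (siegel_int
    (fun x u => (E kappa (invU u))%:E * K (invX u x) (invU u)))%E; last first.
  have -> := siegel_int_invert k3 (K := fun x u => (E kappa u)%:E * K x u)%E mE E0.
  apply: eq_integral => x _; apply: eq_integral => u _.
  by rewrite muleA -EFinM -expRD addNr expR0 mul1e.
apply: eq_integral => x _; apply: eq_integral => u _.
rewrite /K muleA -EFinM; congr (_%:E * _)%E.
have -> : height (invX u x, invU u) = (nrmU u)^-1 * height (x, u).
  exact: (height_inv (x, u)).
have nh := @nrmU_gt0 (x, u).
rewrite /siegel_weight; case: (ltP 0 (height (x, u))) => [/[dup] h /nh/= n0|h].
  rewrite mulr_gt0 ?invr_gt0// -expRD; congr expR.
  have -> : nrmU (invU u) = (nrmU u)^-1 by exact: (N_zeta_inv (q := (x, u))).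
  by rewrite lnM ?lnV ?posrE ?invr_gt0//; ring.
by rewrite ltNge mulr_ge0_le0 ?mulr0// invr_ge0 cd_norm_ge0.
Qed.

Lemma siegel_mass_dil s : 0 < s -> siegel_mass (f \o dil s) = siegel_mass f.
Proof.
move=> s0; pose c : R := s ^+ (p * D + 2 * D).
have c0 : 0 < c by rewrite exprn_gt0.
have mcK : measurable_fun setT (fun q : P => (c%:E * K q.1 q.2)%E) by mfun.
have cK0 x u : (0 <= c%:E * K x u)%E by rewrite mule_ge0// lee_fin ltW.
transitivity (siegel_int (fun x u => c%:E *
    K (scX s x) (scZ (s ^+ 2) u.1, (s ^+ 2 * u.2)%R)))%E.
  apply: eq_integral => x _; apply: eq_integral => u _.
  rewrite /K muleA -EFinM; congr (_%:E * _)%E.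
  have -> : height (scX s x, (scZ (s ^+ 2) u.1, s ^+ 2 * u.2)) = s ^+ 2 * height (x, u).
    exact: (height_dil s (x, u)).
  rewrite /siegel_weight pmulr_rgt0 ?exprn_gt0//; case: ifP => h; last by rewrite mulr0.
  rewrite -[c]lnK ?posrE// -expRD; congr expR.
  have -> : ln c = ln s * (p%:R * D%:R + 2 * D%:R).
    by rewrite /c lnXn// -(mulr_natr (ln s)) natrD !natrM.
  by rewrite (lnM (exprn_gt0 2 s0) h) lnXn// -(mulr_natr (ln s)) natrM; field.
have -> := siegel_int_dilate (K := fun x u => c%:E * K x u)%E mcK cK0 s s0.
have mKx x : measurable_fun setT (K x) by mcomp mK (fun u => (x, u)).
transitivity ((c^-1)%:E * (c%:E * siegel_mass f))%E; last first.
  by rewrite muleA -EFinM mulVf ?mul1e// gt_eqF.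
congr (_ * _)%E; rewrite /siegel_mass /siegel_int.
have <- := ge0_integralZl_EFin (muX k p) measurableT
  (fun x _ => integral_ge0 (f := K x) _ (fun u _ => K0 x u)) (measurable_iterated K mK K0) (ltW c0).
apply: eq_integral => x _.
exact: (ge0_integralZl_EFin (muU k) measurableT (fun u _ => K0 x u) (mKx x) (ltW c0)).
Qed.

End mass_invariance.

(* The composite of tau (y, w), inv, tau (yq, wq) and dil s moves Q / height to e / height
   and fixes N (1 + zeta) / height. *)
Lemma siegel_law y w (G : R' * R' -> \bar R)
    (e := N (fun j => cd_one j + cd_zeta (fnorm k y) w j)) :
  measurable_fun setT G -> (forall z, 0 <= G z)%E ->
  siegel_mass (fun q => G (ln (Qpoly k y w (crd q.1) (nth 0 q.2.1) q.2.2) - ln (height q),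
                           ln (N (zeta1 q)) - ln (height q))) =
  siegel_mass (fun q => G (ln e - ln (height q), ln (N (zeta1 q)) - ln (height q))).
Proof.
move=> mG G0; set f := fun q => G _; rewrite -/(siegel_mass f).
pose s : R := Num.sqrt e^-1.
pose yq : 'I_p -> nat -> R :=
  fun i l => - e^-1 * (y i ** (fun j => cd_one j + cd_zeta (fnorm k y) w j)) l.
pose wq j := e^-1 * w j.
have s0 : 0 < s.
  by rewrite sqrtr_gt0 invr_gt0; apply: N_one_zeta_gt0; apply: sumr_ge0 => i _;
    exact: cd_norm_ge0.
have mh := measurable_height; have mQ := measurable_Qpoly y w; have m1 := measurable_N_zeta1.
have mi := measurable_inv; have mt := measurable_tau y w; have mtq := measurable_tau yq wq.
have mf : measurable_fun setT f by rewrite /f; mfun.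
have f0 q : (0 <= f q)%E by exact: G0.
rewrite -(siegel_mass_tau mf f0 y w).
have mf1 : measurable_fun setT (f \o tau y w) by exact: measurableT_comp mf mt.
rewrite -(siegel_mass_inv mf1 (fun q => f0 _)).
have mf2 : measurable_fun setT ((f \o tau y w) \o inv) by exact: measurableT_comp mf1 mi.
rewrite -(siegel_mass_tau mf2 (fun q => f0 _) yq wq).
have mf3 : measurable_fun setT (((f \o tau y w) \o inv) \o tau yq wq).
  exact: measurableT_comp mf2 mtq.
rewrite -(siegel_mass_dil mf3 (fun q => f0 _) s0).
apply: eq_integral => x _; apply: eq_integral => u _.
rewrite /siegel_weight; case: ifP => [h|_]; last by rewrite !mul0e.
congr (_ * _)%E; rewrite /f /=.
by rewrite (motion_Qpoly y w h) (motion_zeta1 y w h).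
Qed.

End siegel_law.

(** * The intertwining form *)

Section tuple_cat.
Context d (T : measurableType d) {R : realType}.
Variable mu : {sigma_finite_measure set T -> \bar R}.

Lemma measurable_cat_tuple p l :
  measurable_fun setT (fun x : p.-tuple T * l.-tuple T => cat_tuple x.1 x.2).
Proof.
apply/measurable_fun_tnthP => i; rewrite -(@splitK p l i); case: (fintype.split i) => j /=.
  rewrite (_ : _ \o _ = fun x => tnth x.1 j); first by mfun.
  by apply/funext => x /=; rewrite tnth_lshift.
rewrite (_ : _ \o _ = fun x => tnth x.2 j); first by mfun.
by apply/funext => x /=; rewrite tnth_rshift.
Qed.

Lemma integral_cat_tuple p l (f : (p + l).-tuple T -> \bar R) :
  measurable_fun setT f -> (forall x, 0 <= f x)%E ->
  (\int[tuple_measure mu (p + l)]_x f x =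
   \int[tuple_measure mu p]_x \int[tuple_measure mu l]_y f (cat_tuple x y))%E.
Proof.
elim: p f => [|p IH] f mf f0.
  rewrite integral_tuple0; first by apply: eq_integral => y _; congr f; exact: val_inj.
  apply: (measurable_iterated (fun (x : 0.-tuple T) (y : l.-tuple T) => f (cat_tuple x y))) => //.
  exact: measurableT_comp mf (@measurable_cat_tuple 0 l).
have mfc : measurable_fun setT (fun q : T * (p + l).-tuple T => f [tuple of q.1 :: q.2]).
  by apply: measurableT_comp mf _; exact: measurable_tuple_cons.
have mI : measurable_fun setT (fun x : p.+1.-tuple T =>
    \int[tuple_measure mu l]_y f (cat_tuple x y))%E.
  apply: (measurable_iterated (fun (x : p.+1.-tuple T) (y : l.-tuple T) => f (cat_tuple x y))) => //.
  exact: measurableT_comp mf (@measurable_cat_tuple p.+1 l).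
have -> := integral_tupleS mu mI (fun x => integral_ge0 _ (fun y _ => f0 _)).
have -> := integral_tupleS mu mf f0.
apply: eq_integral => a _.
have mfa : measurable_fun setT (fun x : (p + l).-tuple T => f [tuple of a :: x]).
  by mcomp mfc (fun x : (p + l).-tuple T => (a, x)).
rewrite (IH _ mfa (fun x => f0 _)); apply: eq_integral => x _.
by apply: eq_integral => y _; congr f; exact: val_inj.
Qed.

End tuple_cat.

(** * From the large group to the domain *)

Section heisenberg_siegel.
Context {R : realType} (k p l : nat).
Local Notation R' := (measurableTypeR R).
Local Notation F := (cdalg R k).
Local Notation X := (p.-tuple F).
Local Notation Y := (l.-tuple F).
Local Notation Z := ((2 ^ k).-1.-tuple R').
Local Notation U := (Z * R')%type.
Local Notation P := (X * U)%type.
Local Notation N := (@cd_norm R k).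
Local Notation D := (2 ^ k)%N.
Local Notation L := (@lebesgue_measure R).
Local Notation rho := (rho k (p + l).+1 : R).
Local Notation G := (heis R k (p + l).+1).

Definition lpart (g : G) : X := [tuple tnth g.1 (lshift l i) | i < p].
Definition rpart (g : G) : Y := [tuple tnth g.1 (rshift p i) | i < l].

Lemma lpart_cat (x : X) (y : Y) z : lpart (cat_tuple x y, z) = x.
Proof. by apply: eq_from_tnth => i; rewrite tnth_mktuple tnth_lshift. Qed.

Lemma rpart_cat (x : X) (y : Y) z : rpart (cat_tuple x y, z) = y.
Proof. by apply: eq_from_tnth => i; rewrite tnth_mktuple tnth_rshift. Qed.

Lemma measurable_lpart : measurable_fun setT lpart.
Proof. by apply: (measurable_mktuple (f := fun g i => _)) => i; mfun. Qed.

Lemma measurable_rpart : measurable_fun setT rpart.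
Proof. by apply: (measurable_mktuple (f := fun g i => _)) => i; mfun. Qed.

Lemma integral_heis (f : X -> Y -> Z -> \bar R) :
  measurable_fun setT (fun q : (X * Y) * Z => f q.1.1 q.1.2 q.2) ->
  (forall x y z, 0 <= f x y z)%E ->
  (\int[heis_measure k (p + l).+1]_g f (lpart g) (rpart g) g.2 =
   \int[muX k p]_x \int[muZ k]_z \int[muX k l]_y f x y z)%E.
Proof.
move=> mf f0; have ml := measurable_lpart; have mr := measurable_rpart.
have mfg : measurable_fun setT (fun g : G => f (lpart g) (rpart g) g.2).
  by mcomp mf (fun g : G => ((lpart g, rpart g), g.2)).
have -> := integral_sigma_finite_prod (tuple_measure (tuple_measure L D) (p + l))
  (muZ k) mfg (fun g => f0 _ _ _).
pose h (x : (p + l).-tuple F) : \bar R := (\int[muZ k]_z f (lpart (x, z)) (rpart (x, z)) z)%E.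
have mh : measurable_fun setT h.
  by apply: (measurable_iterated (fun (x : (p + l).-tuple F) (z : Z) =>
    f (lpart (x, z)) (rpart (x, z)) z)) => // ; mcomp mfg (fun q => q).
have -> := integral_cat_tuple (tuple_measure L D) mh (fun x => integral_ge0 _ (fun z _ => f0 _ _ _)).
apply: eq_integral => x _.
transitivity (\int[muX k l]_y \int[muZ k]_z f x y z)%E.
  apply: eq_integral => y _; apply: eq_integral => z _.
  by rewrite lpart_cat rpart_cat.
apply: (tonelli (fun y z => f x y z)) => //.
by mcomp mf (fun q : Y * Z => ((x, q.1), q.2)).
Qed.

(* Radial integration in the last l coordinates, with a = |x|^2 as the new variable. *)
Lemma heis_siegel : (0 < l)%N -> exists2 C : R, 0 < C & forall f : P -> \bar R,
  measurable_fun setT f -> (forall q, 0 <= f q)%E ->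
  (\int[heis_measure k (p + l).+1]_g
     ((expR (- (rho * ln (nsq (rpart g)))))%:E *
      f (lpart g, (g.2, (nsq (rpart g) + nsq (lpart g))%R))) =
   C%:E * siegel_mass f)%E.
Proof.
move=> l0; have q0 : (0 < l * D)%N by rewrite muln_gt0 l0 expn_gt0.
have [C1 C10 rad] := radial (@nspace_X R k l) q0.
have [C2 C20 half] := half_line (R := R).
have C0 : 0 < C1 / C2 by rewrite divr_gt0.
exists (C1 / C2) => // f mf f0.
have mX := ns_meas (@nspace_X R k p); have mY := ns_meas (@nspace_X R k l).
have mw := measurable_siegel_weight (R := R) k p.
have mF : measurable_fun setT (fun q : (X * Y) * Z => ((expR (- (rho * ln (nsq q.1.2))))%:E *
    f (q.1.1, (q.2, (nsq q.1.2 + nsq q.1.1)%R)))%E) by mfun.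
have F0 x (y : Y) z :
    (0 <= (expR (- (rho * ln (nsq y))))%:E * f (x, (z, (nsq y + nsq x)%R)))%E.
  by rewrite mule_ge0// lee_fin expR_ge0.
have -> := integral_heis (f := fun x y z =>
  (expR (- (rho * ln (nsq y))))%:E * f (x, (z, (nsq y + nsq x)%R)))%E mF F0.
pose W (x : X) (z : Z) (a : R') : \bar R :=
  ((siegel_weight k p (height (x, (z, a))))%:E * f (x, (z, a)))%E.
have mh := @measurable_height R k p.
have mW x : measurable_fun setT (fun u : U => W x u.1 u.2) by rewrite /W; mfun.
have mW' : measurable_fun setT (fun q : (X * Z) * R' => W q.1.1 q.1.2 q.2) by rewrite /W; mfun.
have W0 x z a : (0 <= W x z a)%E by rewrite mule_ge0// lee_fin siegel_weight_ge0.
have inner x z : (\int[muX k l]_y ((expR (- (rho * ln (nsq y))))%:E *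
    f (x, (z, (nsq y + nsq x)%R))) = (C1 / C2)%:E * \int[L]_a W x z a)%E.
  pose g (t : R') : \bar R := ((expR (- (rho * ln t)))%:E * f (x, (z, (t + nsq x)%R)))%E.
  have mg : measurable_fun setT g by rewrite /g; mfun.
  have g0 t : (0 <= g t)%E by rewrite mule_ge0// lee_fin expR_ge0.
  have -> := rad g mg g0.
  (* The power t^(ld/2 - 1) is the density of t = |x_2|^2 with respect to dt, up to a constant. *)
  pose g1 (t : R') : \bar R := ((expR (((l * D)%:R / 2 - 1) * ln t))%:E * g t)%E.
  have mg1 : measurable_fun setT g1 by rewrite /g1; mfun.
  have g10 t : (0 <= g1 t)%E by rewrite mule_ge0// lee_fin expR_ge0.
  have h := half g1 mg1 g10.
  have mWz : measurable_fun setT (W x z) by rewrite /W; mfun.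
  have -> : (\int[L]_a W x z a = C2%:E * \int[L]_v ((expR v)%:E * g1 (expR v)))%E.
    rewrite -h -(ge0_integral_shift (nsq x) mWz (fun a => W0 x z a)); under eq_integral do rewrite addrC.
    apply: eq_integral => t _; rewrite /W /g1 /g.
    have -> : height (x, (z, (t + nsq x)%R)) = t by rewrite /height /= addrK.
    rewrite /siegel_weight; case: ifP => t0; last by rewrite mul0e.
    rewrite muleA -EFinM -expRD; congr ((expR _)%:E * _)%E.
    (* ld / 2 - 1 - rho = - (rho_H + 1) = - kappa: the weight r^(-2 rho) is the one that produces
       the invariant measure. *)
    by rewrite /Defs.rho -(natr1 (p + l)) !natrM natrD natrX; field.
  rewrite muleA -EFinM divfK ?gt_eqF//; congr (_ * _)%E.
  apply: eq_integral => v _; rewrite /g1 /g !muleA -!EFinM -!expRD expRK.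
  by congr ((expR _)%:E * _)%E; field.
transitivity (\int[muX k p]_x ((C1 / C2)%:E * \int[muU k]_u W x u.1 u.2))%E.
  apply: eq_integral => x _.
  have -> := integral_sigma_finite_prod (muZ k) L (mW x) (fun u => W0 x _ _).
  have mI : measurable_fun setT (fun z => \int[L]_a W x z a)%E.
    exact: (measurable_iterated (fun (z : Z) (a : R') => W x z a)).
  have <- := ge0_integralZl_EFin (muZ k) measurableT
    (fun z _ => integral_ge0 (f := W x z) _ (fun a _ => W0 x z a)) mI (ltW C0).
  by apply: eq_integral => z _; exact: inner.
have mI : measurable_fun setT (fun x => \int[muU k]_u W x u.1 u.2)%E.
  by apply: (measurable_iterated (fun (x : X) (u : U) => W x u.1 u.2)) => //; rewrite /W; mfun.
have -> := ge0_integralZl_EFin (muX k p) measurableT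
    (fun x _ => integral_ge0 (f := fun u : U => W x u.1 u.2) _ (fun u _ => W0 x _ _)) mI (ltW C0).
have -> // : siegel_mass f = (\int[muX k p]_x \int[muU k]_u W x u.1 u.2)%E.
by apply: eq_integral => x _; apply: eq_integral => -[z a] _.
Qed.

Lemma vnorm_sqr q (x : q.-tuple F) : vnorm x ^+ 2 = nsq x.
Proof. by rewrite /vnorm sqr_sqrtr//; exact: nsq_ge0. Qed.

Lemma vnorm4D q (x : q.-tuple F) (z : Z) :
  vnorm x ^+ 4 + 4 * inorm z ^+ 2 = N (cd_zeta (nsq x) (nth 0 z)).
Proof.
rewrite N_cd_zeta (_ : 4 = 2 * 2)%N// exprM vnorm_sqr /inorm sqr_sqrtr//.
by apply: sumr_ge0 => t _; exact: sqr_ge0.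
Qed.

Lemma fprod_anti (k3 : (k <= 3)%N) (x y : 'I_p -> nat -> R) j : (j.+1 < D)%N ->
  fprod k x y j.+1 = - fprod k y x j.+1.
Proof.
move=> jk; rewrite /fprod -sumrN; apply: eq_bigr => i _.
have := cd_conjM (cd_conj (y i)) (x i) k3 jk; rewrite {1}/cd_conj /= => ->.
by apply: cd_mul_ext => // -[|m] _; rewrite /cd_conj //= opprK.
Qed.

(** By [fprod_anti] the half commutator in the group law is the imaginary part of a single product.
    The embedded point has no x_2-coordinates, so x_2 enters only through |x_2|^2 in the real part.
    The two elements of F are conjugate, hence have the same norm. *)
Lemma heis_norm_Qpoly (g : G) (h : heis R k p.+1) : (k <= 3)%N ->
  heis_norm (heis_mul (heis_opp g) (heis_embed (p + l).+1 h)) =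
  Qpoly k (crd h.1) (nth 0 h.2) (crd (lpart g)) (nth 0 g.2)
    (nsq (rpart g) + nsq (lpart g)) `^ 4^-1.
Proof.
move=> k3; rewrite /heis_norm; congr (_ `^ _); set e := heis_embed _ h.
set v := heis_mul _ _.
have el i : tnth e.1 (lshift l i) = tnth h.1 i.
  by rewrite tnth_mktuple /= (tnth_nth [tuple of nseq D 0]).
have er i j : nth 0 (tnth e.1 (rshift p i)) j = 0 :> R.
  rewrite tnth_mktuple /= (nth_default [tuple of nseq D 0]) ?size_tuple ?leq_addr//.
  by rewrite nth_nseq if_same.
have ol i j : (j < D)%N ->
    nth 0 (tnth (heis_opp g).1 (lshift l i)) j = - crd (lpart g) i j.
  by move=> jk; rewrite -[j]/(val (Ordinal jk)) /crd -!tnth_nth !tnth_mktuple.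
have or i j : (j < D)%N ->
    nth 0 (tnth (heis_opp g).1 (rshift p i)) j = - crd (rpart g) i j.
  by move=> jk; rewrite -[j]/(val (Ordinal jk)) /crd -!tnth_nth !tnth_mktuple.
have vl i j : (j < D)%N -> crd v.1 (lshift l i) j = crd h.1 i j + -1 * crd (lpart g) i j.
  move=> jk; rewrite mulN1r -ol// [RHS]addrC /crd -el.
  by rewrite -[j]/(val (Ordinal jk)) /crd -!tnth_nth [tnth v.1 _]tnth_mktuple tnth_mktuple.
have vr i j : (j < D)%N -> crd v.1 (rshift p i) j = -1 * crd (rpart g) i j.
  move=> jk; rewrite mulN1r -or// -[RHS]addr0 -(er i j).
  by rewrite -[j]/(val (Ordinal jk)) /crd -!tnth_nth [tnth v.1 _]tnth_mktuple tnth_mktuple.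
rewrite vnorm4D /Qpoly -[RHS]cd_norm_conj; apply: cd_norm_ext => -[|j] jk.
  rewrite /cd_conj /= -!fnorm_crd {1}/fnorm big_split_ord/=.
  have -> : \sum_(i < p) N (crd v.1 (lshift l i)) =
      fnorm k (fun i j => crd h.1 i j + -1 * crd (lpart g) i j).
    by apply: eq_bigr => i _; apply: cd_norm_ext => j jk'; rewrite vl.
  have -> : \sum_(i < l) N (crd v.1 (rshift p i)) = fnorm k (fun i j => -1 * crd (rpart g) i j).
    by apply: eq_bigr => i _; apply: cd_norm_ext => j jk'; rewrite vr.
  by rewrite fnormD// !fnormZ fprodZr; ring.
have jD : (j < D.-1)%N by rewrite -ltnS prednK// expn_gt0.
have v2 : nth 0 v.2 j = - nth 0 g.2 j + nth 0 h.2 j +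
    (hprod (heis_opp g).1 e.1 j.+1 - hprod e.1 (heis_opp g).1 j.+1) / 2.
  rewrite -[nth 0 v.2 j]/(nth 0 v.2 (val (Ordinal jD))) -tnth_nth tnth_mktuple.
  by rewrite [tnth (heis_opp g).2 _]tnth_mktuple !(tnth_nth 0).
rewrite /cd_conj /= v2.
have -> : hprod (heis_opp g).1 e.1 j.+1 = fprod k (crd h.1) (crd (lpart g)) j.+1.
  rewrite -[RHS]opprK -fprod_anti// -mulN1r /hprod big_split_ord/= addrC big1 ?add0r => [|i _]; last first.
    rewrite -[RHS](mul0r (cd_mul k (cd_conj (nth 0 (tnth (heis_opp g).1 (rshift p i)))) (fun=> 0) j.+1)).
    by rewrite -cd_mulZr; apply: cd_mul_ext => // m _; rewrite er mul0r.
  rewrite -fprodZl; apply: eq_bigr => i _; apply: cd_mul_ext => m mk; last by rewrite el.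
  by rewrite /cd_conj; case: ifP => _; rewrite ol ?expn_gt0// mulN1r.
have -> : hprod e.1 (heis_opp g).1 j.+1 = - fprod k (crd h.1) (crd (lpart g)) j.+1.
  rewrite -mulN1r /hprod big_split_ord/= addrC big1 ?add0r => [|i _]; last first.
    rewrite -[RHS](mul0r (cd_mul k (fun=> 0) (nth 0 (tnth (heis_opp g).1 (rshift p i))) j.+1)).
    rewrite -cd_mulZl; apply: cd_mul_ext => // m _; rewrite mul0r.
    by rewrite /cd_conj er; case: ifP => // _; rewrite er oppr0.
  rewrite -fprodZr; apply: eq_bigr => i _; apply: cd_mul_ext => m mk; first by rewrite el.
  by rewrite ol// mulN1r.
by field.
Qed.

End heisenberg_siegel.

(** * Integrals over the two groups *)

Section spherical_scaling.
Context {R : realType} (k p : nat).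
Local Notation R' := (measurableTypeR R).
Local Notation X := (p.-tuple (cdalg R k)).
Local Notation Z := ((2 ^ k).-1.-tuple R').
Local Notation N := (@cd_norm R k).
Local Notation D := (2 ^ k)%N.
Definition zsq (z : Z) : R := \sum_(t <- z) t ^+ 2.

Definition spherical_norm (a : R) (z : Z) : R :=
  N (fun j => cd_one j + cd_zeta a (nth 0 z) j).

Lemma spherical_normE (a : R) (z : Z) :
  spherical_norm a z = (1 + a) ^+ 2 + 4 * zsq z.
Proof.
rewrite /spherical_norm -N_cd_zeta; apply: cd_norm_ext => -[|j] _ //=.
by rewrite /cd_one /= add0r.
Qed.

Lemma zsq_ge0 z : 0 <= zsq z.
Proof. by apply: sumr_ge0 => t _; exact: sqr_ge0. Qed.

Lemma nspace_zsq : nspace (muZ k) (@scZ R k) zsq D.-1.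
Proof. exact: nspace_Z. Qed.

Lemma measurable_spherical_norm :
  measurable_fun setT (fun q : R' * Z => spherical_norm q.1 q.2).
Proof.
rewrite (_ : (fun q => _) = fun q => (1 + q.1) ^+ 2 + 4 * zsq q.2).
  by have h := ns_meas nspace_zsq; mfun.
by apply/funext => q; rewrite spherical_normE.
Qed.

(** Applied with b = 0 on the small group and b = |x_2|^2 on the large one. The scaling of z gives
    ((1 + b) (1 + |x|^2) / 2)^(d-1) and that of x gives (1 + b)^(pd/2). *)
Lemma spherical_scaling (b : R) (G : R' -> \bar R) : 0 <= b ->
  measurable_fun setT G -> (forall t, 0 <= G t)%E ->
  (\int[muX k p]_x \int[muZ k]_z
     G (ln (spherical_norm (b + nsq x) z)) =
   (2 ^- D.-1 * expR ((D.-1%:R + (p * D)%:R / 2) * ln (1 + b)))%:E *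
   \int[muX k p]_x \int[muZ k]_z
     ((expR (D.-1%:R * ln (1 + nsq x)))%:E *
      G (2 * ln (1 + b) + 2 * ln (1 + nsq x) + ln (1 + zsq z))%R))%E.
Proof.
move=> b0 mG G0.
have HX := @nspace_X R k p; have HZ := nspace_zsq.
have mX := ns_meas HX; have mZ := ns_meas HZ.
have c0 : 0 < 1 + b by rewrite ltr_pwDl.
have d0 (x : X) : 0 < 1 + nsq x by rewrite ltr_pwDl// nsq_ge0.
pose J (c : R') : \bar R := (\int[muZ k]_z G (2 * c + ln (1 + zsq z))%R)%E.
have mJ : measurable_fun setT J.
  by apply: (measurable_iterated (fun (c : R') (z : Z) => G (2 * c + ln (1 + zsq z)))) => //; mfun.
have J0 c : (0 <= J c)%E by apply: integral_ge0.
pose c2 : R := 2 ^- D.-1.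
pose H (x : X) : \bar R :=
  ((c2 * expR (D.-1%:R * ln (1 + b + nsq x)))%:E * J (ln (1 + b + nsq x)))%E.
have c20 : 0 < c2 by rewrite invr_gt0 exprn_gt0.
have mH : measurable_fun setT H by rewrite /H; mfun.
have H0 x : (0 <= H x)%E by rewrite mule_ge0// lee_fin mulr_ge0 ?expR_ge0// ltW.
transitivity (\int[muX k p]_x H x)%E.
  apply: eq_integral => x _.
  have M0 : 0 < 1 + b + nsq x by rewrite ltr_pwDl// nsq_ge0.
  have t0 : 0 < (1 + b + nsq x) / 2 by rewrite divr_gt0.
  have mf : measurable_fun setT (fun z : Z =>
      G (ln (spherical_norm (b + nsq x) z))).
    have h : measurable_fun setT (fun z : Z => spherical_norm (b + nsq x) z).
      by mcomp measurable_spherical_norm (fun z : Z => (b + nsq x, z)).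
    by mfun.
  have e := ns_integral_scale HZ t0 mf (fun z => G0 _).
  have -> : H x = ((((1 + b + nsq x) / 2) ^+ D.-1)%:E * J (ln (1 + b + nsq x)))%E.
    rewrite /H; congr (_%:E * _)%E.
    by rewrite expr_div_n expRM_natl lnK ?posrE// mulrC.
  have -> : J (ln (1 + b + nsq x)) = (\int[muZ k]_z
      G (ln (spherical_norm (b + nsq x) (scZ ((1 + b + nsq x) / 2) z))))%E.
    apply: eq_integral => z _; congr G; rewrite spherical_normE (ns_scale HZ) addrA.
    have -> : (1 + b + nsq x) ^+ 2 + 4 * (((1 + b + nsq x) / 2) ^+ 2 * zsq z) =
        (1 + b + nsq x) ^+ 2 * (1 + zsq z) by field.
    rewrite lnM ?posrE ?exprn_gt0// ?ltr_pwDl ?zsq_ge0//.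
    by rewrite lnXn// mulr_natl.
  by rewrite e muleA -EFinM mulfV ?mul1e// gt_eqF// exprn_gt0.
pose s := Num.sqrt (1 + b).
have s0 : 0 < s by rewrite sqrtr_gt0.
have s2 : s ^+ 2 = 1 + b by rewrite sqr_sqrtr// ltW.
have e := ns_integral_scale HX s0 mH H0.
have -> : (\int[muX k p]_x H x = (s ^+ (p * D))%:E * \int[muX k p]_x H (scX s x))%E.
  by rewrite e muleA -EFinM mulfV ?mul1e// gt_eqF// exprn_gt0.
have cc0 : 0 <= c2 * expR (D.-1%:R * ln (1 + b)) by rewrite mulr_ge0 ?expR_ge0// ltW.
pose K (x : X) : \bar R := (\int[muZ k]_z ((expR (D.-1%:R * ln (1 + nsq x)))%:E *
      G (2 * ln (1 + b) + 2 * ln (1 + nsq x) + ln (1 + zsq z))%R))%E.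
have K0 x : (0 <= K x)%E.
  by apply: integral_ge0 => z _; rewrite mule_ge0// lee_fin expR_ge0.
have mK : measurable_fun setT K.
  apply: (measurable_iterated (fun (x : X) (z : Z) => (expR (D.-1%:R * ln (1 + nsq x)))%:E *
      G (2 * ln (1 + b) + 2 * ln (1 + nsq x) + ln (1 + zsq z))%R))%E; first by mfun.
  by move=> x z; rewrite mule_ge0// lee_fin expR_ge0.
have HK x : (H (scX s x) = (c2 * expR (D.-1%:R * ln (1 + b)))%:E * K x)%E.
  have -> : K x = ((expR (D.-1%:R * ln (1 + nsq x)))%:E * J (ln (1 + b) + ln (1 + nsq x))%R)%E.
    have mg : measurable_fun setT (fun z : Z =>
      G (2 * ln (1 + b) + 2 * ln (1 + nsq x) + ln (1 + zsq z))) by mfun.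
    rewrite /K; have -> := ge0_integralZl_EFin (muZ k) measurableT (fun z _ => G0 _) mg
      (expR_ge0 (D.-1%:R * ln (1 + nsq x))).
    by congr (_ * _)%E; apply: eq_integral => z _; rewrite mulrDr.
  rewrite /H (ns_scale HX) s2.
  have -> : 1 + b + (1 + b) * nsq x = (1 + b) * (1 + nsq x) by ring.
  rewrite lnM ?posrE//; by rewrite muleA -EFinM mulrDr expRD mulrA.
have -> : (\int[muX k p]_x H (scX s x) =
    (c2 * expR (D.-1%:R * ln (1 + b)))%:E * \int[muX k p]_x K x)%E.
  rewrite -(ge0_integralZl_EFin (muX k p) measurableT (fun x _ => K0 x) mK cc0).
  by apply: eq_integral => x _; exact: HK.
rewrite muleA -EFinM; congr (_%:E * _)%E.
rewrite mulrCA; congr (_ * _); rewrite -[s]lnK ?posrE// -expRM_natl -expRD; congr expR.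
have -> : ln (1 + b) = 2 * ln s by rewrite -s2 lnXn// mulr_natl.
by field.
Qed.

End spherical_scaling.

Section spherical_integrals.
Context {R : realType} (k : nat).
Local Notation R' := (measurableTypeR R).
Local Notation X p := (p.-tuple (cdalg R k)).
Local Notation Z := ((2 ^ k).-1.-tuple R').
Local Notation D := (2 ^ k)%N.
Local Notation zsq := (@zsq R k).

Lemma beta_X p : exists2 C : R, 0 < C & forall b : R[i],
  (p == 0%N) || ((p * D)%:R / 2 < complex.Re b) ->
  cintegrable (muX k p) setT (fun x => cexp (- b) (ln (1 + nsq x))) /\
  Gam b * cintegral (muX k p) setT (fun x => cexp (- b) (ln (1 + nsq x))) =
  C%:C * Gam (b - ((p * D)%:R / 2)%:C).
Proof.
have := tuple_beta p (nspace_tuple (@nspace_lebesgue R) D).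
by rewrite muln1; apply; rewrite expn_gt0.
Qed.

Lemma beta_Z : exists2 C : R, 0 < C & forall b : R[i],
  (D.-1 == 0%N) || (D.-1%:R / 2 < complex.Re b) ->
  cintegrable (muZ k) setT (fun z => cexp (- b) (ln (1 + zsq z))) /\
  Gam b * cintegral (muZ k) setT (fun z => cexp (- b) (ln (1 + zsq z))) =
  C%:C * Gam (b - (D.-1%:R / 2)%:C).
Proof. by have := tuple_beta D.-1 (@nspace_lebesgue R); rewrite muln1; apply. Qed.

Lemma expR_cexpM (c d t : R) s : (expR (c * t))%:C * cexp s (d * t) = cexp (c%:C + d%:C * s) t.
Proof. by rewrite cexpDl cexp_real cexpM. Qed.

Lemma nspace_setT_neq0 d (T : measurableType d) (mu : {sigma_finite_measure set T -> \bar R})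
    sc N q : nspace mu sc N q -> mu setT != 0%E.
Proof.
move=> H; have mN := ns_meas H; have [c c0 Hc] := ns_gauss H.
apply/eqP => mu0; have := null_set_integral (f := fun x => (expR (- N x))%:E) measurableT _ mu0.
by rewrite Hc => /(_ ltac:(mfun)) [] c1; rewrite c1 ltxx in c0.
Qed.

Lemma cintegral_pos d (T : measurableType d) (mu : {measure set T -> \bar R}) (f : T -> R) :
  mu setT != 0%E -> (forall x, 0 < f x) -> cintegrable mu setT (fun x => (f x)%:C) ->
  exists2 c : R, 0 < c & cintegral mu setT (fun x => (f x)%:C) = c%:C.
Proof.
move=> muT f0 [fi _]; exists (\int[mu]_x f x); last first.
  rewrite /cintegral /=; congr (_ +i* _).
  by rewrite /Rintegral integral0.
rewrite lt_def; apply/andP; split; last by apply: Rintegral_ge0 => v _; rewrite ltW.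
have mf : measurable_fun setT f by apply/measurable_EFinP; exact: measurable_int fi.
have := integral_pos_neq0 mf f0 muT; have /fineK e := integrable_fin_num measurableT fi.
by apply: contraNN => /eqP h; rewrite -e /Rintegral in h *; rewrite h.
Qed.

Variable p : nat.
Local Notation rhoH := (rho k p.+1 : R).

Lemma measurable_E : measurable_fun setT
  (fun h : heis R k p.+1 => ln (spherical_norm (nsq h.1) h.2)).
Proof.
have mX := ns_meas (@nspace_X R k p).
have h1 : measurable_fun setT (fun h : heis R k p.+1 => spherical_norm (nsq h.1) h.2).
  by mcomp (@measurable_spherical_norm R k) (fun h : X p * Z => (nsq h.1, h.2)).
by mfun.
Qed.

Lemma natr_predD : D.-1%:R = D%:R - 1 :> R.
Proof. by rewrite -subn1 natrB// expn_gt0. Qed.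

(** Convergence follows from two beta integrals; the value is only known to be positive, as the
    integral of a positive function over a space of nonzero measure. *)
Lemma small_group_integral : exists2 c : R, 0 < c &
  cintegrable (heis_measure k p.+1) setT
    (fun h => cexp (- rhoH%:C) (ln (spherical_norm (nsq h.1) h.2))) /\
  cintegral (heis_measure k p.+1) setT
    (fun h => cexp (- rhoH%:C) (ln (spherical_norm (nsq h.1) h.2))) = c%:C.
Proof.
have mX := ns_meas (@nspace_X R k p); have mZ := ns_meas (@nspace_zsq R k).
have mE := measurable_E.
pose nu := sigma_finite_prod (muX k p) (muZ k : {sigma_finite_measure set _ -> \bar R}).
pose w' (q : X p * Z) : R := expR (D.-1%:R * ln (1 + nsq q.1)).
pose psi (q : X p * Z) : R := 2 * ln (1 + nsq q.1) + ln (1 + zsq q.2).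
have mw : measurable_fun setT w' by rewrite /w'; mfun.
have mpsi : measurable_fun setT psi by rewrite /psi; mfun.
have C0 : 0 <= 2 ^- D.-1 :> R by rewrite invr_ge0 exprn_ge0.
have law : same_law (heis_measure k p.+1) nu (fun=> 1) w'
    (fun h : heis R k p.+1 => ln (spherical_norm (nsq h.1) h.2)) psi (2 ^- D.-1).
  move=> G mG G0; under eq_integral do rewrite mul1e.
  have mf : measurable_fun setT
      (fun h : X p * Z => G (ln (spherical_norm (nsq h.1) h.2))) by mfun.
  have -> := integral_sigma_finite_prod (muX k p) (muZ k) mf (fun h => G0 _).
  have mg : measurable_fun setT (fun q : X p * Z => (w' q)%:E * G (psi q))%E by mfun.
  have g0 q : (0 <= (w' q)%:E * G (psi q))%E by rewrite mule_ge0// lee_fin expR_ge0.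
  have -> := integral_sigma_finite_prod (muX k p) (muZ k) mg g0.
  have := spherical_scaling k p (lexx 0) mG G0.
  rewrite addr0 ln1 !mulr0 expR0 mulr1.
  under eq_integral do under eq_integral do rewrite add0r.
  move=> ->; have -> // : (\int[muX k p]_x \int[muZ k]_z
        ((expR (D.-1%:R * ln (1 + nsq x)))%:E *
         G (0 + 2 * ln (1 + nsq x) + ln (1 + zsq z))%R) =
      \int[muX k p]_x \int[muZ k]_z ((w' (x, z))%:E * G (psi (x, z))))%E.
  by apply: eq_integral => x _; apply: eq_integral => z _; rewrite add0r.
have [mr mi] := measurable_cexp (- rhoH%:C) (@measurable_id _ R' setT).
have rhoHE : rhoH = (p * D)%:R / 2 + D.-1%:R.
  by rewrite /rho natr_predD -(natr1 p) natrX natrM natrX; field.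
(* The exponent of 1 + |y|^2 after the scaling of w: 2 rho_H from the integrand, less the d - 1 of
   the Jacobian. *)
pose b2 := (2 * rhoH - D.-1%:R)%:C.
have eb : (D.-1%:R : R)%:C + (2 : R)%:C * - rhoH%:C = - b2.
  by rewrite /b2 -!rmorphN -rmorphM -rmorphD; congr (_%:C); ring.
have e : (fun q => (w' q)%:C * cexp (- rhoH%:C) (psi q)) =
    (fun q => cexp (- b2) (ln (1 + nsq q.1)) * cexp (- rhoH%:C) (ln (1 + zsq q.2))).
  apply/funext => q; rewrite /psi (cexpD _ (2 * _)) mulrA.
  by rewrite (expR_cexpM D.-1%:R 2 (ln (1 + nsq q.1)) (- rhoH%:C)) eb.
have [Cx Cx0 HX] := beta_X p; have [Cz Cz0 HZ] := beta_Z.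
have P0 : 0 <= (p * D)%:R :> R by rewrite ler0n.
have E0 : 0 <= D.-1%:R :> R by rewrite ler0n.
have [ix _] : cintegrable (muX k p) setT (fun x => cexp (- b2) (ln (1 + nsq x))) /\ True.
  split=> //; apply: (HX b2 _).1; case: (posnP p) => [->//|p0]; apply/orP; right.
  have P1 : 0 < (p * D)%:R :> R by rewrite ltr0n muln_gt0 p0 expn_gt0.
  by rewrite /b2 /= rhoHE; lra.
have [iz _] : cintegrable (muZ k) setT (fun z => cexp (- rhoH%:C) (ln (1 + zsq z))) /\ True.
  split=> //; apply: (HZ rhoH%:C _).1.
  case: (posnP D.-1) => [->//|d0]; apply/orP; right.
  have E1 : 0 < D.-1%:R :> R by rewrite ltr0n.
  by rewrite /= rhoHE; lra.
have [i1 _] := cintegral_prod ix iz.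
have [] := cintegral_transfer law C0 (fun=> ler01) (fun q => expR_ge0 _)
  (measurable_cst _) mE mr mi ltac:(by rewrite e).
have -> : (fun h : heis R k p.+1 => (1 : R)%:C * cexp (- rhoH%:C) (ln (spherical_norm (nsq h.1) h.2)))
   = (fun h => cexp (- rhoH%:C) (ln (spherical_norm (nsq h.1) h.2))).
  by apply/funext => h; rewrite mul1r.
move=> ih _.
have er : (fun h : heis R k p.+1 => cexp (- rhoH%:C) (ln (spherical_norm (nsq h.1) h.2))) =
    (fun h => (expR (- rhoH * ln (spherical_norm (nsq h.1) h.2)))%:C).
  by apply/funext => h; rewrite -cexp_real rmorphN.
rewrite er in ih *.
have [|c c0 ->] := cintegral_pos _ (fun h => expR_gt0 _) ih; last by exists c.
exact: nspace_setT_neq0 (nspace_prod (@nspace_X R k p) (@nspace_Z R k)).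
Qed.

Variable l : nat.
Hypothesis l0 : (0 < l)%N.
Local Notation rhoG := (rho k (p + l).+1 : R).
Local Notation G := (heis R k (p + l).+1).

Definition log_height (g : G) : R := ln (nsq (rpart g)).
Definition log_spherical (g : G) : R :=
  ln (spherical_norm (nsq (rpart g) + nsq (lpart g)) g.2).

Lemma measurable_log_height : measurable_fun setT log_height.
Proof.
have mY := ns_meas (@nspace_X R k l); have mr := @measurable_rpart R k p l.
by rewrite /log_height; mfun.
Qed.

Lemma measurable_log_spherical : measurable_fun setT log_spherical.
Proof.
have mX := ns_meas (@nspace_X R k p); have mY := ns_meas (@nspace_X R k l).
have mr := @measurable_rpart R k p l; have ml := @measurable_lpart R k p l.
have h1 : measurable_fun setT
    (fun g : G => spherical_norm (nsq (rpart g) + nsq (lpart g)) g.2).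
  mcomp (@measurable_spherical_norm R k) (fun g : G => (nsq (rpart g) + nsq (lpart g), g.2)).
by rewrite /log_spherical; mfun.
Qed.

Local Notation nu := (sigma_finite_prod (muX k l)
  (sigma_finite_prod (muX k p) (muZ k : {sigma_finite_measure set _ -> \bar R}))).
Local Notation V := (X l * (X p * Z))%type.
Local Notation kap := (D.-1%:R + (p * D)%:R / 2 : R).

(** The integration over x_2 is moved outermost, so that [spherical_scaling] can be used with b =
    |x_2|^2 held fixed. *)
Lemma spherical_law : same_law (Z := (R' * R')%type) (heis_measure k (p + l).+1) nu (fun=> 1)
  (fun q : V => expR (kap * ln (1 + nsq q.1)) * expR (D.-1%:R * ln (1 + nsq q.2.1)))
  (fun g => (log_height g, log_spherical g))
  (fun q : V => (ln (nsq q.1),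
     2 * ln (1 + nsq q.1) + 2 * ln (1 + nsq q.2.1) + ln (1 + zsq q.2.2)))
  (2 ^- D.-1).
Proof.
move=> H mH H0; under eq_integral do rewrite mul1e.
have mX := ns_meas (@nspace_X R k p); have mY := ns_meas (@nspace_X R k l).
have mZ := ns_meas (@nspace_zsq R k).
pose f (x : X p) (y : X l) (z : Z) : \bar R :=
  H (ln (nsq y), ln (spherical_norm (nsq y + nsq x) z)).
have f0 x y z : (0 <= f x y z)%E by exact: H0.
have mf : measurable_fun setT (fun q : (X p * X l) * Z => f q.1.1 q.1.2 q.2).
  have h1 : measurable_fun setT
      (fun q : (X p * X l) * Z => spherical_norm (nsq q.1.2 + nsq q.1.1) q.2).
    mcomp (@measurable_spherical_norm R k)
      (fun q : (X p * X l) * Z => (nsq q.1.2 + nsq q.1.1, q.2)).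
  by rewrite /f; mfun.
have -> := integral_heis mf f0.
have mf' : measurable_fun setT (fun q : (X p * Z) * X l => f q.1.1 q.2 q.1.2).
  by mcomp mf (fun q : (X p * Z) * X l => ((q.1.1, q.2), q.1.2)).
transitivity (\int[muX k l]_y \int[muX k p]_x \int[muZ k]_z f x y z)%E.
  have mI : measurable_fun setT (fun u : X p * Z => \int[muX k l]_y f u.1 y u.2)%E.
    exact: (measurable_iterated (fun (u : X p * Z) (y : X l) => f u.1 y u.2)).
  have <- := integral_sigma_finite_prod (muX k p) (muZ k) mI
    (fun u => integral_ge0 _ (fun y _ => f0 _ y _)).
  have -> := tonelli (m1 := sigma_finite_prod (muX k p) (muZ k)) (m2 := muX k l)
    (fun (u : X p * Z) (y : X l) => f u.1 y u.2) mf' (fun u y => f0 _ y _).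
  apply: eq_integral => y _.
  have mfy : measurable_fun setT (fun u : X p * Z => f u.1 y u.2).
    by mcomp mf' (fun u : X p * Z => (u, y)).
  exact: (integral_sigma_finite_prod (muX k p) (muZ k) mfy (fun u => f0 _ y _)).
pose W (q : V) : \bar R := ((expR (kap * ln (1 + nsq q.1)) * expR (D.-1%:R * ln (1 + nsq q.2.1)))%:E *
  H (ln (nsq q.1), (2 * ln (1 + nsq q.1) + 2 * ln (1 + nsq q.2.1) + ln (1 + zsq q.2.2))%R))%E.
have W0 q : (0 <= W q)%E by rewrite mule_ge0// lee_fin mulr_ge0 ?expR_ge0.
have mA : measurable_fun setT (fun q : V => ln (1 + nsq q.1)) by mfun.
have mB : measurable_fun setT (fun q : V => ln (1 + nsq q.2.1)) by mfun.
have mC : measurable_fun setT (fun q : V => ln (1 + zsq q.2.2)) by mfun.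
have mA' : measurable_fun setT (fun q : V => ln (nsq q.1)) by mfun.
have mW : measurable_fun setT W.
  apply: emeasurable_funM; first by apply/measurable_EFinP; mfun.
  by mcomp mH (fun q : V => (ln (nsq q.1),
     2 * ln (1 + nsq q.1) + 2 * ln (1 + nsq q.2.1) + ln (1 + zsq q.2.2))).
have -> := integral_sigma_finite_prod (muX k l) (sigma_finite_prod (muX k p) (muZ k)) mW W0.
pose I (y : X l) : \bar R := (\int[sigma_finite_prod (muX k p) (muZ k)]_u W (y, u))%E.
have I0 y : (0 <= I y)%E by apply: integral_ge0.
have mI : measurable_fun setT I.
  by apply: (measurable_iterated (fun y u => W (y, u))) => //; mcomp mW (fun q : V => q).
have c0 : 0 <= 2 ^- D.-1 :> R by rewrite invr_ge0 exprn_ge0.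
have <- := ge0_integralZl_EFin (muX k l) measurableT (fun y _ => I0 y) mI c0.
apply: eq_integral => y _.
have mHy : measurable_fun setT (fun t : R' => H (ln (nsq y), t)) by mfun.
rewrite /f; have -> := spherical_scaling k p (nsq_ge0 y) mHy (fun t => H0 _).
rewrite EFinM -muleA; congr (_ * _)%E.
pose K (x : X p) (z : Z) : \bar R := ((expR (D.-1%:R * ln (1 + nsq x)))%:E *
   H (ln (nsq y), (2 * ln (1 + nsq y) + 2 * ln (1 + nsq x) + ln (1 + zsq z))%R))%E.
have K0 x z : (0 <= K x z)%E by rewrite mule_ge0// lee_fin expR_ge0.
have mK : measurable_fun setT (fun u : X p * Z => K u.1 u.2) by rewrite /K; mfun.
have <- := integral_sigma_finite_prod (muX k p) (muZ k) mK (fun u => K0 _ _).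
have <- := ge0_integralZl_EFin (sigma_finite_prod (muX k p) (muZ k)) measurableT
  (fun u _ => K0 u.1 u.2) mK (expR_ge0 (kap * ln (1 + nsq y))).
by apply: eq_integral => u _; rewrite /W /K EFinM muleA.
Qed.

End spherical_integrals.

Section large_group_integral.
Context {R : realType} (k p l : nat).
Hypothesis l0 : (0 < l)%N.
Local Notation R' := (measurableTypeR R).
Local Notation X p := (p.-tuple (cdalg R k)).
Local Notation Z := ((2 ^ k).-1.-tuple R').
Local Notation D := (2 ^ k)%N.
Local Notation rhoG := (rho k (p + l).+1 : R).
Local Notation rhoH := (rho k p.+1 : R).

Lemma ReD (x y : R[i]) : complex.Re (x + y) = complex.Re x + complex.Re y.
Proof. by case: x y => [a b] [c d]. Qed.

Lemma ReN (x : R[i]) : complex.Re (- x) = - complex.Re x.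
Proof. by case: x. Qed.

Lemma half_complex (x : R[i]) : x / 2 = (2^-1 : R)%:C * x.
Proof. by rewrite mulrC fmorphV rmorph_nat. Qed.

Lemma Re_half (x : R[i]) : complex.Re (x / 2) = complex.Re x / 2.
Proof. by rewrite half_complex Re_realM mulrC. Qed.

Lemma rhoH_eq : rhoH = (p * D)%:R / 2 + D.-1%:R.
Proof. by rewrite /rho natr_predD -(natr1 p) natrX natrM natrX; field. Qed.

Lemma rhoG_eq : rhoG = rhoH + (l * D)%:R / 2.
Proof. by rewrite /rho -(natr1 p) -(natr1 (p + l)) natrD natrM natrX; field. Qed.

(** With s = lambda + rho, the beta integrals over z, x_1 and x_2 have upper parameters s/2, s - d +
    1 and s - rho_H. The numerator Gamma(s - rho_H) of the second cancels the denominator of the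
    third, leaving Gamma((s - d + 1)/2) / (Gamma(s/2) Gamma(s - d + 1)) and the two factors
    containing nu. [Gam_ratio] rewrites the former as a power of 2 times Gamma((s + 1)/2) /
    (Gamma((s - d + 2)/2) Gamma(s)). *)
Lemma large_group_integral : exists2 c : R, 0 < c & forall lambda nu : R[i],
  complex.Re lambda = 0 -> complex.Re nu = 0 ->
  let F (g : heis R k (p + l).+1) :=
    cexp ((lambda - rhoG%:C + (rhoH%:C - nu)) / 2) (log_height g) *
    cexp (- ((lambda + rhoG%:C) / 2)) (log_spherical g) in
  cintegrable (heis_measure k (p + l).+1) setT F /\
  cintegral (heis_measure k (p + l).+1) setT F *
    (Gam ((lambda + rhoG%:C - D%:R + 2) / 2) * Gam (lambda + rhoG%:C)) =
  c%:C * (Gam ((lambda + rhoG%:C + 1) / 2) * Gam ((lambda + rhoG%:C - nu - rhoH%:C) / 2) *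
          Gam ((lambda + rhoG%:C + nu - rhoH%:C) / 2)).
Proof.
have q0 : (0 < l * D)%N by rewrite muln_gt0 l0 expn_gt0.
have [C1 C10 HZ] := @beta_Z R k; have [C2 C20 HX] := @beta_X R k p.
have [C3 C30 HY] := nspace_beta (@nspace_X R k l) q0.
exists (C1 * C2 * C3); first by rewrite !mulr_gt0.
move=> lambda nu hl hn F.
set P := (p * D)%:R : R; set E := D.-1%:R : R; set Lr := (l * D)%:R : R.
have P0 : 0 <= P by rewrite ler0n.
have E0 : 0 <= E by rewrite ler0n.
have Lr0 : 0 < Lr by rewrite ltr0n.
have eH : rhoH = P / 2 + E := rhoH_eq.
have eG : rhoG = rhoH + Lr / 2 := rhoG_eq.
move: eH eG @F; set rG := rhoG; set rH := rhoH => eH eG F.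
have eE : (D%:R : R[i]) = E%:C + 1.
  by rewrite /E natr_predD rmorphB rmorph1 subrK rmorph_nat.
pose s := lambda + rG%:C; pose sg := s / 2; pose a0 := (s - nu - rH%:C) / 2.
pose b3 := s - rH%:C; pose b2 := s - E%:C.
have two : (2 : R)%:C = 2 by rewrite rmorph_nat.
have halfC (x : R) : (x / 2)%:C = x%:C / 2 by rewrite rmorphM fmorphV rmorph_nat.
have DC (x y : R) : (x + y)%:C = x%:C + y%:C by rewrite rmorphD.
have eHC : rH%:C = P%:C / 2 + E%:C.
  by rewrite eH DC halfC.
have Rs : complex.Re s = rG by rewrite /s ReD hl add0r.
have Rsg : complex.Re sg = rG / 2 by rewrite /sg Re_half Rs.
have Ra0 : complex.Re a0 = (rG - rH) / 2 by rewrite /a0 Re_half !(ReD, ReN) hl hn /=; lra.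
have Rb3 : complex.Re b3 = rG - rH by rewrite /b3 !(ReD, ReN) hl /=; lra.
have Rb2 : complex.Re b2 = rG - E by rewrite /b2 !(ReD, ReN) hl /=; lra.
have sg0 : 0 < complex.Re sg by rewrite Rsg; lra.
have b20 : 0 < complex.Re b2 by rewrite Rb2; lra.
have b30 : 0 < complex.Re b3 by rewrite Rb3; lra.
have [iz I1] : cintegrable (muZ k) setT (fun z => cexp (- sg) (ln (1 + zsq z))) /\
    Gam sg * cintegral (muZ k) setT (fun z => cexp (- sg) (ln (1 + zsq z))) =
    C1%:C * Gam (sg - (E / 2)%:C).
  by apply: HZ; apply/orP; right; rewrite Rsg -/E; lra.
have [ix I2] : cintegrable (muX k p) setT (fun x => cexp (- b2) (ln (1 + nsq x))) /\
    Gam b2 * cintegral (muX k p) setT (fun x => cexp (- b2) (ln (1 + nsq x))) =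
    C2%:C * Gam (b2 - (P / 2)%:C).
  by apply: HX; apply/orP; right; rewrite Rb2 -/P; lra.
have [iy I3] : cintegrable (muX k l) setT
     (fun y => cexp (a0 - (Lr / 2)%:C) (ln (nsq y)) * cexp (- b3) (ln (1 + nsq y))) /\
    Gam b3 * cintegral (muX k l) setT
     (fun y => cexp (a0 - (Lr / 2)%:C) (ln (nsq y)) * cexp (- b3) (ln (1 + nsq y))) =
    C3%:C * (Gam (b3 - a0) * Gam a0).
  by apply: HY; rewrite Ra0 ?Rb3; lra.
have [ixz Ixz] := cintegral_prod ix iz.
have [iv Iv] := cintegral_prod iy ixz.
have law := @spherical_law R k p l.
have F1 : cmeasurable (fun q : R' * R' =>
    cexp ((lambda - rG%:C + (rH%:C - nu)) / 2) q.1 * cexp (- sg) q.2).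
  by apply: cmeasurableM; apply: measurable_cexp; mfun.
have law0 (q : X l * (X p * Z)) : 0 <= expR ((E + P / 2) * ln (1 + nsq q.1)) *
    expR (E * ln (1 + nsq q.2.1)) by rewrite mulr_ge0 ?expR_ge0.
have mphi : measurable_fun setT
    (fun g : heis R k (p + l).+1 => (log_height g, log_spherical g)).
  apply: measurable_fun_pair; [exact: measurable_log_height|exact: measurable_log_spherical].
have c0 : 0 <= 2 ^- D.-1 :> R by rewrite invr_ge0 exprn_ge0.
have eb3 : (E + P / 2)%:C + (2 : R)%:C * - sg = - b3.
  by rewrite two /sg /b3 eHC DC halfC; field.
have eb2 : E%:C + (2 : R)%:C * - sg = - b2 by rewrite two /sg /b2; field.
(* The exponent of |x_2|^2 takes the form required by [nspace_beta] because rho - rho_H = ld / 2. *)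
have ea : (lambda - rG%:C + (rH%:C - nu)) / 2 = a0 - (Lr / 2)%:C.
  have -> : (Lr / 2)%:C = rG%:C - rH%:C by rewrite eG DC addrAC subrr add0r.
  by rewrite /a0 /s; field.
pose H (q : R' * R') := cexp ((lambda - rG%:C + (rH%:C - nu)) / 2) q.1 * cexp (- sg) q.2.
have e : (fun q : X l * (X p * Z) => (expR ((E + P / 2) * ln (1 + nsq q.1)) *
    expR (E * ln (1 + nsq q.2.1)))%:C *
    H (ln (nsq q.1), 2 * ln (1 + nsq q.1) + 2 * ln (1 + nsq q.2.1) + ln (1 + zsq q.2.2))) =
   (fun q => (cexp (a0 - (Lr / 2)%:C) (ln (nsq q.1)) * cexp (- b3) (ln (1 + nsq q.1))) *
    (cexp (- b2) (ln (1 + nsq q.2.1)) * cexp (- sg) (ln (1 + zsq q.2.2)))).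
  apply/funext => -[y [x z]]; rewrite /H ea.
  move: (ln (1 + nsq y)) (ln (1 + nsq x)) (ln (1 + zsq z)) (ln (nsq y)) => A B C t.
  rewrite (rmorphM _ (expR ((E + P / 2) * A))) -eb3 -eb2 -!expR_cexpM.
  rewrite (cexpD (- sg) (2 * A + 2 * B)) (cexpD (- sg) (2 * A)).
  by ring.
have [] := cintegral_transfer law c0 (fun=> ler01) law0 (measurable_cst _) mphi F1.1 F1.2.
  by rewrite -/H e.
rewrite -/H e Iv Ixz.
have -> : (fun g : heis R k (p + l).+1 => (1 : R)%:C * H (log_height g, log_spherical g)) = F.
  by apply/funext => g; rewrite mul1r.
move=> iF ->; split => //.
set A1 := cintegral (muZ k) _ _ in I1 *; set A2 := cintegral (muX k p) _ _ in I2 *.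
set A3 := cintegral (muX k l) _ _ in I3 *.
have g1 : Gam sg != 0 by exact: Gam_neq0 sg0.
have g2 : Gam b2 != 0 by exact: Gam_neq0 b20.
have g3 : Gam b3 != 0 by exact: Gam_neq0 b30.
have Hr := @Gam_ratio R D.-1 b2 b20.
have t1 : b2 / 2 = sg - (E / 2)%:C by rewrite /b2 /sg halfC; field.
have t2 : b2 + D.-1%:R = s.
  by have -> : (D.-1%:R : R[i]) = E%:C; [rewrite /E rmorph_nat|rewrite /b2 subrK].
have t3 : (b2 + 1) / 2 = (s - D%:R + 2) / 2 by rewrite eE /b2; field.
have t4 : b2 - (P / 2)%:C = b3 by rewrite /b2 /b3 eHC halfC; ring.
have t5 : b3 - a0 = (s + nu - rH%:C) / 2 by rewrite /b3 /a0; field.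
rewrite t1 t2 t3 -/sg in Hr; rewrite t4 in I2; rewrite t5 in I3.
rewrite -/s -/a0.
have c2E : (2 ^- D.-1 : R)%:C * 2 ^+ D.-1 = 1.
  by rewrite fmorphV rmorphXn /= rmorph_nat mulVf// expf_neq0// pnatr_eq0.
(* The beta identities determine the integrals only after multiplication by these Gamma values,
   which are nonzero. *)
apply: (mulfI g1); apply: (mulfI g2); apply: (mulfI g3).
have MC (x y : R) : (x * y)%:C = x%:C * y%:C by rewrite rmorphM.
rewrite (MC (C1 * C2) C3) (MC C1 C2).
set GA := Gam (sg - _) in I1 Hr; set X := Gam (_ / 2) in Hr *; set Y := Gam ((s + 1) / 2) in Hr *.
set V := Gam ((s + nu - _) / 2) in I3 *.
set c2 := (2 ^- D.-1 : R)%:C in c2E *; set e2 := 2 ^+ D.-1 in c2E Hr.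
move: c2 e2 c2E Hr => c2 e2 c2E Hr.
transitivity (c2 * (Gam b3 * A3) * (Gam b2 * A2) * (Gam sg * A1) * (X * Gam s)).
  by ring.
rewrite I1 I2 I3.
transitivity (c2 * C1%:C * C2%:C * C3%:C * V * Gam a0 * Gam b3 * (GA * X * Gam s)).
  by ring.
rewrite Hr.
transitivity (c2 * e2 * (C1%:C * C2%:C * C3%:C * V * Gam a0 * Gam b3 * (Gam sg * Y * Gam b2))).
  by ring.
by rewrite c2E mul1r; ring.
Qed.

End large_group_integral.

(** * Evaluation of the form *)

Section intertwining_form.
Context {R : realType} (k p l : nat).
Hypotheses (k3 : (k <= 3)%N) (assoc : (k <= 2)%N \/ p = 0%N) (l0 : (0 < l)%N).
Local Notation R' := (measurableTypeR R).
Local Notation X p := (p.-tuple (cdalg R k)).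
Local Notation Z := ((2 ^ k).-1.-tuple R').
Local Notation D := (2 ^ k)%N.
Local Notation rhoG := (rho k (p + l).+1 : R).
Local Notation rhoH := (rho k p.+1 : R).
Local Notation G := (heis R k (p + l).+1).
Local Notation H := (heis R k p.+1).
Local Notation pi := (sigma_finite_prod (heis_measure k (p + l).+1) (heis_measure k p.+1)).

Definition log_Q (q : G * H) : R :=
  ln (Qpoly k (crd q.2.1) (nth 0 q.2.2) (crd (lpart q.1)) (nth 0 q.1.2)
    (nsq (rpart q.1) + nsq (lpart q.1))).
Definition log_E (h : H) : R := ln (spherical_norm (nsq h.1) h.2).

Lemma measurable_log_Q : measurable_fun setT log_Q.
Proof.
have mX := ns_meas (@nspace_X R k p); have mY := ns_meas (@nspace_X R k l).
have mr := @measurable_rpart R k p l; have ml := @measurable_lpart R k p l.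
rewrite /log_Q; apply: (measurableT_comp (@measurable_ln R)).
apply: measurable_cd_norm => j; apply: measurable_funB; first apply: measurable_funD.
- by apply: measurable_cd_zeta => [|i]; [mfun|apply: measurable_nth0; mfun].
- apply: measurable_cd_conj => i; apply: measurable_cd_zeta => [|i'].
    by apply: measurable_fnorm => i' j'; apply: measurable_crd; mfun.
  by apply: measurable_nth0; mfun.
- apply: measurable_funM; first by mfun.
  apply: measurable_fprod => i j'; first by apply: measurable_crd; mfun.
  by apply: measurable_crd; mfun.
Qed.

Definition joint_weight (q : G * H) : R := expR (- (rhoG * log_height q.1)).

(** For fixed (y, w), [heis_siegel] passes to the domain, [siegel_law] replaces Q by E there, and
    [heis_siegel] leads back. The component [log_E] is carried along so that the test function may
    depend on (y, w). *)
Lemma joint_law : same_law (Z := (R' * (R' * R'))%type) pi pi joint_weight joint_weight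
  (fun q => (log_Q q - log_height q.1, (log_spherical q.1 - log_height q.1, log_E q.2)))
  (fun q => (log_E q.2 - log_height q.1, (log_spherical q.1 - log_height q.1, log_E q.2))) 1.
Proof.
move=> F mF F0; rewrite mul1e.
have mh := @measurable_log_height R k p l; have ms := @measurable_log_spherical R k p l.
have mE : measurable_fun setT log_E := @measurable_E R k p; have mQ := measurable_log_Q.
have mw : measurable_fun setT joint_weight by rewrite /joint_weight; mfun.
have w0 q : 0 <= joint_weight q by exact: expR_ge0.
have F1 u q : (0 <= (joint_weight q)%:E * F u)%E by rewrite mule_ge0// lee_fin w0.
pose Phi (q : G * H) : R' * (R' * R') :=
  (log_Q q - log_height q.1, (log_spherical q.1 - log_height q.1, log_E q.2)).
pose Psi (q : G * H) : R' * (R' * R') :=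
  (log_E q.2 - log_height q.1, (log_spherical q.1 - log_height q.1, log_E q.2)).
have mPhi : measurable_fun setT Phi by rewrite /Phi; mfun.
have mPsi : measurable_fun setT Psi by rewrite /Psi; mfun.
have m1 : measurable_fun setT (fun q : G * H => (joint_weight q)%:E * F (Phi q))%E by mfun.
have m2 : measurable_fun setT (fun q : G * H => (joint_weight q)%:E * F (Psi q))%E by mfun.
have -> := integral_sigma_finite_prod_swap (heis_measure k (p + l).+1) (heis_measure k p.+1)
  m1 (fun q => F1 _ q).
have -> := integral_sigma_finite_prod_swap (heis_measure k (p + l).+1) (heis_measure k p.+1)
  m2 (fun q => F1 _ q).
apply: eq_integral => h _.
have [C C0 HS] := @heis_siegel R k p l l0.
have mFh : measurable_fun setT (fun u : R' * R' => F (u.1, (u.2, log_E h))).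
  by mcomp mF (fun u : R' * R' => (u.1, (u.2, log_E h))).
have law := siegel_law k3 assoc (crd h.1) (nth 0 h.2) mFh (fun u => F0 _).
have mht := @measurable_height R k p; have m1' := @measurable_N_zeta1 R k p.
have mQ' := @measurable_Qpoly R k p (crd h.1) (nth 0 h.2).
pose phi (q : X p * (Z * R')) : R' * (R' * R') :=
  (ln (Qpoly k (crd h.1) (nth 0 h.2) (crd q.1) (nth 0 q.2.1) q.2.2) - ln (height q),
   (ln (cd_norm k (zeta1 q)) - ln (height q), log_E h)).
pose psi (q : X p * (Z * R')) : R' * (R' * R') :=
  (log_E h - ln (height q), (ln (cd_norm k (zeta1 q)) - ln (height q), log_E h)).
have mphi : measurable_fun setT phi by rewrite /phi; mfun.
have mpsi : measurable_fun setT psi by rewrite /psi; mfun.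
have heightE (g : G) : height (lpart g, (g.2, nsq (rpart g) + nsq (lpart g))) = nsq (rpart g).
  by rewrite /height /= addrK.
have e1 := HS (F \o phi) (measurableT_comp mF mphi) (fun q => F0 _).
have e2 := HS (F \o psi) (measurableT_comp mF mpsi) (fun q => F0 _).
transitivity (C%:E * siegel_mass (F \o phi))%E.
  rewrite -e1; apply: eq_integral => g _; congr (_ * F _)%E.
  by rewrite /phi heightE.
have -> : siegel_mass (F \o phi) = siegel_mass (F \o psi).
  have eE : log_E h = ln (cd_norm k (fun j => cd_one j +
      cd_zeta (fnorm k (crd h.1)) (nth 0 h.2) j)) by rewrite /log_E /spherical_norm fnorm_crd.
  rewrite (_ : psi = fun q => (ln (cd_norm k (fun j => cd_one j +
      cd_zeta (fnorm k (crd h.1)) (nth 0 h.2) j)) - ln (height q),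
      (ln (cd_norm k (zeta1 q)) - ln (height q), log_E h))); first exact: law.
  by apply/funext => q; rewrite /psi {1}eE.
rewrite -e2; apply: eq_integral => g _; congr (_ * F _)%E.
by rewrite /psi heightE.
Qed.

Lemma ln_sqrt (t : R) : 0 <= t -> ln (Num.sqrt t) = 2^-1 * ln t.
Proof.
rewrite le_eqVlt => /predU1P[<-|t0]; first by rewrite sqrtr0 ln0// mulr0.
rewrite -{2}(sqr_sqrtr (ltW t0)) lnXn ?sqrtr_gt0// -(mulr_natr (ln _)); by field.
Qed.

Lemma cat_parts (g : G) : g.1 = cat_tuple (lpart g) (rpart g).
Proof.
apply: eq_from_tnth => i; rewrite -(@splitK p l i); case: (fintype.split i) => j /=.
  by rewrite tnth_lshift tnth_mktuple.
by rewrite tnth_rshift tnth_mktuple.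
Qed.

Lemma joint_weightE (q : G * H) : (joint_weight q)%:C = cexp (- rhoG)%:C (log_height q.1).
Proof. by rewrite cexp_real mulNr. Qed.

(** The integrand is r^(-2 rho) times powers of Q / r^2, R / r^2 and E alone: the exponents of r^2
    add up as - rho + (rho_H - nu)/2 + (lambda + rho)/2 = (lambda - rho + rho_H - nu)/2, the one in
    the kernel. The identity holds at every point, including x_2 = 0, by the convention for [ln] at
    0. *)
Lemma ell_integrandE (lambda nu : R[i]) (g : G) (h : H) :
  ell_integrand lambda nu (spherical lambda) (spherical nu) g h =
  (joint_weight (g, h))%:C *
  (cexp (- ((rhoH%:C - nu) / 2)) (log_Q (g, h) - log_height g) *
   (cexp (- ((lambda + rhoG%:C) / 2)) (log_spherical g - log_height g) *
    cexp (- ((nu + rhoH%:C) / 2)) (log_E h))).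
Proof.
have two : (2 : R)%:C = 2 by rewrite rmorph_nat.
have halfC : (2^-1 : R)%:C = 2^-1 by rewrite fmorphV rmorph_nat.
have quarterC : (4^-1 : R)%:C = 4^-1 by rewrite fmorphV rmorph_nat.
have nsqE : \sum_(a <- drop p g.1) \sum_(t <- (a : seq R)) t ^+ 2 = nsq (rpart g).
  by rewrite cat_parts [val _]/= (drop_size_cat _ (size_tuple (lpart g))).
have e1 : cpow (heis_norm (heis_mul (heis_opp g) (heis_embed (p + l).+1 h)))
    (- (2 * (- nu + rhoH%:C))) = cexp (- ((rhoH%:C - nu) / 2)) (log_Q (g, h)).
  rewrite cpow_cexp heis_norm_Qpoly// ln_powR -/(log_Q (g, h)) cexpM quarterC.
  have -> // : 4^-1 * - (2 * (- nu + rhoH%:C)) = - ((rhoH%:C - nu) / 2) by field.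
have e2 : cpow (vnorm (drop p g.1)) (lambda - rhoG%:C + (- nu + rhoH%:C)) =
    cexp ((lambda - rhoG%:C + (- nu + rhoH%:C)) / 2) (log_height g).
  by rewrite cpow_cexp /vnorm nsqE ln_sqrt ?nsq_ge0// cexpM halfC mulrC.
have e3 : spherical lambda g = cexp (- ((lambda + rhoG%:C) / 2)) (log_spherical g).
  rewrite /spherical cpow_cexp vnorm_sqr /log_spherical spherical_normE /inorm sqr_sqrtr ?zsq_ge0//.
  by rewrite {1}/nsq {1}cat_parts /= big_cat /= addrC.
have e4 : spherical nu h = cexp (- ((nu + rhoH%:C) / 2)) (log_E h).
  by rewrite /spherical cpow_cexp vnorm_sqr /log_E spherical_normE /inorm sqr_sqrtr// zsq_ge0.
rewrite /ell_integrand /kern e1 e2 e3 e4 joint_weightE /=.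
rewrite (cexpD _ (log_Q _)) (cexpD _ (log_spherical _)) -!cexpN.
have -> : (lambda - rhoG%:C + (- nu + rhoH%:C)) / 2 =
    (- rhoG)%:C + - - ((rhoH%:C - nu) / 2) + - - ((lambda + rhoG%:C) / 2).
  by rewrite rmorphN; field.
rewrite (cexpDl (_ + _)) cexpDl.
move: (cexp _ _) (cexp _ _) (cexp _ _) (cexp _ _) (cexp _ _) (cexp _ _) => A B C' D' E' F'.
by ring.
Qed.

Lemma ell_mod_spherical : exists2 c : R, 0 < c & forall lambda nu : R[i],
  complex.Re lambda = 0 -> complex.Re nu = 0 ->
  let phi := spherical lambda : G -> R[i] in let psi := spherical nu : H -> R[i] in
  ell_mod_cvg lambda nu phi psi /\
  ell_mod lambda nu phi psi *
    (Gam ((lambda + rhoG%:C - D%:R + 2) / 2) * Gam (lambda + rhoG%:C)) =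
  c%:C * (Gam ((lambda + rhoG%:C + 1) / 2) * Gam ((lambda + rhoG%:C - nu - rhoH%:C) / 2) *
          Gam ((lambda + rhoG%:C + nu - rhoH%:C) / 2)).
Proof.
have [c1 c10 hG] := @large_group_integral R k p l l0.
have [c2 c20 [iH IH]] := @small_group_integral R k p.
exists (c1 * c2); first by rewrite mulr_gt0.
move=> lambda nu hl hn phi psi; have [iG IG] := hG _ _ hl hn.
have [ip Ip] := cintegral_prod iG iH.
pose F (u : R' * (R' * R')) := cexp (- ((rhoH%:C - nu) / 2)) u.1 *
  (cexp (- ((lambda + rhoG%:C) / 2)) u.2.1 * cexp (- ((nu + rhoH%:C) / 2)) u.2.2).
have mF : cmeasurable F.
  apply: cmeasurableM; first by apply: measurable_cexp; mfun.
  by apply: cmeasurableM; apply: measurable_cexp; mfun.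
have mh := @measurable_log_height R k p l; have ms := @measurable_log_spherical R k p l.
have mE : measurable_fun setT log_E := @measurable_E R k p; have mQ := measurable_log_Q.
have mw : measurable_fun setT joint_weight by rewrite /joint_weight; mfun.
have mPhi : measurable_fun setT (fun q : G * H =>
    (log_Q q - log_height q.1, (log_spherical q.1 - log_height q.1, log_E q.2))) by mfun.
have eF : (fun q : G * H => (joint_weight q)%:C *
    F (log_E q.2 - log_height q.1, (log_spherical q.1 - log_height q.1, log_E q.2))) =
  (fun q : G * H => (cexp ((lambda - rhoG%:C + (rhoH%:C - nu)) / 2) (log_height q.1) *
    cexp (- ((lambda + rhoG%:C) / 2)) (log_spherical q.1)) *
    cexp (- rhoH%:C) (ln (spherical_norm (nsq q.2.1) q.2.2))).
  apply/funext => -[g h]; rewrite /F /= joint_weightE /= -/(log_E h).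
  rewrite (cexpD _ (log_E _)) (cexpD _ (log_spherical _)) -!cexpN.
  have -> : (lambda - rhoG%:C + (rhoH%:C - nu)) / 2 =
      (- rhoG)%:C + - - ((rhoH%:C - nu) / 2) + - - ((lambda + rhoG%:C) / 2).
    by rewrite rmorphN; field.
  (* Once Q has become E, its exponent and that of [spherical nu] add up to - rho_H: the integral
     over the small group no longer depends on nu. *)
  have -> : - rhoH%:C = - ((rhoH%:C - nu) / 2) + - ((nu + rhoH%:C) / 2) by field.
  rewrite (cexpDl (_ + _)) (cexpDl (- rhoG)%:C) (cexpDl (- ((rhoH%:C - nu) / 2))).
  by ring.
have eI : (fun q : G * H => (joint_weight q)%:C *
    F (log_Q q - log_height q.1, (log_spherical q.1 - log_height q.1, log_E q.2))) =
  (fun q => ell_integrand lambda nu phi psi q.1 q.2).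
  by apply/funext => -[g h]; rewrite ell_integrandE.
have [] := cintegral_transfer joint_law ler01 (fun q => expR_ge0 _) (fun q => expR_ge0 _)
  mw mPhi mF.1 mF.2.
  by rewrite -/F eF.
rewrite -/F eI eF => iI II; split; first exact: iI.
rewrite /ell_mod (cintegral_iterated iI) II Ip IH mul1r.
have -> : (c1 * c2)%:C = c1%:C * c2%:C by rewrite rmorphM.
by rewrite mulrAC IG mulrAC.
Qed.

End intertwining_form.

(* k = 0, 1, 2, 3 stands for F = R, C, H, O, and d = 2 ^ k. *)
Theorem theorem3p1 (R : realType) (k n m : nat)
    (hF : (k <= 2)%N /\ (2 <= n)%N \/ k = 3%N /\ n = 2%N)
    (hm : (1 <= m <= n.-1)%N) :
  exists c : R, 0 < c /\
    forall lambda nu : R[i], complex.Re lambda = 0 -> complex.Re nu = 0 ->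
      let d := (2 ^ k)%:R : R[i] in
      let rhoG := (rho k n : R)%:C in
      let rhoH := (rho k m : R)%:C in
      let phi := spherical lambda : heis R k n -> R[i] in
      let psi := spherical nu : heis R k m -> R[i] in
      ell_mod_cvg lambda nu phi psi /\
      ell_mod lambda nu phi psi =
        c%:C *
        (cGamma ((lambda + rhoG + 1) / 2) *
         cGamma ((lambda + rhoG - nu - rhoH) / 2) *
         cGamma ((lambda + rhoG + nu - rhoH) / 2) /
         (cGamma ((lambda + rhoG - d + 2) / 2) * cGamma (lambda + rhoG))).
Proof.
have [p mE] : exists p, m = p.+1 by exists m.-1; rewrite prednK//; case/andP: hm.
have [l l0 nE] : exists2 l, (0 < l)%N & n = (p + l).+1.
  by exists (n - m)%N; lia.
have k3 : (k <= 3)%N by lia.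
have assoc : (k <= 2)%N \/ p = 0%N by lia.
subst m n; have [c c0 hc] := @ell_mod_spherical R k p l k3 assoc l0.
have [C C0 hC] := @cGamma_Gam R.
(* Each [cGamma] is C times [Gam]; three of them stand in the numerator and two in the denominator,
   which leaves one factor C. *)
exists (c / C); split; first exact: divr_gt0.
move=> lambda nu hl hn d rG rH phi psi; have [cvg val] := hc _ _ hl hn; split=> //.
have P0 : 0 <= (p * 2 ^ k)%:R :> R by rewrite ler0n.
have E0 : 0 <= (2 ^ k).-1%:R :> R by rewrite ler0n.
have L0 : 0 < (l * 2 ^ k)%:R :> R by rewrite ltr0n muln_gt0 l0 expn_gt0.
have eH := @rhoH_eq R k p; have eG := @rhoG_eq R k p l.
have eD := @natr_predD R k.
have Rd : complex.Re d = (2 ^ k)%:R by rewrite /d -(rmorph_nat (real_complex R)).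
have R1 : complex.Re (1 : R[i]) = 1 by [].
(* Positivity of the real parts of the five arguments, needed because [cGamma] is Euler's integral.
   For the two arguments containing nu the real part is (rho - rho_H)/2, positive because m < n. *)
have r1 : 0 < complex.Re ((lambda + rG + 1) / 2).
  by rewrite Re_half !(ReD, ReN) hl R1 /=; lra.
have r2 : 0 < complex.Re ((lambda + rG - nu - rH) / 2).
  by rewrite Re_half !(ReD, ReN) hl hn /=; lra.
have r3 : 0 < complex.Re ((lambda + rG + nu - rH) / 2).
  by rewrite Re_half !(ReD, ReN) hl hn /=; lra.
have r4 : 0 < complex.Re ((lambda + rG - d + 2) / 2).
  by rewrite Re_half !(ReD, ReN) hl Rd R1 /=; lra.
have r5 : 0 < complex.Re (lambda + rG).
  by rewrite !(ReD, ReN) hl /=; lra.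
have CC : C%:C != 0 by rewrite (fmorph_eq0 (real_complex R)) gt_eqF.
have e : (c / C)%:C = c%:C / C%:C by rewrite rmorphM fmorphV.
have h4 := Gam_neq0 r4; have h5 := Gam_neq0 r5.
rewrite !hC// e; apply: (mulIf (mulf_neq0 h4 h5)); rewrite val.
rewrite -/rG -/rH -/d; move: (Gam _) (Gam _) (Gam _) => g1 g2 g3.
set g4 := Gam _ in h4 *; set g5 := Gam _ in h5 *.
by field; rewrite CC h4 h5.
Qed.
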